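(* Let $(X,\mathcal V)$ be a regular dynamic pair on a manifold $M$ and let $c\colon[0,T]\to M$ be an integral curve of $X$ which is not a closed orbit. (i) If the curvature matrix $K_t=K(c(t))$, $t\in[0,T]$, has an invariant one-dimensional subspace which is parallel with respect to $D_X$ along $c$ and the corresponding eigenvalue satisfies $$\lambda(t)\ge\kappa>0,\qquad t\in(0,T],$$ (equivalently, the normal curvature matrix $K_t$ on $c$ has a one-dimensional diagonal block with the eigenvalue satisfying this inequality), then there is a conjugate time in $(0,\pi/\sqrt\kappa\,]$, provided that $\pi/\sqrt\kappa\le T$. (ii) Moreover, if there are $r$ such subspaces with the eigenvalues $\lambda_1(t),\dots,\lambda_r(t)$, then the set of conjugate points along $c$ of the pair $(X,\mathcal V)$ includes all zeros on $(0,T]$ of solutions of the equations $$\ddot y_i=-\lambda_i(t)\,y_i,\qquad i=1,\dots,r,$$ with initial conditions $y_i(0)=0$, $\dot y_i(0)\ne0$ (if $t^*$ is a common zero of $k$ of these equations then it is a conjugate point of multiplicity $k$ or larger).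
   Context: All data are $C^\infty$. A dynamic pair $(X,\mathcal V)$ on a manifold $M$ consists of a vector field $X$ and a smooth distribution $\mathcal V\subset TM$ of rank $m$. Put $\mathcal D=\mathcal V+[X,\mathcal V]$ (spanned by the sections $V$ of $\mathcal V$ and the brackets $[X,V]$). The pair is regular if $X(x)\ne0$ for all $x$, $\operatorname{rk}\mathcal D=2m$, and $[X,\mathcal D]\subset\mathcal D$. Curvature. For a local frame $\hat W=(W_1,\dots,W_m)$ of $\mathcal V$ (a row vector) there are unique $m\times m$ matrices of functions $H_0,H_1$ with $[X,[X,\hat W]]=\hat W H_0+[X,\hat W]H_1$. The curvature matrix in the frame $\hat W$ is $K=-H_0+\frac12X(H_1)-\frac14H_1^2$; it is the matrix of a well-defined (frame-independent) bundle endomorphism $K\colon\mathcal V\to\mathcal V$, the curvature operator. A section $V$ of $\mathcal V$ is normal if $[X,[X,V]]\in\mathcal V$, and a normal frame is a frame of $\mathcal V$ consisting of normal sections; along $c$ there is a unique normal frame with any prescribed value at $c(0)$. The normal curvature matrix along $c$ is the curvature matrix, as a function of $t$, expressed in a normal frame along $c$. Covariant derivative. The distribution $\mathcal H=\operatorname{span}\{[X,V_1],\dots,[X,V_m]\}$, for a normal frame $V_1,\dots,V_m$, does not depend on the normal frame and $\mathcal D=\mathcal V\oplus\mathcal H$, with projection $\pi_{\mathcal V}\colon\mathcal D\to\mathcal V$. For a section $V$ of $\mathcal V$, $D_XV:=\pi_{\mathcal V}[X,V]$; in a normal frame $D_X(\sum f^iV_i)=\sum X(f^i)V_i$, and this also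 defines $D_X$ on sections along $c$ (with $X$ acting as $d/dt$). A field of one-dimensional subspaces of $\mathcal V$ along $c$ is parallel with respect to $D_X$ if it is spanned by a nonvanishing section $V$ of $\mathcal V$ along $c$ with $D_XV=0$. Conjugate points. A number $t^*\in(0,T]$ is a conjugate time, and $c(t^* )$ is a conjugate point (to $c(0)$ on $c$), if $\exp(t^*X)_*\mathcal V(c(0))\cap\mathcal V(c(t^* ))\ne\{0\}$, where $\exp(tX)$ is the flow of $X$; the dimension of this intersection is the multiplicity of $t^*$ or $c(t^* )$. In (ii) conjugate points are identified with the corresponding conjugate times.
   Formalization: In (ii), the claim that a common zero of k equations has multiplicity at least k is stated only when the k one-dimensional subspaces concerned are linearly independent along c; without this it fails, e.g. for K = κ·Id of rank 2 with three parallel lines. *)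

(* Defs.v *)
From HB Require Import structures.
From mathcomp Require Import all_boot all_order all_algebra.
From mathcomp Require Import all_classical all_reals all_analysis.
Set Implicit Arguments.
Unset Strict Implicit.
Unset Printing Implicit Defensive.
Import Order.TTheory GRing.Theory Num.Theory.
Import numFieldNormedType.Exports.
Local Open Scope classical_set_scope.
Local Open Scope ring_scope.

Definition iter_derive (R : realType) (V W : normedModType R) (vs : seq V)
    (f : V -> W) : V -> W :=
  foldr (fun v g x => derive g x v) f vs.

(* C^oo on an open set A: all iterated directional derivatives are
   (Frechet) differentiable at the points of A. *)
Definition smooth_on (R : realType) (V W : normedModType R) (A : set V)
    (f : V -> W) : Prop :=
  forall (vs : seq V) (x : V), A x -> differentiable (iter_derive vs f) x.

(* A smooth n-manifold without boundary, given by an atlas indexed by its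
   points: [chart p] is a chart around p with domain [dom p] and inverse
   [chartV p].  Outside [dom p] (resp. outside the image of [dom p]) the values
   of [chart p] (resp. [chartV p]) are irrelevant. *)
Record manifold (R : realType) (n : nat) := Manifold {
  carrier :> topologicalType;
  dom : carrier -> set carrier;
  chart : carrier -> carrier -> 'rV[R]_n;
  chartV : carrier -> 'rV[R]_n -> carrier;
  manifold_hausdorff : hausdorff_space carrier;
  manifold_second_countable : @second_countable carrier;
  dom_open : forall p, open (dom p);
  dom_center : forall p, dom p p;
  chart_open : forall p, open (chart p @` dom p);
  chartK : forall p q, dom p q -> chartV p (chart p q) = q;
  chart_continuous : forall p q, dom p q -> {for q, continuous (chart p)};
  chartV_continuous : forall p u, (chart p @` dom p) u ->
    {for u, continuous (chartV p)};
  chart_compat : forall p q,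
    smooth_on (chart p @` (dom p `&` dom q)) (chart q \o chartV p)
}.

Section Geometry.
Variables (R : realType) (n : nat) (M : manifold R n).

(* The tangent space at p is 'rV[R]_n, a tangent vector at p being identified
   with its coordinates in the chart [chart p] at p; a vector field
   is a function M -> 'rV[R]_n. *)

(* The differential at p of a map from M to M. *)
Definition tangent_map (F : M -> M) (p : M) : 'rV[R]_n -> 'rV[R]_n :=
  'd (chart (F p) \o F \o chartV p) (chart p p).

(* The coordinates, in the chart [chart p], of the tangent vector v at q. *)
Definition in_chart (p q : M) : 'rV[R]_n -> 'rV[R]_n :=
  'd (chart p \o chartV q) (chart q q).

Definition local_rep (Y : M -> 'rV[R]_n) (p : M) (u : 'rV[R]_n) : 'rV[R]_n :=
  in_chart p (chartV p u) (Y (chartV p u)).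

Definition smooth_field (U : set M) (Y : M -> 'rV[R]_n) : Prop :=
  forall p, smooth_on (chart p @` (dom p `&` U)) (local_rep Y p).

(* [Y, Z], with [Y, Z]^i = Y(Z^i) - Z(Y^i) in coordinates. *)
Definition bracket (Y Z : M -> 'rV[R]_n) (p : M) : 'rV[R]_n :=
  'D_(Y p) (local_rep Z p) (chart p p) - 'D_(Z p) (local_rep Y p) (chart p p).

Definition field_apply (Y : M -> 'rV[R]_n) (h : M -> R) (p : M) : R :=
  'D_(Y p) (h \o chartV p) (chart p p).

(* [f] has derivative l at t, the variable being restricted to [0, T]
   (so the derivative is one-sided at 0 and at T). *)
Definition has_deriv (W : normedModType R) (T : R) (f : R -> W) (t : R)
    (l : W) : Prop :=
  (fun s => (s - t)^-1 *: (f s - f t)) @ within `[0, T] (t^') --> l.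

Section Pair.
Variables (X : M -> 'rV[R]_n) (V : M -> {vspace 'rV[R]_n}).

Definition integral_curve (T : R) (c : R -> M) : Prop :=
  {within `[0, T], continuous c} /\
  forall t, 0 <= t <= T -> has_deriv T (chart (c t) \o c) t (X (c t)).

(* The curve returns, within [0, T], to a point that it has already visited;
   for an integral curve this means that it is periodic and covers at least
   one period. *)
Definition closed_orbit (T : R) (c : R -> M) : Prop :=
  exists s t, [/\ 0 <= s, s < t, t <= T & c s = c t].

(* exp(tX) for t >= 0; the value is p where the flow is not defined. *)
Definition flow (t : R) (p : M) : M :=
  xget p [set q | exists g, [/\ integral_curve t g, g 0 = p & g t = q]].

Definition section_of (D : M -> {vspace 'rV[R]_n}) (U : set M)
    (Y : M -> 'rV[R]_n) : Prop :=
  [/\ open U, smooth_field U Y & forall q, U q -> Y q \in D q].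

Definition frame (m : nat) (U : set M) (W : 'I_m -> M -> 'rV[R]_n) : Prop :=
  (forall i, section_of V U (W i)) /\
  open U /\ forall q, U q -> basis_of (V q) [tuple W i q | i < m].

Definition smooth_distribution (m : nat) : Prop :=
  forall p, exists U (W : 'I_m -> M -> 'rV[R]_n), U p /\ frame U W.

Definition dynamic_pair (m : nat) : Prop :=
  smooth_field setT X /\ smooth_distribution m.

(* The values at p of the sections of V and of the brackets [X, Y], with Y a
   section of V. *)
Definition derived_vectors (p : M) : set 'rV[R]_n :=
  [set v | exists U Y, [/\ U p, section_of V U Y
                         & v = Y p \/ v = bracket X Y p]].

Definition spanned_by (E : {vspace 'rV[R]_n}) (S : set 'rV[R]_n) : Prop :=
  (forall v, S v -> v \in E) /\
  forall F : {vspace 'rV[R]_n}, (forall v, S v -> v \in F) -> (E <= F)%VS.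

Definition regular_pair (m : nat) : Prop :=
  [/\ dynamic_pair m, (forall p, X p != 0) &
   exists D : M -> {vspace 'rV[R]_n},
     [/\ forall p, spanned_by (D p) (derived_vectors p),
         forall p, \dim (D p) = (2 * m)%N &
         forall U Y, section_of D U Y ->
           forall q, U q -> bracket X Y q \in D q]].

(* [X, [X, W]] = W H0 + [X, W] H1 on U *)
Definition structure_eq (m : nat) (U : set M) (W : 'I_m -> M -> 'rV[R]_n)
    (H0 H1 : M -> 'M[R]_m) : Prop :=
  forall q, U q -> forall j, bracket X (bracket X (W j)) q =
    \sum_i H0 q i j *: W i q + \sum_i H1 q i j *: bracket X (W i) q.

Definition curvature_matrix (m : nat) (H0 H1 : M -> 'M[R]_m) (p : M) : 'M[R]_m :=
  - H0 p + 2^-1 *: (\matrix_(i, j) field_apply X (fun q => H1 q i j) p)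
  - 4^-1 *: (H1 p *m H1 p).

(* The graph of the curvature operator: K_p v = w. *)
Definition curvature (m : nat) (p : M) (v w : 'rV[R]_n) : Prop :=
  exists U (W : 'I_m -> M -> 'rV[R]_n) (H0 H1 : M -> 'M[R]_m) (a : 'cV[R]_m),
    [/\ U p, frame U W, structure_eq U W H0 H1,
        v = \sum_i a i 0 *: W i p &
        w = \sum_i (curvature_matrix H0 H1 p *m a) i 0 *: W i p].

Definition normal_frame (m : nat) (U : set M) (E : 'I_m -> M -> 'rV[R]_n)
    : Prop :=
  frame U E /\
  forall i q, U q -> bracket X (bracket X (E i)) q \in V q.

Section AlongCurve.
Variables (m : nat) (T : R) (c : R -> M).

(* The graph of the covariant derivative of sections along c: (D_X v)(t) = w,
   computed in a normal frame around c(t). *)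
Definition covariant_deriv (v : R -> 'rV[R]_n) (t : R) (w : 'rV[R]_n) : Prop :=
  exists U (E : 'I_m -> M -> 'rV[R]_n) (f : 'I_m -> R -> R) (df : 'I_m -> R),
    [/\ U (c t) /\ normal_frame U E,
        (\forall s \near t, 0 <= s <= T -> v s = \sum_i f i s *: E i (c s)),
        forall i, has_deriv T (f i : R -> R^o) t (df i) &
        w = \sum_i df i *: E i (c t)].

Definition parallel_line (L : R -> {vspace 'rV[R]_n}) : Prop :=
  exists v : R -> 'rV[R]_n, forall t, 0 <= t <= T ->
    [/\ v t \in V (c t), v t != 0, L t = <[v t]>%VS & covariant_deriv v t 0].

(* L is a parallel field of invariant lines of the curvature operator along c,
   with eigenvalue lam. *)
Definition parallel_eigenline (L : R -> {vspace 'rV[R]_n}) (lam : R -> R)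
    : Prop :=
  parallel_line L /\
  forall t, 0 <= t <= T -> forall v, v \in L t ->
    curvature m (c t) v (lam t *: v).

Definition normal_frame_along (E : 'I_m -> R -> 'rV[R]_n) : Prop :=
  forall t, 0 <= t <= T -> exists U (W : 'I_m -> M -> 'rV[R]_n),
    [/\ U (c t), normal_frame U W &
        \forall s \near t, 0 <= s <= T -> forall i, E i s = W i (c s)].

Definition normal_curvature_matrix (N : R -> 'M[R]_m) : Prop :=
  exists E, normal_frame_along E /\
    forall t, 0 <= t <= T -> forall j,
      curvature m (c t) (E j t) (\sum_i N t i j *: E i t).

(* exp(tX)_* V(c(0)) :&: V(c(t)) *)
Definition conjugate_space (t : R) : {vspace 'rV[R]_n} :=
  (linfun (tangent_map (flow t) (c 0)) @: V (c 0) :&: V (c t))%VS.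

Definition conjugate_time (t : R) : Prop :=
  0 < t <= T /\ conjugate_space t != 0%VS.

Definition multiplicity (t : R) : nat := \dim (conjugate_space t).

End AlongCurve.
End Pair.
End Geometry.

(* t is a zero of a solution on [0, T] of y'' = - lam y, y(0) = 0, y'(0) <> 0. *)
Definition jacobi_zero (R : realType) (T : R) (lam : R -> R) (t : R) : Prop :=
  exists y dy : R -> R^o,
    [/\ forall s, 0 <= s <= T -> has_deriv T y s (dy s),
        forall s, 0 <= s <= T -> has_deriv T dy s (- lam s * y s),
        y 0 = 0, dy 0 != 0 & y t = 0].

(* Main.v *)
(* Let [v] be a parallel section spanning an invariant line along [c], and [S] a normal
   section of the distribution with [S (c t) = v t].  Since [[X, [X, S]] = - K S] for normal
   sections, a field [a(t) v(t) + b(t) [X, S](c(t))] along [c] is invariant under the flow of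
   [X] as soon as [a = - b'] and [b'' = - lambda b].  With [b 0 = 0], [b' 0 <> 0] the flow
   therefore carries [- b'(0) v(0)], a nonzero vector of V(c(0)), into V(c(t)) at every zero
   [t] of [b], and independent lines give independent vectors.  If [lambda >= kappa > 0], the
   Wronskian of [b] and [sin (sqrt kappa t)] forces a zero of [b] in [(0, pi / sqrt kappa]].

   Invariance of such fields needs the flow of [X] near [c] to be differentiable, with the
   variational equation along [c] for its differential.  This is proved locally by Picard
   iteration, the remainder being controlled by Gronwall-type bounds, and is propagated along
   [c] by a real induction on [0, T]. *)
Require Import Defs.
From HB Require Import structures.
From mathcomp Require Import all_boot all_order all_algebra.
From mathcomp Require Import all_classical all_reals all_analysis.
From mathcomp Require Import perm ring lra.
Set Implicit Arguments.
Unset Strict Implicit.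
Unset Printing Implicit Defensive.
Import Order.TTheory GRing.Theory Num.Theory.
Import numFieldNormedType.Exports.
Local Open Scope classical_set_scope.
Local Open Scope ring_scope.

(** * Calculus on an interval *)

(** In the statement the flow is a choice: [flow] picks the endpoint of some integral curve and
    falls back to the starting point when there is none. So integral curves must be unique before
    the flow has a usable value, and the orbits of all points near [c 0] must last as long as [c]
    before its differential means anything; the latter is carried along in the induction.
    Derivatives are one-sided at the ends of [0, T], and solutions are restricted to shorter closed
    intervals and glued again, hence a calculus on arbitrary intervals with explicit epsilons.
    Brackets only make sense for fields on open sets, whereas a parallel line lives on the curve.
    The bridge is that the coordinates of normal sections in a normal frame are constant along [X],
    so that a parallel section is locally the restriction of a constant combination of a normal
    frame. This also yields continuity of the eigenvalue, about which nothing is assumed, and lets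
    local normal frames be glued along [c] into one having the given section as a column, which the
    equivalence with a diagonal block requires. *)

(** Supremum argument. The step may start at any [s1] just left of [t] and end at any [s2] just
    right of it, so a single hypothesis gives both closure at a limit and continuation beyond it. It
    stands in for compactness and connectedness of [a, b] in most arguments below. *)
Lemma real_induction (R : realType) (a b : R) (P : R -> Prop) :
  a <= b -> P a ->
  (forall t, a <= t <= b -> exists2 d : R, 0 < d & forall s1 s2,
     a <= s1 <= t -> t <= s2 <= b -> t - s1 < d -> s2 - t < d -> P s1 -> P s2) ->
  P b.
Proof.
move=> ab Pa step.
pose S := [set s | a <= s <= b /\ P s].
have supS : has_sup S.
  by split; [exists a; rewrite /S /= lexx | exists b => s -[/andP[]]].
have Sa : S a by rewrite /S /= lexx.
have le_a : a <= sup S by apply: ub_le_sup => //; case: supS.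
have le_b : sup S <= b.
  by apply: ge_sup; [case: supS | move=> s -[/andP[]]].
have [|d d0 dP] := step (sup S); first by rewrite le_a.
have [s1 [/andP[as1 s1b] Ps1]] := sup_adherent d0 supS => ds1.
have s1S : s1 <= sup S by apply: ub_le_sup; [case: supS | split; rewrite ?as1].
pose s2 := Num.min (sup S + d / 2) b.
have s2S : sup S <= s2 by rewrite /s2 le_min le_b andbT lerDl divr_ge0 // ltW.
have s2b : s2 <= b by rewrite /s2 ge_min lexx orbT.
have Ps2 : P s2.
  apply: (dP s1) => //; rewrite ?as1 ?s2S //.
    by rewrite ltrBlDr addrC -ltrBlDr.
  have : s2 <= sup S + d / 2 by rewrite /s2 ge_min lexx.
  by move=> ?; lra.
have : s2 <= sup S.
  by apply: ub_le_sup; [case: supS | split; rewrite // s2b andbT (le_trans le_a)].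
rewrite /s2 ge_min => /orP[|bS]; first by move=> ?; exfalso; lra.
by move: Ps2; rewrite /s2 min_r //; lra.
Qed.

Section Hderiv.
Variables (R : realType).
Implicit Types W : normedModType R.

(* Epsilon-delta versions of [has_deriv] and of continuity on [a, b]. *)
Definition hderiv W (a b : R) (f : R -> W) (t : R) (l : W) : Prop :=
  forall e : R, 0 < e -> exists2 d : R, 0 < d & forall s, a <= s <= b -> `|s - t| < d ->
    `|f s - f t - (s - t) *: l| <= e * `|s - t|.

Definition hcont W (a b : R) (f : R -> W) (t : R) : Prop :=
  forall e : R, 0 < e -> exists2 d : R, 0 < d & forall s, a <= s <= b -> `|s - t| < d ->
    `|f s - f t| < e.

Lemma has_derivP W T (f : R -> W) t l : 0 <= t <= T ->
  has_deriv T f t l <-> hderiv 0 T f t l.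
Proof.
move=> tT; split.
- move=> /cvgrPdist_le H e e0; have := H _ e0.
  rewrite !near_withinE => /nbhs_ballP[d /= d0 dP].
  exists d => // s sT sd.
  have [->|st] := eqVneq s t.
    by rewrite !(subrr, scale0r, subr0, normr0, mulr0).
  have := dP s; rewrite /ball /= distrC => /(_ sd st).
  rewrite in_itv /= => /(_ sT); rewrite distrC => H1.
  have -> : f s - f t - (s - t) *: l =
      (s - t) *: ((s - t)^-1 *: (f s - f t) - l).
    by rewrite scalerBr scalerA mulfV ?scale1r // subr_eq0.
  by rewrite normrZ mulrC ler_wpM2r.
- move=> H; apply/cvgrPdist_le => e e0; have [d d0 dP] := H _ e0.
  rewrite !near_withinE; apply/nbhs_ballP; exists d => //= s.
  rewrite /ball /= distrC => sd st; rewrite in_itv /= => sT.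
  rewrite distrC.
  have st0 : 0 < `|s - t| by rewrite normr_gt0 subr_eq0.
  rewrite -(ler_pM2l st0) -normrZ scalerBr scalerA mulfV ?scale1r ?subr_eq0 //.
  by rewrite mulrC; exact: dP.
Qed.

Lemma hderiv_cont W a b (f : R -> W) t l : hderiv a b f t l -> hcont a b f t.
Proof.
move=> H e e0; have [d d0 dP] := H _ ltr01.
have L0 : 0 < `|l| + 1 + 1 by rewrite ltr_wpDr // ltr_wpDl.
exists (Num.min d (e / (`|l| + 1 + 1))); first by rewrite lt_min d0 divr_gt0.
move=> s sI; rewrite lt_min => /andP[sd se].
have := dP s sI sd; rewrite mul1r => H1.
have -> : f s - f t = (f s - f t - (s - t) *: l) + (s - t) *: l by rewrite subrK.
apply: (le_lt_trans (ler_normD _ _)); rewrite normrZ.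
apply: (@le_lt_trans _ _ (`|s - t| * (`|l| + 1))).
  by rewrite mulrDr mulr1 addrC lerD2l.
apply: (@le_lt_trans _ _ (`|s - t| * (`|l| + 1 + 1))).
  by rewrite ler_wpM2l // lerDl.
by rewrite -ltr_pdivlMr.
Qed.

Lemma hderiv_sub W a b a' b' (f : R -> W) t l : a <= a' -> b' <= b ->
  hderiv a b f t l -> hderiv a' b' f t l.
Proof.
move=> aa bb H e e0; have [d d0 dP] := H e e0; exists d => // s /andP[s1 s2].
by apply: dP; rewrite (le_trans aa s1) (le_trans s2 bb).
Qed.

Lemma hcont_sub W a b a' b' (f : R -> W) t : a <= a' -> b' <= b ->
  hcont a b f t -> hcont a' b' f t.
Proof.
move=> aa bb H e e0; have [d d0 dP] := H e e0; exists d => // s /andP[s1 s2].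
by apply: dP; rewrite (le_trans aa s1) (le_trans s2 bb).
Qed.

(** Equality at [t] is asked separately since [t] itself may lie outside [a, b]. *)
Lemma hderiv_eq W a b (f g : R -> W) t l : f t = g t ->
  (exists2 d : R, 0 < d & forall s, a <= s <= b -> `|s - t| < d -> f s = g s) ->
  hderiv a b f t l -> hderiv a b g t l.
Proof.
move=> ft [d1 d10 fg] H e e0; have [d d0 dP] := H e e0.
exists (Num.min d d1); first by rewrite lt_min d0.
move=> s sI; rewrite lt_min => /andP[sd sd1].
by rewrite -ft -fg //; exact: dP.
Qed.

Lemma hcont_eq W a b (f g : R -> W) t : f t = g t ->
  (exists2 d : R, 0 < d & forall s, a <= s <= b -> `|s - t| < d -> f s = g s) ->
  hcont a b f t -> hcont a b g t.
Proof.
move=> ft [d1 d10 fg] H e e0; have [d d0 dP] := H e e0.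
exists (Num.min d d1); first by rewrite lt_min d0.
move=> s sI; rewrite lt_min => /andP[sd sd1].
by rewrite -ft -fg //; exact: dP.
Qed.

Lemma hderiv_cst W a b (k : W) t : hderiv a b (fun=> k) t 0.
Proof.
move=> e e0; exists 1 => // s _ _; rewrite subrr scaler0 subr0 normr0.
by rewrite mulr_ge0 // ltW.
Qed.

Lemma hderiv_shift a b (c t : R) :
  hderiv a b (fun s => s - c : R^o) t (1 : R^o).
Proof.
move=> e e0; exists 1 => // s _ _.
have -> : s - c - (t - c) - (s - t) *: (1 : R^o) = 0.
  by rewrite -[_ *: _]/(_ * _) mulr1 opprB addrA subrK subrr.
by rewrite normr0 mulr_ge0 // ltW.
Qed.

Lemma hderivD W a b (f g : R -> W) t l k :
  hderiv a b f t l -> hderiv a b g t k ->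
  hderiv a b (fun s => f s + g s) t (l + k).
Proof.
move=> F G e e0; have e20 : 0 < e / 2 by rewrite divr_gt0.
have [d d0 dP] := F _ e20; have [d' d'0 dP'] := G _ e20.
exists (Num.min d d'); first by rewrite lt_min d0.
move=> s sI; rewrite lt_min => /andP[sd sd'].
have -> : f s + g s - (f t + g t) - (s - t) *: (l + k) =
  (f s - f t - (s - t) *: l) + (g s - g t - (s - t) *: k).
  by rewrite scalerDr !opprD (addrACA (f s)) (addrACA (f s - f t)).
apply: (le_trans (ler_normD _ _)); have := dP s sI sd; have := dP' s sI sd'.
by move=> *; lra.
Qed.

Lemma diff_eps (V W : normedModType R) (F : V -> W) (x : V) :
  differentiable F x -> forall e : R, 0 < e -> exists2 d : R, 0 < d &
    forall y, `|y - x| < d -> `|F y - F x - 'd F x (y - x)| <= e * `|y - x|.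
Proof.
move=> dF e e0; have [_ /eqaddoP H] := (diff_locallyP _ _).1 dF.
have := H _ e0 => /nbhs_ballP[d /= d0 dP]; exists d => // y yx.
have := dP (y - x); rewrite -ball_normE /= sub0r normrN => /(_ yx) /=.
by rewrite !fctE /= subrK opprD addrA.
Qed.

Lemma diff_of_eps (V W : normedModType R) (F : V -> W) (df : {linear V -> W})
    (x : V) : continuous df ->
  (forall e : R, 0 < e -> exists2 d : R, 0 < d &
    forall y, `|y - x| < d -> `|F y - F x - df (y - x)| <= e * `|y - x|) ->
  differentiable F x /\ 'd F x = df :> (V -> W).
Proof.
move=> cdf H.
have E : F \o shift x = cst (F x) + df +o_ 0 id.
  apply/eqaddoP => e e0; have [d d0 dP] := H _ e0.
  apply/nbhs_ballP; exists d => // h; rewrite -ball_normE /= sub0r normrN => hd.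
  have := dP (h + x); rewrite addrK => /(_ hd).
  by rewrite !fctE /= opprD addrA.
have Ed := diff_unique cdf E.
by split=> //; apply/diff_locallyP; rewrite Ed.
Qed.

Lemma diff_bound (V W : normedModType R) (F : V -> W) (x : V) :
  differentiable F x -> exists2 k : R, 0 < k &
    forall v, `|'d F x v| <= k * `|v|.
Proof. by move=> /diff_continuous; exact: linear_lipschitz. Qed.

Lemma hderiv_comp (V W : normedModType R) a b (f : R -> V) t l (F : V -> W) :
  hderiv a b f t l -> differentiable F (f t) ->
  hderiv a b (F \o f) t ('d F (f t) l).
Proof.
move=> Hf dF e e0.
have [k k0 kP] := diff_bound dF.
have e1 : 0 < e / 2 / k by rewrite !divr_gt0.
have [d1 d10 d1P] := Hf _ e1.
have L0 : 0 < `|l| + e / 2 / k by rewrite ltr_wpDl.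
have e2 : 0 < e / 2 / (`|l| + e / 2 / k) by rewrite !divr_gt0.
have [d2 d20 d2P] := diff_eps dF e2.
have [d3 d30 d3P] := hderiv_cont Hf d20.
exists (Num.min d1 d3); first by rewrite lt_min d10.
move=> s sI; rewrite lt_min => /andP[sd1 sd3] /=.
have H1 := d1P s sI sd1; have H2 := d2P _ (d3P s sI sd3).
have H3 := kP (f s - f t - (s - t) *: l).
have -> : F (f s) - F (f t) - (s - t) *: 'd F (f t) l =
  (F (f s) - F (f t) - 'd F (f t) (f s - f t)) +
  'd F (f t) (f s - f t - (s - t) *: l).
  by rewrite [X in _ = _ + X]linearB /= [in X in _ = _ + X]linearZ /= addrA subrK.
apply: (le_trans (ler_normD _ _)).
have H4 : `|f s - f t| <= (`|l| + e / 2 / k) * `|s - t|.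
  have -> : f s - f t = (s - t) *: l + (f s - f t - (s - t) *: l).
    by rewrite [RHS]addrC subrK.
  apply: (le_trans (ler_normD _ _)); rewrite normrZ mulrDl.
  by rewrite (mulrC `|l|) lerD2l.
have H5 : e / 2 / (`|l| + e / 2 / k) * `|f s - f t| <= e / 2 * `|s - t|.
  apply: (le_trans (ler_wpM2l (ltW e2) H4)).
  by rewrite mulrA divfK ?gt_eqF.
have H6 : k * `|f s - f t - (s - t) *: l| <= e / 2 * `|s - t|.
  apply: (le_trans (ler_wpM2l (ltW k0) H1)).
  by rewrite mulrA (mulrC k) divfK ?gt_eqF.
by have := le_trans H2 H5; have := le_trans H3 H6; move=> *; lra.
Qed.

Lemma hderivZ W a b k (f : R -> W) t l : hderiv a b f t l ->
  hderiv a b (fun s => k *: f s) t (k *: l).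
Proof.
move=> H; have dk : differentiable ( *:%R k) (f t) by [].
by have := hderiv_comp H dk; rewrite diff_val.
Qed.

Lemma hderivN W a b (f : R -> W) t l : hderiv a b f t l ->
  hderiv a b (fun s => - f s) t (- l).
Proof.
move=> /(hderivZ (-1)); rewrite scaleN1r.
by apply: hderiv_eq; rewrite ?scaleN1r //; exists 1 => // s _ _; rewrite scaleN1r.
Qed.

Lemma hderivB W a b (f g : R -> W) t l k :
  hderiv a b f t l -> hderiv a b g t k ->
  hderiv a b (fun s => f s - g s) t (l - k).
Proof. by move=> F /hderivN; exact: hderivD. Qed.

Lemma hderiv_sum W (I : Type) (r : seq I) a b (f : I -> R -> W) t (l : I -> W) :
  (forall i, hderiv a b (f i) t (l i)) ->
  hderiv a b (fun s => \sum_(i <- r) f i s) t (\sum_(i <- r) l i).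
Proof.
move=> H; elim: r => [|i r IH].
  rewrite big_nil; apply: hderiv_eq (hderiv_cst _ _ 0 _); rewrite ?big_nil //.
  by exists 1 => // s _ _; rewrite big_nil.
rewrite big_cons; apply: hderiv_eq (hderivD (H i) IH); rewrite ?big_cons //.
by exists 1 => // s _ _; rewrite big_cons.
Qed.

(** Remainder of the product rule: [x], [u] are the values at the base point, [y], [w] the
    increments, [h] the increment of the variable and [l], [k] the two derivatives. Each of the
    three terms on the right is small compared with [h]. *)
Lemma scale_expand W (x y h l : R) (u w k : W) :
  (x + y) *: (u + w) - x *: u - h *: (l *: u + x *: k) =
  (y - h * l) *: u + x *: (w - h *: k) + y *: w.
Proof.
rewrite !scalerDl !scalerDr scaleNr scalerN opprD !scalerA (mulrC x h).
have -> : x *: u + x *: w + (y *: u + y *: w) - x *: u =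
  x *: w + (y *: u + y *: w).
  by rewrite addrC !addrA addNr add0r.
by rewrite [RHS](AC (2*2*1) (3*(1*5)*(2*4))).
Qed.

Lemma hderiv_scale W a b (f : R -> R^o) (g : R -> W) t (l : R^o) k :
  hderiv a b f t l -> hderiv a b g t k ->
  hderiv a b (fun s => (f s : R) *: g s) t ((l : R) *: g t + (f t : R) *: k).
Proof.
move=> Hf Hg e e0.
have G0 : 0 < `|g t| + 1 by rewrite ltr_wpDl.
have F0 : 0 < `|f t| + 1 by rewrite ltr_wpDl.
have L0 : 0 < `|k| + 1 by rewrite ltr_wpDl.
have e3 : 0 < e / 3 by rewrite divr_gt0.
have [d1 d10 d1P] := Hf _ (divr_gt0 e3 G0).
have [d2 d20 d2P] := Hg _ (divr_gt0 e3 F0).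
have [d3 d30 d3P] := hderiv_cont Hf (divr_gt0 e3 L0).
have [d4 d40 d4P] := Hg _ ltr01.
exists (Num.min (Num.min d1 d4) (Num.min d2 d3)).
  by rewrite !lt_min d10 d20 d30 d40.
move=> s sI; rewrite !lt_min => /andP[/andP[sd1 sd4] /andP[sd2 sd3]].
have {}d1P := d1P s sI sd1; have {}d2P := d2P s sI sd2.
have {}d3P := d3P s sI sd3.
have -> : (f s : R) *: g s - (f t : R) *: g t -
    (s - t) *: ((l : R) *: g t + (f t : R) *: k) =
  (f s - f t - (s - t) *: l : R) *: g t + (f t : R) *: (g s - g t - (s - t) *: k)
  + (f s - f t : R) *: (g s - g t).
  have := @scale_expand W (f t) (f s - f t) (s - t) l (g t) (g s - g t) k.
  by rewrite (addrC (f t)) (addrC (g t)) !subrK.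
apply: (le_trans (ler_normD _ _)).
have -> : e * `|s - t| = (e / 3 * `|s - t| + e / 3 * `|s - t|) +
  e / 3 * `|s - t| by lra.
apply: lerD; first (apply: (le_trans (ler_normD _ _)); apply: lerD).
- rewrite normrZ; apply: (@le_trans _ _ (e / 3 / (`|g t| + 1) * `|s - t| * (`|g t| + 1))).
    by apply: ler_pM => //; rewrite lerDl.
  by rewrite mulrAC divfK ?gt_eqF.
- rewrite normrZ; apply: (@le_trans _ _ ((`|f t| + 1) * (e / 3 / (`|f t| + 1) * `|s - t|))).
    by apply: ler_pM => //; rewrite lerDl.
  by rewrite mulrA (mulrC (`|f t| + 1)) divfK ?gt_eqF.
have k4 : `|g s - g t| <= (`|k| + 1) * `|s - t|.
  have -> : g s - g t = (s - t) *: k + (g s - g t - (s - t) *: k).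
    by rewrite [RHS]addrC subrK.
  apply: (le_trans (ler_normD _ _)); rewrite normrZ mulrDl (mulrC `|k|) lerD2l.
  exact: d4P.
rewrite normrZ; apply: (@le_trans _ _ (e / 3 / (`|k| + 1) * ((`|k| + 1) * `|s - t|))).
  by apply: ler_pM => //; exact: ltW.
by rewrite mulrA divfK ?gt_eqF.
Qed.

Lemma hderiv_derive W a b (f : R -> W) (t : R) (l : W) :
  is_derive t 1 f l -> hderiv a b f t l.
Proof.
move=> [df <-] e e0.
have df' : differentiable f t by exact/derivable1_diffP.
have [d d0 dP] := diff_eps df' e0; exists d => // s _ sd.
rewrite deriveE //; have := dP s sd.
by rewrite -[X in 'd _ _ X]mulr1 -[(s - t) * 1]/((s - t) *: (1 : R^o)) linearZ.
Qed.

Lemma hderiv_exp a b (k t0 : R) (t : R) :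
  hderiv a b (fun s => expR (k * (s - t0)) : R^o) t (k * expR (k * (t - t0))).
Proof.
have Hid := @hderiv_shift a b t0 t.
have De : differentiable (expR : R^o -> R^o) (k * (t - t0)).
  exact/derivable1_diffP.
have := hderiv_comp (hderivZ k Hid) De.
rewrite -[_ *: (1 : R^o)]/(k * 1) mulr1 -[X in 'd _ _ X]mulr1.
rewrite -[X in 'd _ _ X]/(k *: (1 : R^o)) linearZ -deriveE //.
by rewrite derive_val.
Qed.

(** For vector values only an inequality is available. It is proved with a small slack proportional
    to the length, which makes it additive over adjacent intervals and so accessible to
    [real_induction]. *)
Lemma mean_value_le W a b (f df : R -> W) (psi dpsi : R -> R^o) : a <= b ->
  (forall t, a <= t <= b -> hderiv a b f t (df t)) ->
  (forall t, a <= t <= b -> hderiv a b psi t (dpsi t)) ->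
  (forall t, a <= t <= b -> `|df t| <= dpsi t) ->
  `|f b - f a| <= psi b - psi a.
Proof.
move=> ab Hf Hp le; apply/ler_addgt0Pr => e e0.
have c0 : 0 < b - a + 1 by rewrite ltr_wpDl // subr_ge0.
(* The slack [e'] per unit length adds up to at most [e] over [a, b]; the 1 covers [a = b]. In the
   induction it absorbs the errors [e' / 2] of [f] and of [psi] on either side of [t]. *)
pose e' := e / (b - a + 1).
have e'0 : 0 < e' by rewrite divr_gt0.
apply: (@le_trans _ _ (psi b - psi a + e' * (b - a))); last first.
  rewrite lerD2l /e' mulrAC ler_pdivrMr // ler_pM2l //; lra.
pose P s := `|f s - f a| <= psi s - psi a + e' * (s - a).
apply: (@real_induction R a b P ab); first by rewrite /P !subrr normr0 mulr0 addr0.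
move=> t tI; have e20 : 0 < e' / 2 by rewrite divr_gt0.
have [d1 d10 d1P] := Hf t tI _ e20; have [d2 d20 d2P] := Hp t tI _ e20.
exists (Num.min d1 d2); first by rewrite lt_min d10.
have /andP[at_ tb] := tI.
move=> s1 s2 /andP[as1 s1t] /andP[ts2 s2b]; rewrite !lt_min.
move=> /andP[sd1 sd2] /andP[sd3 sd4]; rewrite /P => H.
have I1 : a <= s1 <= b by lra.
have I2 : a <= s2 <= b by lra.
have n1 : `|s1 - t| = t - s1 by rewrite distrC ger0_norm ?subr_ge0.
have n2 : `|s2 - t| = s2 - t by rewrite ger0_norm ?subr_ge0.
have := d1P _ I1; rewrite n1 => /(_ sd1) A1.
have := d2P _ I1; rewrite n1 => /(_ sd2); rewrite ler_norml => /andP[_ B1].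
have := d1P _ I2; rewrite n2 => /(_ sd3) A2.
have := d2P _ I2; rewrite n2 => /(_ sd4); rewrite ler_norml => /andP[B2 _].
have key s e1 : `|f s - f t - (s - t) *: df t| <= e1 ->
    `|f s - f t| <= e1 + `|s - t| * dpsi t.
  move=> H1; rewrite -(subrK ((s - t) *: df t) (f s - f t)).
  apply: (le_trans (ler_normD _ _)); apply: lerD => //.
  by rewrite normrZ ler_wpM2l // le.
have {}A1 := key _ _ A1; have {}A2 := key _ _ A2.
rewrite n1 in A1; rewrite n2 in A2.
have -> : f s2 - f a = (f s2 - f t) + (f t - f s1) + (f s1 - f a).
  by rewrite !subrKA.
apply: (le_trans (ler_normD _ _)).
have := ler_normD (f s2 - f t) (f t - f s1); rewrite (distrC (f t)) => N1.
rewrite -[_ *: _]/(_ * _) in B1; rewrite -[_ *: _]/(_ * _) in B2.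
move: N1 A1 A2 B1 B2 H; rewrite !(mulrBl, mulrBr) => *; lra.
Qed.
End Hderiv.

(** * Gronwall's inequality, limits and antiderivatives *)

Section Ode.
Variables (R : realType).
Implicit Types W : normedModType R.

Lemma hcont_bounded W a b (g : R -> W) : a <= b ->
  (forall t, a <= t <= b -> hcont a b g t) ->
  exists2 B : R, 0 < B & forall t, a <= t <= b -> `|g t| <= B.
Proof.
move=> ab Hg.
apply: (@real_induction R a b (fun c => exists2 B : R, 0 < B &
  forall t, a <= t <= c -> `|g t| <= B) ab).
  exists (`|g a| + 1); first by rewrite ltr_wpDl.
  by move=> t /le_anti <-; rewrite lerDl.
move=> t tI; have [d d0 dP] := Hg t tI 1 ltr01; exists d => //.
move=> s1 s2 /andP[as1 s1t] /andP[ts2 s2b] ds1 ds2 [B B0 BP].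
exists (B + (`|g t| + 1)); first by rewrite ltr_wpDr // ltr_wpDl.
move=> s /andP[as_ ss2]; have [ss1|ss1] := leP s s1.
  apply: (le_trans (BP s _)); first by rewrite as_.
  by rewrite lerDl addr_ge0.
have sI : a <= s <= b by lra.
have sd : `|s - t| < d by rewrite ltr_norml; lra.
have := dP s sI sd; rewrite -{2}(subrK (g t) (g s)) => H.
have := ler_normD (g s - g t) (g t); move=> *; lra.
Qed.

(** In place of an integral inequality, let [Mx] be the supremum of [|g| / w] for the weight
    [w s = exp (2 L (s - a))]. Integrating [L Mx w + e] gives [|g| <= K + Mx / 2 * (w - 1)], hence
    [Mx <= K + Mx / 2] and [Mx <= 2 K]. The 2 in the exponent is what produces the absorbable
    half. *)
Lemma gronwall W a b (g dg : R -> W) (L e : R) : 0 < L -> 0 <= e ->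
  (forall t, a <= t <= b -> hderiv a b g t (dg t)) ->
  (forall t, a <= t <= b -> `|dg t| <= L * `|g t| + e) ->
  forall t, a <= t <= b ->
    `|g t| <= 2 * (`|g a| + e * (b - a)) * expR (2 * L * (t - a)).
Proof.
move=> L0 e0 Hg le t tI; have ab : a <= b by case/andP: tI; exact: le_trans.
pose w s := expR (2 * L * (s - a)).
have w0 s : 0 < w s by exact: expR_gt0.
pose S := [set x | exists2 s, a <= s <= b & x = `|g s| / w s].
have w1 s : a <= s -> 1 <= w s.
  by move=> as_; rewrite -expR0 ler_expR !mulr_ge0 ?subr_ge0 // ltW.
have supS : has_sup S.
  split; first by exists (`|g a| / w a), a => //; rewrite lexx.
  have [B B0 BP] : exists2 B : R, 0 < B & forall t, a <= t <= b -> `|g t| <= B.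
    by apply: hcont_bounded => // s /Hg; exact: hderiv_cont.
  exists B => _ [s sI ->]; rewrite ler_pdivrMr //.
  apply: (le_trans (BP s sI)); apply: ler_peMr; first exact: ltW.
  by apply: w1; case/andP: sI.
pose Mx := sup S.
have leM s : a <= s <= b -> `|g s| <= Mx * w s.
  by move=> sI; rewrite -ler_pdivrMr //; apply: ub_le_sup; [case: supS | exists s].
pose K := `|g a| + e * (b - a).
have K0 : 0 <= K by rewrite addr_ge0 // mulr_ge0 // subr_ge0.
have main s : a <= s <= b -> `|g s| <= K + Mx / 2 * (w s - 1).
  move=> /andP[as_ sb].
  have mv : `|g s - g a| <= (Mx / 2 * w s + e * (s - a)) - (Mx / 2 * w a + e * (a - a)).
    apply: (@mean_value_le R W a s g dg (fun u => Mx / 2 * w u + e * (u - a))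
      (fun u => Mx / 2 * (2 * L * w u) + e * 1)) => //.
    - move=> u /andP[au us]; apply: hderiv_sub (Hg u _) => //.
      by rewrite au (le_trans us).
    - move=> u _; apply: hderivD.
        by apply: (@hderivZ R R^o _ _ (Mx / 2)); exact: hderiv_exp.
      by apply: (@hderivZ R R^o _ _ e); exact: hderiv_shift.
    - move=> u /andP[au us]; have uI : a <= u <= b by rewrite au (le_trans us).
      apply: (le_trans (le u uI)).
      have -> : Mx / 2 * (2 * L * w u) + e * 1 = L * (Mx * w u) + e by field.
      by rewrite lerD2r ler_pM2l // leM.
  have wa : w a = 1 by rewrite /w subrr mulr0 expR0.
  rewrite wa in mv.
  have := ler_normD (g s - g a) (g a); rewrite subrK => H.
  have : e * (s - a) <= e * (b - a) by rewrite ler_wpM2l // lerD2r.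
  by rewrite /K => *; lra.
have MK : Mx <= K + Mx / 2.
  apply: ge_sup; first by case: supS.
  move=> _ [s sI ->]; rewrite ler_pdivrMr //.
  have sw := w1 s (andP sI).1.
  apply: (le_trans (main s sI)).
  have : K <= K * w s by exact: ler_peMr.
  have M0 : 0 <= Mx.
    have := leM s sI => H; have := le_trans (normr_ge0 _) H.
    by rewrite pmulr_lge0.
  have gen (k m x : R) : 0 <= m -> k <= k * x -> k + m / 2 * (x - 1) <= (k + m / 2) * x.
    by move=> *; lra.
  exact: gen.
apply: (le_trans (leM t tI)); apply: ler_wpM2r; first exact: ltW.
have gen (x y : R) : x <= y + x / 2 -> x <= 2 * y by move=> *; lra.
exact: gen MK.
Qed.
(** The norm of a row vector is its largest coordinate in absolute value; [0 <= B] settles the empty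
    row [k = 0]. *)
Lemma rV_norm_le k (v : 'rV[R]_k) (B : R) : 0 <= B ->
  (`|v| <= B) = [forall i, `|v 0 i| <= B].
Proof.
move=> B0; rewrite [leLHS]/Num.Def.normr /= mx_normrE.
apply/idP/forallP => [H i|H].
  apply: le_trans H; exact: (@le_bigmax _ _ _ 0 (fun ij : 'I_1 * 'I_k => `|v ij.1 ij.2|) (0, i)).
by apply: bigmax_le => // -[i j] _; rewrite ord1; exact: H.
Qed.

Lemma rV_coord_le k (v : 'rV[R]_k) i : `|v 0 i| <= `|v|.
Proof. by have := lexx `|v|; rewrite rV_norm_le // => /forallP /(_ i). Qed.

Lemma hderiv_coord k a b (f : R -> 'rV[R]_k) t (l : 'rV[R]_k) i :
  hderiv a b f t l -> hderiv a b (fun s => f s 0 i : R^o) t (l 0 i).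
Proof.
move=> H e e0; have [d d0 dP] := H e e0; exists d => // s sI sd.
apply: le_trans (dP s sI sd); apply: le_trans (rV_coord_le _ i).
by rewrite !mxE.
Qed.

Lemma hcont_coord k a b (f : R -> 'rV[R]_k) t i :
  hcont a b f t -> hcont a b (fun s => f s 0 i : R^o) t.
Proof.
move=> H e e0; have [d d0 dP] := H e e0; exists d => // s sI sd.
apply: le_lt_trans (dP s sI sd); apply: le_trans (rV_coord_le _ i).
by rewrite !mxE.
Qed.

Lemma hderiv_rV k a b (f : R -> 'rV[R]_k) t (l : 'rV[R]_k) :
  (forall i, hderiv a b (fun s => f s 0 i : R^o) t (l 0 i)) ->
  hderiv a b f t l.
Proof.
move=> H.
have E (v : 'rV[R]_k) : \sum_(i <- index_enum 'I_k) v 0 i *: delta_mx 0 i = v.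
  by rewrite [RHS]row_sum_delta.
have H0 := @hderiv_sum R _ _ (index_enum 'I_k) a b
  (fun i s => f s 0 i *: (delta_mx 0 i : 'rV_k)) t (fun i => l 0 i *: delta_mx 0 i).
rewrite -[l]E; apply: hderiv_eq (H0 _).
- exact: E.
- by exists 1 => // s _ _; exact: E.
- move=> i; have := hderiv_scale (H i) (hderiv_cst a b (delta_mx 0 i : 'rV[R]_k) t).
  by rewrite scaler0 addr0.
Qed.

(** Coordinatewise nested intervals: the tail of the series from [j] on is at most [2 K 2^-j], so
    [u j] minus or plus this amount gives increasing lower and decreasing upper bounds. The supremum
    of the lower ones is the limit. *)
Lemma geometric_limit k (u : nat -> 'rV[R]_k) (K : R) :
  (forall j, `|u j.+1 - u j| <= K * 2^-1 ^+ j) ->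
  exists l, forall j, `|u j - l| <= 2 * K * 2^-1 ^+ j.
Proof.
move=> H.
have K0 : 0 <= K by have := le_trans (normr_ge0 _) (H 0%N); rewrite expr0 mulr1.
have h0 j : 0 <= K * 2^-1 ^+ j by rewrite mulr_ge0 // exprn_ge0.
have real i : exists l : R, forall j, `|u j 0 i - l| <= 2 * K * 2^-1 ^+ j.
  pose lo j := u j 0 i - 2 * K * 2^-1 ^+ j.
  pose hi j := u j 0 i + 2 * K * 2^-1 ^+ j.
  have Hi j : `|u j.+1 0 i - u j 0 i| <= K * 2^-1 ^+ j.
    by apply: le_trans (H j); apply: le_trans (rV_coord_le _ i); rewrite !mxE.
  have lo1 j : lo j <= lo j.+1.
    have := Hi j; rewrite ler_norml /lo exprS.
    by move: (2^-1 ^+ j) => x /andP[*]; lra.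
  have hi1 j : hi j.+1 <= hi j.
    have := Hi j; rewrite ler_norml /hi exprS.
    by move: (2^-1 ^+ j) => x /andP[*]; lra.
  have lohi j : lo j <= hi j by have := h0 j; rewrite /lo /hi => *; lra.
  have loD j p : lo j <= lo (j + p)%N.
    by elim: p => [|p IH]; rewrite ?addn0 // addnS (le_trans IH).
  have hiD j p : hi (j + p)%N <= hi j.
    by elim: p => [|p IH]; rewrite ?addn0 // addnS (le_trans _ IH).
  have lh j p : lo j <= hi p.
    by rewrite (le_trans (loD j p)) // (le_trans (lohi _)) // addnC.
  pose S := range lo.
  have supS : has_sup S.
    by split; [exists (lo 0%N), 0%N | exists (hi 0%N) => _ [j _ <-]].
  exists (sup S) => j; rewrite ler_norml.
  have A : lo j <= sup S by apply: ub_le_sup; [case: supS | exists j].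
  have B : sup S <= hi j by apply: ge_sup; [case: supS | move=> _ [p _ <-]].
  by move: A B; rewrite /lo /hi => *; lra.
have [l lP] := choice real.
exists (\row_i l i) => j; rewrite rV_norm_le; last by rewrite -mulrA mulr_ge0.
by apply/forallP => i; rewrite !mxE.
Qed.

Lemma antiderivative_real a b (g : R -> R^o) : a <= b ->
  (forall t, a <= t <= b -> hcont a b g t) ->
  exists G : R -> R^o, forall t, a <= t <= b -> hderiv a b G t (g t).
Proof.
move=> ab Hg.
(* Composing with this retraction of the line onto [a, b] extends [g] to a continuous function on
   the whole line. *)
pose cl (s : R) := Num.max a (Num.min b s).
have clI s : a <= cl s <= b.
  by rewrite /cl le_max lexx ge_max ab ge_min lexx.
have clE s : a <= s <= b -> cl s = s.
  by move=> /andP[as_ sb]; rewrite /cl min_r // max_r.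
have cl1 s t : `|cl s - cl t| <= `|s - t|.
  rewrite /cl; have := ler_norm (s - t); have := ler_norm (t - s).
  rewrite (distrC t) ler_norml.
  by case: (leP b s) => ?; case: (leP b t) => ?;
     case: (leP a b) => ?; case: (leP a s) => ?; case: (leP a t) => ?; lra.
pose gc s := g (cl s).
have gcc : continuous gc.
  move=> t; apply/cvgrPdist_lt => e e0; have [d d0 dP] := Hg _ (clI t) _ e0.
  apply/nbhs_ballP; exists d => // s; rewrite /ball /= => sd.
  rewrite distrC; apply: dP => //; apply: le_lt_trans (cl1 _ _) _.
  by rewrite distrC.
(* Integrating from [a - 1], inside an interval ending at [b + 1], makes [a] and [b] interior
   points, so the fundamental theorem gives a two-sided derivative there as well. *)
exists (fun x => (\int[@lebesgue_measure R]_(t in `[a - 1, x]) gc t)%R) => t tI.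
apply: hderiv_derive.
have [||||D1 D2] := @continuous_FTC1_closed R gc (a - 1) t (b + 1).
- by lra.
- apply: continuous_compact_integrable; first exact: segment_compact.
  exact: continuous_subspaceT.
- by lra.
- exact: gcc.
by apply: DeriveDef => //; rewrite -derive1E D2 /gc clE.
Qed.

Lemma antiderivative k a b (g : R -> 'rV[R]_k) : a <= b ->
  (forall t, a <= t <= b -> hcont a b g t) ->
  forall x0, exists G : R -> 'rV[R]_k, G a = x0 /\
    forall t, a <= t <= b -> hderiv a b G t (g t).
Proof.
move=> ab Hg x0.
have [G GP] := choice (fun i => antiderivative_real ab
  (fun t tI => hcont_coord i (Hg t tI))).
exists (fun t => x0 + (\row_i G i t - \row_i G i a)); split.
  by rewrite subrr addr0.
move=> t tI; rewrite -[g t]add0r; apply: hderivD; first exact: hderiv_cst.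
rewrite -[g t]subr0; apply: hderivB; last exact: hderiv_cst.
apply: hderiv_rV => i; apply: hderiv_eq (GP i t tI); rewrite ?mxE //.
by exists 1 => // s _ _; rewrite mxE.
Qed.
End Ode.

(** * Picard iteration *)

Section Picard.
Variables (R : realType).

Lemma half_pow_lt (D e : R) : 0 < e -> exists j, D * 2^-1 ^+ j < e.
Proof.
move=> e0; have [D0|D0] := leP D 0.
  by exists 0%N; rewrite expr0 mulr1 (le_lt_trans D0).
exists (Num.bound (D / e)).
rewrite exprVn ltr_pdivrMr ?exprn_gt0 // mulrC -ltr_pdivrMr //.
have := archi_boundP (ltW (divr_gt0 D0 e0)) => /lt_le_trans; apply.
by rewrite -natrX ler_nat ltnW // ltn_expl.
Qed.

Lemma le_half_pow (x D : R) : (forall j, x <= D * 2^-1 ^+ j) -> x <= 0.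
Proof.
move=> H; rewrite leNgt; apply/negP => x0; have [j] := half_pow_lt D x0.
by rewrite ltNge H.
Qed.

Lemma hcont_subst k a b (f : R -> 'rV[R]_k -> 'rV[R]_k) (L : R) :
  0 < L ->
  (forall t, a <= t <= b -> forall x y, `|f t x - f t y| <= L * `|x - y|) ->
  (forall t, a <= t <= b -> forall x, hcont a b (f ^~ x) t) ->
  forall y t, a <= t <= b -> hcont a b y t -> hcont a b (fun s => f s (y s)) t.
Proof.
move=> L0 lip cf y t tI yc e e0.
have [d1 d10 d1P] := cf t tI (y t) _ (divr_gt0 e0 (ltr0n _ 2)).
have [d2 d20 d2P] := yc _ (divr_gt0 (divr_gt0 e0 (ltr0n _ 2)) L0).
exists (Num.min d1 d2); first by rewrite lt_min d10.
move=> s sI; rewrite lt_min => /andP[sd1 sd2].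
rewrite -(subrKA (f s (y t))); apply: (le_lt_trans (ler_normD _ _)).
rewrite [ltRHS](splitr e); apply: ler_ltD; last exact: d1P.
apply: (le_trans (lip s sI _ _)); rewrite mulrC -ler_pdivlMr //.
by apply: ltW; exact: d2P.
Qed.

(** A Lipschitz bound in [x] that is uniform over [a, b] yields a solution on all of [a, b], without
    smallness of [b - a]. This serves the truncated nonlinear field, its variational equation and
    the scalar equation alike. *)
Theorem picard k a b (f : R -> 'rV[R]_k -> 'rV[R]_k) (L : R) (x0 : 'rV[R]_k) :
  a <= b -> 0 < L ->
  (forall t, a <= t <= b -> forall x y, `|f t x - f t y| <= L * `|x - y|) ->
  (forall t, a <= t <= b -> forall x, hcont a b (f ^~ x) t) ->
  exists y : R -> 'rV[R]_k, y a = x0 /\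
    forall t, a <= t <= b -> hderiv a b y t (f t (y t)).
Proof.
move=> ab L0 lip cf.
have aI : a <= a <= b by rewrite lexx.
(* [Phi] is the integral operator, obtained by choice. It is specified on continuous curves only, so
   continuity of each iterate has to accompany the iteration. *)
have [Phi PhiP] : exists Phi, forall y : R -> 'rV[R]_k,
    (forall t, a <= t <= b -> hcont a b y t) -> Phi y a = x0 /\
    forall t, a <= t <= b -> hderiv a b (Phi y) t (f t (y t)).
  have E (y : R -> 'rV[R]_k) : exists z : R -> 'rV[R]_k,
      (forall t, a <= t <= b -> hcont a b y t) -> z a = x0 /\
      forall t, a <= t <= b -> hderiv a b z t (f t (y t)).
    have [yc|nyc] := pselect (forall t, a <= t <= b -> hcont a b y t).
      have [|z zP] := @antiderivative R k a b (fun s => f s (y s)) ab _ x0.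
        by move=> t tI; exact: (hcont_subst L0 lip cf tI (yc t tI)).
      by exists z.
    by exists y => /nyc.
  by have [Phi PhiP] := choice E; exists Phi.
pose Y j := iter j Phi (fun=> x0).
have Yc j t : a <= t <= b -> hcont a b (Y j) t.
  elim: j t => [|j IH] t tI; first exact: hderiv_cont (hderiv_cst a b x0 t).
  exact: hderiv_cont ((PhiP _ IH).2 t tI).
have Y0 j : Y j a = x0 by case: j => [//|j]; exact: (PhiP _ (Yc j)).1.
have YD j t : a <= t <= b -> hderiv a b (Y j.+1) t (f t (Y j t)).
  exact: (PhiP _ (Yc j)).2.
(* In the sup norm weighted by [1 / w] the Picard map contracts by 1/2 on the whole of
   [a, b]. *)
pose w s := expR (2 * L * (s - a)).
have w0 s : 0 < w s by exact: expR_gt0.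
have w1 s : a <= s -> 1 <= w s.
  by move=> as_; rewrite -expR0 ler_expR !mulr_ge0 ?subr_ge0 // ltW.
have [C C0 CP] : exists2 C : R, 0 < C & forall t, a <= t <= b ->
    `|Y 1%N t - Y 0%N t| <= C.
  apply: hcont_bounded => // t tI.
  exact: hderiv_cont (hderivB (YD 0%N t tI) (hderiv_cst a b x0 t)).
have step j t : a <= t <= b ->
    `|Y j.+1 t - Y j t| <= C * 2^-1 ^+ j * w t.
  elim: j t => [|j IH] t tI.
    rewrite expr0 mulr1; apply: (le_trans (CP t tI)).
    by apply: ler_peMr; [exact: ltW | apply: w1; case/andP: tI].
  have /andP[at_ tb] := tI.
  have mv := @mean_value_le R _ a t (fun s => Y j.+2 s - Y j.+1 s)
    (fun s => f s (Y j.+1 s) - f s (Y j s)) (fun s => C * 2^-1 ^+ j.+1 * w s)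
    (fun s => C * 2^-1 ^+ j.+1 * (2 * L * w s)) at_.
  have : `|Y j.+2 t - Y j.+1 t - (Y j.+2 a - Y j.+1 a)| <=
      C * 2^-1 ^+ j.+1 * w t - C * 2^-1 ^+ j.+1 * w a.
    apply: mv.
    - move=> s /andP[as_ st]; apply: (@hderiv_sub R _ a b) => //.
      by apply: hderivB; apply: YD; rewrite as_ (le_trans st).
    - move=> s _; apply: (@hderivZ R R^o _ _ (C * 2^-1 ^+ j.+1)).
      exact: hderiv_exp.
    - move=> s /andP[as_ st]; have sI : a <= s <= b by rewrite as_ (le_trans st).
      apply: (le_trans (lip s sI _ _)).
      apply: (le_trans (ler_wpM2l (ltW L0) (IH s sI))).
      rewrite exprS le_eqVlt; apply/orP; left; apply/eqP.
      by move: (2^-1 ^+ j) => q; field.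
  rewrite !Y0 subrr subr0 => /le_trans; apply; rewrite gerBl.
  by rewrite !mulr_ge0 ?ltW // exprn_ge0.
pose D := 2 * (C * w b).
have D0 : 0 < D by rewrite !mulr_gt0.
have [y yP] : exists y : R -> 'rV[R]_k, forall t, a <= t <= b ->
    forall j, `|Y j t - y t| <= D * 2^-1 ^+ j.
  have E (t : R) : exists l : 'rV[R]_k, a <= t <= b ->
      forall j, `|Y j t - l| <= D * 2^-1 ^+ j.
    have [tI|ntI] := boolP (a <= t <= b); last by exists 0.
    have [|l lP] := @geometric_limit R k (Y ^~ t) (C * w b); last by exists l.
    move=> j; apply: (le_trans (step j t tI)); rewrite mulrAC.
    apply: ler_wpM2r; first by rewrite exprn_ge0.
    apply: ler_wpM2l; first exact: ltW.
    rewrite ler_expR; apply: ler_wpM2l; first by rewrite mulr_ge0 // ltW.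
    by rewrite lerD2r; case/andP: tI.
  by have [y yP] := choice E; exists y.
have yc t : a <= t <= b -> hcont a b y t.
  move=> tI e e0; have e3 : 0 < e / 3 by rewrite divr_gt0.
  have [j jP] := half_pow_lt D e3.
  have [d d0 dP] := Yc j t tI _ e3; exists d => // s sI sd.
  have := dP s sI sd; have := yP t tI j; have := yP s sI j.
  have -> : y s - y t = - (Y j s - y s) + (Y j s - Y j t) + (Y j t - y t).
    by rewrite opprB !subrKA.
  move: (ler_normD (- (Y j s - y s) + (Y j s - Y j t)) (Y j t - y t)).
  move: (ler_normD (- (Y j s - y s)) (Y j s - Y j t)); rewrite normrN.
  by move=> *; lra.
(* The limit [y] is so far only continuous. Integrating the equation once more gives a
   differentiable [z], and [z = y] because both are limits of the iterates. *)
have [z [za zD]] := @antiderivative R k a b (fun s => f s (y s)) ab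
  (fun t tI => hcont_subst L0 lip cf tI (yc t tI)) x0.
have zy t : a <= t <= b -> z t = y t.
  move=> tI; apply/eqP; rewrite -subr_eq0 -normr_le0; have /andP[at_ tb] := tI.
  apply: (@le_half_pow _ ((L * (b - a) + 1) * D)) => j.
  have mv : `|z t - Y j.+1 t - (z a - Y j.+1 a)| <=
      L * (D * 2^-1 ^+ j) * (t - a) - L * (D * 2^-1 ^+ j) * (a - a).
    apply: (@mean_value_le R _ a t (fun s => z s - Y j.+1 s)
      (fun s => f s (y s) - f s (Y j s))
      (fun s => L * (D * 2^-1 ^+ j) * (s - a))
      (fun s => L * (D * 2^-1 ^+ j) * 1)) => //.
    - move=> s /andP[as_ st]; apply: (@hderiv_sub R _ a b) => //.
      have sI : a <= s <= b by rewrite as_ (le_trans st).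
      by apply: hderivB; [exact: zD | exact: YD].
    - move=> s _; apply: (@hderivZ R R^o _ _ (L * (D * 2^-1 ^+ j))).
      exact: hderiv_shift.
    - move=> s /andP[as_ st]; have sI : a <= s <= b by rewrite as_ (le_trans st).
      rewrite mulr1; apply: (le_trans (lip s sI _ _)).
      by apply: ler_wpM2l; [exact: ltW | rewrite distrC; exact: yP].
  rewrite za Y0 !subrr mulr0 !subr0 in mv.
  have q0 : 0 <= 2^-1 ^+ j :> R by rewrite exprn_ge0.
  have yj := yP t tI j.+1; rewrite exprS in yj.
  rewrite -(subrKA (Y j.+1 t)); apply: (le_trans (ler_normD _ _)).
  apply: (le_trans (lerD mv yj)).
  have : L * (D * 2^-1 ^+ j) * (t - a) <= L * (D * 2^-1 ^+ j) * (b - a).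
    by apply: ler_wpM2l; [rewrite !mulr_ge0 // ltW | rewrite lerD2r].
  have : 0 <= D * 2^-1 ^+ j by rewrite mulr_ge0 // ltW.
  by move: (2^-1 ^+ j) => q *; lra.
by exists z; split=> // t tI; rewrite zy //; exact: zD.
Qed.

End Picard.

(** * Smooth functions *)

Section Smooth.
Variables (R : realType).
Implicit Types V W : normedModType R.

Lemma differentiable_near V W (f g : V -> W) x : {near x, f =1 g} ->
  differentiable f x -> differentiable g x /\ 'd g x = 'd f x :> (V -> W).
Proof.
move=> fg df; apply: diff_of_eps; first exact: diff_continuous.
move=> e e0; have [d d0 dP] := diff_eps df e0.
have gx := nbhs_singleton fg.
move/nbhs_ballP : fg => [d' /= d'0 d'P].
exists (Num.min d d'); first by rewrite lt_min d0.
move=> y; rewrite lt_min => /andP[yd yd'].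
by rewrite -gx -d'P; [exact: dP | rewrite -ball_normE /= distrC].
Qed.

Lemma scale_is_bilinear W : bilinear_for
    (GRing.Scale.Law.clone _ _ *:%R _) (GRing.Scale.Law.clone _ _ *:%R _)
    (fun (k : R^o) (w : W) => (k : R) *: w).
Proof.
split=> [u'|u] a x y /=.
- by rewrite scalerDl scalerA.
- by rewrite scalerDr !scalerA mulrC.
Qed.

Lemma diff_scale V W (h : V -> R^o) (F : V -> W) x :
  differentiable h x -> differentiable F x ->
  differentiable (fun y => (h y : R) *: F y) x /\
  'd (fun y => (h y : R) *: F y) x =
    (fun v => ('d h x v : R) *: F x + (h x : R) *: 'd F x v) :> (V -> W).
Proof.
move=> dh dF.
pose bM := bilinear_isBilinear.Build R R^o W W _ _ _ (@scale_is_bilinear W).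
pose b : {bilinear R^o -> W -> W} := HB.pack (fun (k : R^o) (w : W) => (k : R) *: w) bM.
have bc : continuous (fun p : R^o * W => b p.1 p.2).
  by move=> p; exact: scale_continuous.
have db := differentiable_bilin (h x, F x) bc.
have dp := differentiable_pair dh dF.
split; first exact: (differentiable_comp dp db).
rewrite (diff_comp dp db) (diff_bilin _ bc) diff_pair //.
by apply/funext => v /=; rewrite addrC.
Qed.

(** Finite-order truncation of [smooth_on]. Closure under products and inverses is an induction on
    the order, in which the function and its derivatives appear at one order less; the lists of
    directions in [smooth_on] do not support such an induction. *)
Fixpoint Ck V W (A : set V) (j : nat) (f : V -> W) : Prop :=
  if j is j'.+1 then
    (forall x, A x -> differentiable f x) /\ forall v, Ck A j' ('D_v f)
  else True.

(** [iter_derive] applies the last direction of its list first, so differentiating [f] beforehand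
    appends a direction at the end of the list. *)
Lemma smooth_onE V W (A : set V) (f : V -> W) : smooth_on A f <->
  (forall x, A x -> differentiable f x) /\ forall v, smooth_on A ('D_v f).
Proof.
have E v vs : iter_derive vs ('D_v f) = iter_derive (rcons vs v) f.
  by rewrite /iter_derive foldr_rcons.
split=> [H|[H1 H2] vs]; last first.
  by elim/last_ind: vs => [//|vs v _] x; rewrite -E; exact: H2.
by split=> [x Ax|v vs]; [exact: (H [::] x Ax) | rewrite E; exact: H].
Qed.

Lemma smooth_onP V W (A : set V) (f : V -> W) :
  smooth_on A f <-> forall j, Ck A j f.
Proof.
split=> [H j|H].
  by elim: j f H => [//|j IH] f /smooth_onE[H1 H2]; split=> // v; exact: IH.
move=> vs; have : Ck A (size vs).+1 f by [].
elim/last_ind: vs {H} f => [|vs v IH] f; first by case.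
rewrite size_rcons /iter_derive foldr_rcons => -[_ /(_ v)]; exact: IH.
Qed.

Lemma Ck_eq V W (A : set V) j (f g : V -> W) : open A ->
  (forall x, A x -> f x = g x) -> Ck A j f -> Ck A j g.
Proof.
move=> oA; elim: j f g => [//|j IH] f g fg [df Df]; split.
  move=> x Ax; apply: (proj1 (differentiable_near _ (df x Ax))).
  by apply: filterS (open_nbhs_nbhs (conj oA Ax)) => y; exact: fg.
move=> v; apply: (IH ('D_v f) _ _ (Df v)) => x Ax; apply: near_eq_derive.
by apply: filterS (open_nbhs_nbhs (conj oA Ax)) => y; exact: fg.
Qed.

Lemma CkS V W (A : set V) j (f : V -> W) : Ck A j.+1 f -> Ck A j f.
Proof. by elim: j f => [//|j IH] f [df Df]; split=> // v; exact: (IH _ (Df v)). Qed.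

Lemma Ck_cst V W (A : set V) j (k : W) : Ck A j (fun=> k).
Proof.
elim: j k => [//|j IH] k; split=> [x _ |v]; first exact: differentiable_cst.
have -> : 'D_v (fun=> k) = (fun=> 0) by apply/funext => x; exact: derive_cst.
exact: IH.
Qed.

Lemma CkD V W (A : set V) j (f g : V -> W) : open A ->
  Ck A j f -> Ck A j g -> Ck A j (fun x => f x + g x).
Proof.
move=> oA; elim: j f g => [//|j IH] f g [df Df] [dg Dg]; split=> [x Ax|v].
  exact: differentiableD (df x Ax) (dg x Ax).
apply: Ck_eq (IH _ _ (Df v) (Dg v)) => // x Ax.
rewrite (@deriveD _ _ _ f g) //; apply: diff_derivable; [exact: df | exact: dg].
Qed.

Lemma derive_scale V W (h : V -> R^o) (F : V -> W) x v :
  differentiable h x -> differentiable F x ->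
  'D_v (fun y => (h y : R) *: F y) x =
    ('D_v h x : R) *: F x + (h x : R) *: 'D_v F x.
Proof.
move=> dh dF; have [dp E] := diff_scale dh dF.
by rewrite !deriveE // E.
Qed.

Lemma Ck_scale V W (A : set V) j (h : V -> R^o) (F : V -> W) : open A ->
  Ck A j h -> Ck A j F -> Ck A j (fun x => (h x : R) *: F x).
Proof.
move=> oA; elim: j h F => [//|j IH] h F Hh HF.
have [dh Dh] := Hh; have [dF DF] := HF; split=> [x Ax|v].
  by have [] := diff_scale (dh x Ax) (dF x Ax).
apply: Ck_eq (CkD oA (IH _ _ (Dh v) (CkS HF)) (IH _ _ (CkS Hh) (DF v))) => // x Ax.
by rewrite derive_scale //; [exact: dh | exact: dF].
Qed.

Lemma Ck_sum V W (I : Type) (r : seq I) (A : set V) j (f : I -> V -> W) :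
  open A -> (forall i, Ck A j (f i)) -> Ck A j (fun x => \sum_(i <- r) f i x).
Proof.
move=> oA H; elim: r => [|i r IH].
  by apply: Ck_eq (Ck_cst _ _ 0) => // x _; rewrite big_nil.
by apply: Ck_eq (CkD oA (H i) IH) => // x _; rewrite big_cons.
Qed.

Lemma Ck_prod V (I : Type) (r : seq I) (A : set V) j (f : I -> V -> R^o) :
  open A -> (forall i, Ck A j (f i)) ->
  Ck A j (fun x => (\prod_(i <- r) (f i x : R) : R^o)).
Proof.
move=> oA H; elim: r => [|i r IH].
  by apply: Ck_eq (Ck_cst _ _ (1 : R^o)) => // x _; rewrite big_nil.
by apply: Ck_eq (Ck_scale oA (H i) IH) => // x _; rewrite big_cons.
Qed.

(** The derivative of [1 / f] is [- (1 / f)^2 'D_v f], and the induction hypothesis provides [1 / f]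
    at exactly the order required of this product. *)
Lemma CkV V (A : set V) j (f : V -> R^o) : open A ->
  (forall x, A x -> (f x : R) != 0) -> Ck A j f ->
  Ck A j (fun x => (f x : R)^-1 : R^o).
Proof.
move=> oA f0; elim: j f f0 => [//|j IH] f f0 Hf.
have [df Df] := Hf; split=> [x Ax|v].
  by apply: differentiableV; [exact: df | exact: f0].
have H := IH f f0 (CkS Hf).
apply: Ck_eq (Ck_scale oA (Ck_cst A j (-1 : R^o)) (Ck_scale oA (Ck_scale oA H H) (Df v))) => // x Ax.
rewrite deriveV; [|exact: f0 | exact: diff_derivable (df x Ax)].
rewrite scaleN1r scaleNr; congr (- (_ *: _)).
by rewrite -[LHS]/(_ * _) -expr2 exprVn.
Qed.

Lemma diff_linear_comp (U V W : normedModType R) (l : {linear V -> W}) (f : U -> V) x :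
  continuous l -> differentiable f x -> differentiable (l \o f) x /\
  'd (l \o f) x = l \o 'd f x :> (U -> W).
Proof.
move=> cl df; have dl : differentiable l (f x) by exact: linear_differentiable.
split; first exact: differentiable_comp.
by rewrite diff_comp // diff_lin.
Qed.

Lemma Ck_linear (U V W : normedModType R) (A : set U) j (l : {linear V -> W}) (f : U -> V) :
  open A -> continuous l -> Ck A j f -> Ck A j (l \o f).
Proof.
move=> oA cl; elim: j f => [//|j IH] f [df Df]; split=> [x Ax|v].
  by have [] := diff_linear_comp cl (df x Ax).
apply: Ck_eq (IH _ (Df v)) => // x Ax /=.
have [dlf E] := diff_linear_comp cl (df x Ax).
by rewrite !deriveE // ?E //; exact: df.
Qed.

End Smooth.

(** * Symmetry of second derivatives and strict differentiability *)

Section Schwarz.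
Variables (R : realType).
Implicit Types V W : normedModType R.

Lemma near_normP V (x : V) (P : V -> Prop) : (\forall y \near x, P y) <->
  exists2 d : R, 0 < d & forall y, `|y - x| < d -> P y.
Proof.
split=> [/nbhs_ballP[d /= d0 dP]|[d d0 dP]].
  by exists d => // y yx; apply: dP; rewrite -ball_normE /= distrC.
by apply/nbhs_ballP; exists d => // y; rewrite -ball_normE /= distrC; exact: dP.
Qed.

Lemma hderiv_line V a b (u y : V) t : hderiv a b (fun s => s *: u + y) t u.
Proof.
move=> e e0; exists 1 => // s _ _.
by rewrite opprD addrACA subrr addr0 -scalerBl subrr normr0 mulr_ge0 // ltW.
Qed.

Lemma sub_sub4 (W : zmodType) (a b c d e : W) :
  a - b - c = (a - e - (d + c)) - (b - e - d).
Proof.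
have -> : a - e - (d + c) = a - (e + d) - c by rewrite !opprD !addrA.
have -> : b - e - d = b - (e + d) by rewrite opprD addrA.
by rewrite [RHS]addrAC opprB (addrA (a - _)) subrK.
Qed.

(** The second difference of [f] is compared with [h * h] times the second derivative by the mean
    value inequality in the direction [u] alone. The function so differentiated has as derivative a
    difference of two values of ['D_u f], up to a constant, so differentiability of ['D_u f] at the
    single point [x] is enough. *)
Lemma schwarz_aux V W (f : V -> W) x u v :
  (\forall y \near x, differentiable f y) -> differentiable ('D_u f) x ->
  forall e : R, 0 < e -> exists2 d : R, 0 < d & forall h, 0 < h < d ->
    `|f (h *: u + (h *: v + x)) - f (h *: u + x) - (f (h *: v + x) - f x)
      - (h * h) *: 'D_v ('D_u f) x| <= e * (h * h).
Proof.
move=> /near_normP[d1 d10 d1P] dG e e0.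
(* Both arguments of ['D_u f] stay within [h (|u| + |v|)] of [x]; with accuracy [e / N] the two
   errors together are at most [e * h]. *)
pose N := 2 * (`|u| + `|v|) + 1.
have uv0 : 0 <= `|u| + `|v| by rewrite addr_ge0.
have N0 : 0 < N by rewrite ltr_wpDl // mulr_ge0.
have [d2 d20 d2P] := diff_eps dG (divr_gt0 e0 N0).
exists (Num.min d1 d2 / N); first by rewrite divr_gt0 // lt_min d10.
move=> h /andP[h0]; rewrite ltr_pdivlMr // lt_min => /andP[hd1 hd2].
have uvN : `|u| + `|v| <= N by rewrite /N; lra.
have small s c : 0 <= s <= h -> (c = 0 \/ c = h) ->
    `|s *: u + c *: v| <= h * (`|u| + `|v|).
  move=> /andP[s0 sh] ch; apply: (le_trans (ler_normD _ _)).
  rewrite !normrZ (ger0_norm s0) mulrDr; apply: lerD.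
    exact: ler_wpM2r.
  case: ch => ->; first by rewrite normr0 mul0r mulr_ge0 // ltW.
  by rewrite ger0_norm // ltW.
have hN : h * (`|u| + `|v|) <= h * N by apply: ler_wpM2l => //; exact: ltW.
pose G := 'D_u f; pose l := 'D_v G x.
pose c0 := h *: v + x.
have mv : `|(f (h *: u + c0) - f (h *: u + x) - (h * h) *: l) -
   (f (0 *: u + c0) - f (0 *: u + x) - (0 * h) *: l)| <= e * h * (h - 0) - e * h * (0 - 0).
  apply: (@mean_value_le R W 0 h
    (fun s => f (s *: u + c0) - f (s *: u + x) - (s * h) *: l)
    (fun s => G (s *: u + c0) - G (s *: u + x) - h *: l)
    (fun s => e * h * (s - 0)) (fun=> e * h * 1)); first exact: ltW.
  - move=> s sI; apply: hderivB; first (apply: hderivB).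
    + have df : differentiable f (s *: u + c0).
        apply: d1P; rewrite /c0 addrA addrK.
        by apply: (le_lt_trans (small s h sI (or_intror erefl))); exact: le_lt_trans hd1.
      by rewrite /G deriveE //; exact: (hderiv_comp (hderiv_line _ _ _ _ _) df).
    + have df : differentiable f (s *: u + x).
        apply: d1P; rewrite addrK -[s *: u]addr0 -(scale0r v).
        by apply: (le_lt_trans (small s 0 sI (or_introl erefl))); exact: le_lt_trans hd1.
      by rewrite /G deriveE //; exact: (hderiv_comp (hderiv_line _ _ _ _ _) df).
    + move=> e' e'0; exists 1 => // s' _ _.
      have -> : (s' * h) *: l - (s * h) *: l - (s' - s) *: (h *: l) = 0.
        by rewrite scalerA mulrBl scalerBl subrr.
      by rewrite normr0 mulr_ge0 // ltW.
  - by move=> s _; apply: (@hderivZ R R^o _ _ (e * h)); exact: hderiv_shift.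
  - move=> s sI; rewrite mulr1.
    have k1 := small s h sI (or_intror erefl).
    have k2 := small s 0 sI (or_introl erefl); rewrite scale0r addr0 in k2.
    have := d2P (s *: u + c0); rewrite /c0 addrA addrK => /(_ (le_lt_trans k1 (le_lt_trans hN hd2))) A1.
    have := d2P (s *: u + x); rewrite addrK => /(_ (le_lt_trans k2 (le_lt_trans hN hd2))) A2.
    have -> : G (s *: u + h *: v + x) - G (s *: u + x) - h *: l =
      (G (s *: u + h *: v + x) - G x - 'd G x (s *: u + h *: v)) -
      (G (s *: u + x) - G x - 'd G x (s *: u)).
      have -> : 'd G x (s *: u + h *: v) = 'd G x (s *: u) + h *: l.
        by rewrite linearD /l deriveE //; congr (_ + _); rewrite linearZ.
      exact: sub_sub4.
    apply: (le_trans (ler_normB _ _)); apply: (le_trans (lerD A1 A2)).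
    have eN : 0 <= e / N by rewrite divr_ge0 // ltW.
    apply: (@le_trans _ _ (e / N * (h * (`|u| + `|v|)) + e / N * (h * (`|u| + `|v|)))).
      by apply: lerD; apply: ler_wpM2l.
    rewrite -mulrDr -mulrDr [leLHS](_ : _ = e * h * ((`|u| + `|v|) * 2 / N)).
      rewrite ler_piMr ?mulr_ge0 ?ltW // ltr_pdivrMr // mul1r /N; lra.
    by field; rewrite gt_eqF.
move: mv; rewrite !(scale0r, mul0r, add0r, oppr0, subr0, subrr, mulr0).
by rewrite -/c0 mulrA [in X in X -> _]addrAC.
Qed.

(** The second difference is symmetric in [u] and [v], so both mixed derivatives, multiplied by
    [h * h], approximate the same quantity within [e / 2 * (h * h)]. *)
Lemma schwarz V W (f : V -> W) x u v :
  (\forall y \near x, differentiable f y) -> differentiable ('D_u f) x ->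
  differentiable ('D_v f) x -> 'D_v ('D_u f) x = 'D_u ('D_v f) x.
Proof.
move=> df du dv; apply/eqP; rewrite -subr_eq0 -normr_le0.
apply/ler_addgt0Pr => e e0; rewrite add0r.
have e2 : 0 < e / 2 by rewrite divr_gt0.
have [d1 d10 d1P] := schwarz_aux v df du e2.
have [d2 d20 d2P] := schwarz_aux u df dv e2.
pose h := Num.min d1 d2 / 2.
have h0 : 0 < h by rewrite divr_gt0 // lt_min d10.
have hlt : h < Num.min d1 d2 by rewrite /h ltr_pdivrMr // ltr_pMr ?ltr1n // lt_min d10.
move: hlt; rewrite lt_min => /andP[hd1 hd2].
have := d1P h; rewrite h0 => /(_ hd1) A1.
have := d2P h; rewrite h0 => /(_ hd2) A2.
have hh : 0 < h * h by rewrite mulr_gt0.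
rewrite -(ler_pM2l hh) -[X in X * `|_|](gtr0_norm hh) -normrZ.
move: A1 A2; set P := 'D_v _ x; set Q := 'D_u _ x.
move=> A1 A2.
have -> : (h * h) *: (P - Q) =
  (f (h *: v + (h *: u + x)) - f (h *: v + x) - (f (h *: u + x) - f x) - (h * h) *: Q)
  - (f (h *: u + (h *: v + x)) - f (h *: u + x) - (f (h *: v + x) - f x) - (h * h) *: P).
  rewrite (addrCA (h *: v)) scalerBr; set F := f _; set a := f _; set b := f _.
  have -> : F - b - (a - f x) = F - a - (b - f x).
    by rewrite !opprB [LHS](AC (2*2) (1*4*(3*2))).
  by move: (F - a - _) => K; rewrite opprB [RHS]addrC subrKA.
apply: (le_trans (ler_normB _ _)); apply: (le_trans (lerD A2 A1)).
by rewrite -mulrDl -splitr mulrC.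
Qed.

Lemma derive_basis n W (f : 'rV[R]_n -> W) x v : differentiable f x ->
  'D_v f x = \sum_j v 0 j *: 'D_(delta_mx 0 j) f x.
Proof.
move=> df; rewrite deriveE // [in LHS](row_sum_delta v) linear_sum /=.
by apply: eq_bigr => j _; rewrite linearZ deriveE.
Qed.

(** Continuity of the partial derivatives brings ['d f y] close to ['d f x]; the mean value
    inequality on the segment between [z] and [y], which stays in the ball, gives the second
    estimate. Having two moving points is what Lipschitz bounds and estimates uniform along a curve
    require. *)
Lemma strict_diff n W (f : 'rV[R]_n -> W) x :
  (\forall y \near x, differentiable f y) ->
  (forall j, {for x, continuous ('D_(delta_mx 0 j) f)}) ->
  forall e : R, 0 < e -> exists2 r : R, 0 < r &
    (forall y w, `|y - x| < r -> `|'d f y w - 'd f x w| <= e * `|w|) /\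
    (forall y z, `|y - x| < r -> `|z - x| < r ->
      `|f y - f z - 'd f x (y - z)| <= e * `|y - z|).
Proof.
move=> df Dc e e0.
have e1 : 0 < e / n.+1%:R by rewrite divr_gt0.
have : \forall y \near x, differentiable f y /\
    forall j : 'I_n, `|'D_(delta_mx 0 j) f y - 'D_(delta_mx 0 j) f x| < e / n.+1%:R.
  apply: filterI => //.
  have /filter_forall : forall j : 'I_n, nbhs x [set y |
      `|'D_(delta_mx 0 j) f y - 'D_(delta_mx 0 j) f x| < e / n.+1%:R].
    move=> j; move/cvgrPdist_lt : (Dc j) => /(_ _ e1); apply: filterS => y.
    by rewrite /= distrC.
  exact.
move=> /near_normP[r r0 rP]; exists r => //.
have dfx : differentiable f x by exact: nbhs_singleton df.
have A y w : `|y - x| < r -> `|'d f y w - 'd f x w| <= e * `|w|.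
  move=> /rP[dfy yD].
  have -> : 'd f y w - 'd f x w = \sum_j w 0 j *:
      ('D_(delta_mx 0 j) f y - 'D_(delta_mx 0 j) f x).
    transitivity ('D_w f y - 'D_w f x).
      by congr (_ - _); [exact: esym (deriveE w dfy) | exact: esym (deriveE w dfx)].
    rewrite (derive_basis w dfy) (derive_basis w dfx) -sumrB.
    by apply: eq_bigr => j _; rewrite scalerBr.
  apply: (le_trans (ler_norm_sum _ _ _)).
  apply: (@le_trans _ _ (\sum_(j < n) (e / n.+1%:R * `|w|))).
    apply: ler_sum => j _; rewrite normrZ mulrC.
    by apply: ler_pM => //; [exact: ltW | exact: rV_coord_le].
  rewrite sumr_const card_ord -[_ *+ n]mulr_natr mulrAC; apply: ler_wpM2r => //.
  by rewrite mulrAC ler_pdivrMr // ler_pM2l // ler_nat.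
split=> // y z yr zr.
have seg (s : R) : 0 <= s <= 1 -> `|s *: (y - z) + z - x| < r.
  move=> /andP[s0 s1].
  have -> : s *: (y - z) + z - x = s *: (y - x) + (1 - s) *: (z - x).
    rewrite scalerBl scale1r -[y - z](subrKA x) -[x - z]opprB scalerBr.
    by rewrite -!addrA; congr (_ + _); rewrite addrC -!addrA.
  apply: (le_lt_trans (ler_normD _ _)); rewrite !normrZ (ger0_norm s0).
  rewrite ger0_norm ?subr_ge0 //.
  by have [->|] := eqVneq s 0; [rewrite mul0r subr0 mul1r add0r | nra].
have mv : `|(f (1 *: (y - z) + z) - 1 *: 'd f x (y - z)) -
    (f (0 *: (y - z) + z) - 0 *: 'd f x (y - z))| <=
    e * `|y - z| * (1 - 0) - e * `|y - z| * (0 - 0).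
  apply: (@mean_value_le R W 0 1 (fun s => f (s *: (y - z) + z) - s *: 'd f x (y - z))
    (fun s => 'd f (s *: (y - z) + z) (y - z) - 'd f x (y - z))
    (fun s => e * `|y - z| * (s - 0)) (fun=> e * `|y - z| * 1)) => //.
  - move=> s sI; apply: hderivB.
      apply: (hderiv_comp (hderiv_line _ _ _ _ _)).
      by have [] := rP _ (seg s sI).
    have := @hderiv_line W 0 1 ('d f x (y - z)) 0 s.
    by apply: hderiv_eq; [rewrite addr0 | exists 1 => // s' _ _; rewrite addr0].
  - by move=> s _; apply: (@hderivZ R R^o _ _ (e * `|y - z|)); exact: hderiv_shift.
  - by move=> s sI; rewrite mulr1; apply: A; exact: seg.
move: mv; rewrite !(scale0r, scale1r, add0r, oppr0, subr0, subrr, mulr0, mulr1) subrK.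
by rewrite [in X in X -> _]addrAC.
Qed.

End Schwarz.

(** * Smooth maps between spaces of row vectors *)

Section SmoothRow.
Variables (R : realType).
Implicit Types V W : normedModType R.

Lemma smooth_on_diff V W (A : set V) (f : V -> W) x :
  smooth_on A f -> A x -> differentiable f x.
Proof. by move=> H Ax; exact: (H [::] x Ax). Qed.

Lemma smooth_on_derive V W (A : set V) (f : V -> W) v :
  smooth_on A f -> smooth_on A ('D_v f).
Proof. by move=> /smooth_onE[]. Qed.

Lemma smooth_on_eq V W (A : set V) (f g : V -> W) : open A ->
  (forall x, A x -> f x = g x) -> smooth_on A f -> smooth_on A g.
Proof. by move=> oA fg /smooth_onP H; apply/smooth_onP => j; exact: Ck_eq (H j). Qed.

Lemma smooth_on_subset V W (A B : set V) (f : V -> W) :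
  A `<=` B -> smooth_on B f -> smooth_on A f.
Proof. by move=> AB H vs x /AB; exact: H. Qed.

Lemma smooth_on_local V W (A : set V) (f : V -> W) :
  (forall x, A x -> exists2 B : set V, B x & smooth_on B f) -> smooth_on A f.
Proof. by move=> H vs x /H[B Bx]; exact. Qed.

Lemma smooth_on_cst V W (A : set V) (k : W) : smooth_on A (fun=> k).
Proof. by apply/smooth_onP => j; exact: Ck_cst. Qed.

Lemma smooth_onD V W (A : set V) (f g : V -> W) : open A ->
  smooth_on A f -> smooth_on A g -> smooth_on A (fun x => f x + g x).
Proof.
by move=> oA /smooth_onP Hf /smooth_onP Hg; apply/smooth_onP => j; exact: CkD.
Qed.

Lemma smooth_on_scale V W (A : set V) (h : V -> R^o) (F : V -> W) : open A ->
  smooth_on A h -> smooth_on A F -> smooth_on A (fun x => (h x : R) *: F x).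
Proof.
by move=> oA /smooth_onP Hf /smooth_onP Hg; apply/smooth_onP => j; exact: Ck_scale.
Qed.

Lemma smooth_onM V (A : set V) (h F : V -> R^o) : open A ->
  smooth_on A h -> smooth_on A F -> smooth_on A (fun x => (h x : R) * (F x : R) : R^o).
Proof. by move=> oA Hh HF; exact: smooth_on_scale oA Hh HF. Qed.

Lemma smooth_onB V W (A : set V) (f g : V -> W) : open A ->
  smooth_on A f -> smooth_on A g -> smooth_on A (fun x => f x - g x).
Proof.
move=> oA Hf Hg.
have H := smooth_on_scale oA (@smooth_on_cst _ _ A (-1 : R^o)) Hg.
apply: (smooth_on_eq oA _ (smooth_onD oA Hf H)).
by move=> x _; rewrite scaleN1r.
Qed.

Lemma smooth_on_sum V W (I : Type) (r : seq I) (A : set V) (f : I -> V -> W) :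
  open A -> (forall i, smooth_on A (f i)) -> smooth_on A (fun x => \sum_(i <- r) f i x).
Proof.
by move=> oA H; apply/smooth_onP => j; apply: Ck_sum => // i; move/smooth_onP: (H i).
Qed.

Lemma smooth_on_prod V (I : Type) (r : seq I) (A : set V) (f : I -> V -> R^o) :
  open A -> (forall i, smooth_on A (f i)) ->
  smooth_on A (fun x => (\prod_(i <- r) (f i x : R) : R^o)).
Proof.
by move=> oA H; apply/smooth_onP => j; apply: Ck_prod => // i; move/smooth_onP: (H i).
Qed.

Lemma smooth_onV V (A : set V) (f : V -> R^o) : open A ->
  (forall x, A x -> (f x : R) != 0) -> smooth_on A f ->
  smooth_on A (fun x => (f x : R)^-1 : R^o).
Proof.
by move=> oA f0 /smooth_onP H; apply/smooth_onP => j; exact: CkV.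
Qed.

Lemma smooth_on_coord V n (A : set V) (f : V -> 'rV[R]_n) i : open A ->
  smooth_on A f -> smooth_on A (fun x => f x 0 i : R^o).
Proof.
move=> oA /smooth_onP H; apply/smooth_onP => j.
have @l : {linear 'rV[R]_n -> R^o}.
  by exists (fun N : 'rV[R]_n => N 0 i); do 2![eexists]; do ?[constructor];
     rewrite ?mxE// => ? *; rewrite ?mxE//; move=> ?; rewrite !mxE.
by apply: (Ck_linear (l := l) oA _ (H j)) => N; exact: coord_continuous.
Qed.

Lemma smooth_on_derive_dir n W (A : set 'rV[R]_n) (a : 'rV[R]_n -> 'rV[R]_n)
    (f : 'rV[R]_n -> W) : open A ->
  smooth_on A a -> smooth_on A f -> smooth_on A (fun x => 'D_(a x) f x).
Proof.
move=> oA Ha Hf.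
apply: (@smooth_on_eq _ _ _
  (fun x => \sum_(j <- index_enum 'I_n) a x 0 j *: 'D_(delta_mx 0 j) f x)) => //.
  by move=> x Ax; rewrite [RHS]derive_basis //; exact: smooth_on_diff Ax.
apply: smooth_on_sum => // j; apply: smooth_on_scale => //.
  exact: smooth_on_coord.
exact: smooth_on_derive.
Qed.

Lemma smooth_on_det V k (A : set V) (B : V -> 'M[R]_k) : open A ->
  (forall i j, smooth_on A (fun x => B x i j : R^o)) ->
  smooth_on A (fun x => \det (B x) : R^o).
Proof.
move=> oA H.
apply: (@smooth_on_sum _ R^o _ (index_enum {perm 'I_k}) A
  (fun (s : {perm 'I_k}) x => (-1) ^+ s * \prod_i B x i (s i) : R^o)) => // s.
apply: (@smooth_onM _ _ (fun=> (-1) ^+ s) (fun x => \prod_i B x i (s i))) => //.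
  exact: smooth_on_cst.
by apply: smooth_on_prod => // i; exact: H.
Qed.

Lemma open_neq0 V (A : set V) (f : V -> R^o) : open A ->
  (forall x, A x -> {for x, continuous f}) -> open (A `&` [set x | (f x : R) != 0]).
Proof.
move=> oA fc; rewrite openE => x [Ax fx]; apply: filterI.
  exact: open_nbhs_nbhs.
have : nbhs (f x : R^o) [set y | y != 0] by apply: open_nbhs_nbhs; split => //; exact: open_neq.
exact: fc.
Qed.

(* Cramer's rule. *)
Lemma smooth_on_coef n k (A : set 'rV[R]_n) (w : 'I_k -> 'rV[R]_n -> 'rV[R]_n)
    (g : 'I_k -> 'rV[R]_n -> R^o) (s : 'rV[R]_n -> 'rV[R]_n) : open A ->
  (forall i, smooth_on A (w i)) -> smooth_on A s ->
  (forall x, A x -> s x = \sum_i (g i x : R) *: w i x) ->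
  (forall x, A x -> forall c : 'I_k -> R, \sum_i c i *: w i x = 0 -> forall i, c i = 0) ->
  forall i, smooth_on A (g i).
Proof.
move=> oA Hw Hs sg free i; apply: smooth_on_local => x Ax.
pose M y : 'M[R]_(k, n) := \matrix_(i, j) w i y 0 j.
have ME y (c : 'rV[R]_k) : c *m M y = \sum_i c 0 i *: w i y.
  apply/rowP => j; rewrite !mxE summxE; apply: eq_bigr => l _.
  by rewrite !mxE.
(* [P] is a right inverse of the matrix of the [w i] at the point [x] alone. Near [x] the square
   matrix [B y = M y *m P] keeps a nonzero determinant, and the row of coefficients is found from
   [s y *m P] by the adjugate of [B y]. Smoothness being local, this neighbourhood suffices. *)
have /row_freeP[P MP] : row_free (M x).
  rewrite -kermx_eq0; apply/eqP/row_matrixP => l; rewrite row0.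
  have : row l (kermx (M x)) *m M x = 0 by rewrite -row_mul mulmx_ker row0.
  by rewrite ME => /(free x Ax) H; apply/rowP => j; rewrite H mxE.
pose B y := M y *m P.
have HB a b : smooth_on A (fun y => B y a b : R^o).
  apply: (@smooth_on_eq _ _ _ (fun y => \sum_(l <- index_enum 'I_n)
      (w a y 0 l : R) *: (P l b : R^o))) => //.
    by move=> y _; rewrite /B mxE; apply: eq_bigr => l _; rewrite mxE.
  apply: smooth_on_sum => // l; apply: smooth_on_scale => //.
    exact: smooth_on_coord.
  exact: smooth_on_cst.
have Hd : smooth_on A (fun y => \det (B y) : R^o) by exact: smooth_on_det.
pose A' := A `&` [set y | \det (B y) != 0].
have oA' : open A'.
  apply: (@open_neq0 _ _ (fun y => \det (B y) : R^o)) => // y Ay.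
  exact: differentiable_continuous (smooth_on_diff Hd Ay).
exists A'; first by split; rewrite //= /B MP det1 oner_neq0.
have A'A : A' `<=` A by move=> y [].
pose sP (j : 'I_k) (y : 'rV[R]_n) : R := \sum_(l <- index_enum 'I_n) s y 0 l * P l j.
pose num (y : 'rV[R]_n) : R := \sum_(j <- index_enum 'I_k) sP j y * cofactor (B y) i j.
apply: (@smooth_on_eq _ _ _ (fun y => (\det (B y))^-1 * num y : R^o)) => //.
  move=> y [Ay dy].
  have uB : B y \in unitmx by rewrite unitmxE unitfE.
  pose gr : 'rV[R]_k := \row_j g j y.
  have E : gr *m B y = s y *m P.
    rewrite /B mulmxA ME sg //; congr (_ *m P); apply: eq_bigr => j _.
    by rewrite mxE.
  have -> : g i y = gr 0 i by rewrite mxE.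
  rewrite -[gr](mulmxK uB) E /invmx uB -scalemxAr mxE; congr (_ * _).
  rewrite mxE; apply: eq_bigr => j _; rewrite !mxE.
  by congr (_ * _); apply: eq_bigr.
apply: (smooth_onM oA').
  by apply: smooth_onV => // [y []//|]; exact: smooth_on_subset Hd.
apply: smooth_on_sum => // j; apply: (smooth_onM oA').
  apply: smooth_on_sum => // l.
  apply: (@smooth_onM _ _ (fun y => s y 0 l) (fun=> P l j)) => //.
    exact: smooth_on_subset A'A (smooth_on_coord l oA Hs).
  exact: smooth_on_cst.
apply: (@smooth_onM _ _ (fun=> (-1) ^+ (i + j)) (fun y => \det (row' i (col' j (B y))))) => //.
  exact: smooth_on_cst.
apply: smooth_on_det => // a b.
apply: (@smooth_on_eq _ _ _ (fun y => B y (lift i a) (lift j b) : R^o)) => //.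
  by move=> y _; rewrite !mxE.
exact: smooth_on_subset A'A (HB _ _).
Qed.

End SmoothRow.

(** * Local flows *)

Section LocalFlow.
Variables (R : realType) (n : nat).
Implicit Types (F : 'rV[R]_n -> 'rV[R]_n) (x y z : 'rV[R]_n).

Lemma smooth_on_near (V W : normedModType R) (A : set V) (f : V -> W) (x : V) :
  open A -> A x -> smooth_on A f -> \forall y \near x, differentiable f y.
Proof.
move=> oA Ax Hf; apply: filterS (open_nbhs_nbhs (conj oA Ax)) => y.
exact: smooth_on_diff.
Qed.

Lemma smooth_strict_diff (A : set 'rV[R]_n) F x : open A -> smooth_on A F -> A x ->
  forall e : R, 0 < e -> exists2 r : R, 0 < r &
    (forall y w, `|y - x| < r -> `|'d F y w - 'd F x w| <= e * `|w|) /\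
    (forall y z, `|y - x| < r -> `|z - x| < r ->
      `|F y - F z - 'd F x (y - z)| <= e * `|y - z|).
Proof.
move=> oA HF Ax; apply: strict_diff; first exact: smooth_on_near oA Ax HF.
move=> j; apply: differentiable_continuous.
exact: smooth_on_diff (smooth_on_derive _ HF) Ax.
Qed.

Lemma local_lipschitz (A : set 'rV[R]_n) F x : open A -> smooth_on A F -> A x ->
  exists r L : R, [/\ 0 < r, 0 < L,
    (forall y, `|y - x| < r -> A y),
    (forall y w, `|y - x| < r -> `|'d F y w| <= L * `|w|) &
    (forall y z, `|y - x| < r -> `|z - x| < r -> `|F y - F z| <= L * `|y - z|)].
Proof.
move=> oA HF Ax; have [r1 r10 [H1 H2]] := smooth_strict_diff oA HF Ax ltr01.
have /near_normP[r2 r20 H3] := open_nbhs_nbhs (conj oA Ax).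
have [k k0 kP] := diff_bound (smooth_on_diff HF Ax).
exists (Num.min r1 r2), (1 + k); split.
- by rewrite lt_min r10.
- by rewrite addr_gt0.
- by move=> y; rewrite lt_min => /andP[_]; exact: H3.
- move=> y w; rewrite lt_min => /andP[yr _].
  rewrite -(subrK ('d F x w) ('d F y w)) mulrDl.
  by apply: (le_trans (ler_normD _ _)); apply: lerD; [exact: H1 | exact: kP].
- move=> y z; rewrite !lt_min => /andP[yr _] /andP[zr _].
  rewrite -(subrK ('d F x (y - z)) (F y - F z)) mulrDl.
  by apply: (le_trans (ler_normD _ _)); apply: lerD; [exact: H2 | exact: kP].
Qed.

(** Retraction onto the closed ball of radius [r] around [x]; for the maximum norm this ball is a
    box, so that the retraction acts on each coordinate separately and is 1-Lipschitz. *)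
Definition clamp x (r : R) y : 'rV[R]_n :=
  \row_i Num.max (x 0 i - r) (Num.min (x 0 i + r) (y 0 i)).

Lemma clamp_lip x r y z : 0 <= r -> `|clamp x r y - clamp x r z| <= `|y - z|.
Proof.
move=> r0; rewrite rV_norm_le //; apply/forallP => i; rewrite !mxE.
apply: (le_trans _ (rV_coord_le (y - z) i)); rewrite !mxE.
have := ler_norm (y 0 i - z 0 i); have := ler_norm (z 0 i - y 0 i).
rewrite (distrC (z 0 i)) ler_norml.
case: (leP (x 0 i + r) (y 0 i)) => ?; case: (leP (x 0 i + r) (z 0 i)) => ?;
case: (leP (x 0 i - r) (x 0 i + r)) => ?; case: (leP (x 0 i - r) (y 0 i)) => ?;
case: (leP (x 0 i - r) (z 0 i)) => ?; lra.
Qed.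

Lemma clamp_le x r y : 0 <= r -> `|clamp x r y - x| <= r.
Proof.
move=> r0; rewrite rV_norm_le //; apply/forallP => i; rewrite !mxE ler_norml.
case: (leP (x 0 i + r) (y 0 i)) => ?; case: (leP (x 0 i - r) (x 0 i + r)) => ?;
case: (leP (x 0 i - r) (y 0 i)) => ?; lra.
Qed.

Lemma clamp_id x r y : 0 <= r -> `|y - x| <= r -> clamp x r y = y.
Proof.
move=> r0; rewrite rV_norm_le // => /forallP H; apply/rowP => i.
have := H i; rewrite !mxE ler_norml => /andP[? ?].
by rewrite min_r ?max_r //; lra.
Qed.

(* [clamp] makes the field globally Lipschitz, so that the solutions exist on all of [a, b];
   Gronwall then keeps those starting near [c a] where [clamp] is the identity. *)
Lemma box_flow F x (r L a b : R) (c : R -> 'rV[R]_n) : 0 < r -> 0 < L -> a <= b ->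
  (forall y z, `|y - x| < r -> `|z - x| < r -> `|F y - F z| <= L * `|y - z|) ->
  (forall t, a <= t <= b -> hderiv a b c t (F (c t)) /\ `|c t - x| < r / 4) ->
  exists g : 'rV[R]_n -> R -> 'rV[R]_n, exists eta C : R, [/\ 0 < eta, 0 < C &
    forall y, `|y - c a| < eta -> g y a = y /\ forall t, a <= t <= b ->
      [/\ hderiv a b (g y) t (F (g y t)), `|g y t - x| < r / 2 &
          `|g y t - c t| <= C * `|y - c a|]].
Proof.
move=> r0 L0 ab lip Hc.
have r2 : 0 <= r / 2 by rewrite divr_ge0 // ltW.
have clr y : `|clamp x (r / 2) y - x| < r.
  by apply: (le_lt_trans (clamp_le _ _ r2)); lra.
have E y : exists g : R -> 'rV[R]_n, g a = y /\
    forall t, a <= t <= b -> hderiv a b g t (F (clamp x (r / 2) (g t))).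
  apply: (@picard R n a b (fun _ z => F (clamp x (r / 2) z)) L) => //.
    move=> t _ y1 y2; apply: (le_trans (lip _ _ (clr _) (clr _))).
    by apply: ler_wpM2l; [exact: ltW | exact: clamp_lip].
  move=> t _ y1 e e0; exists 1 => // s _ _; by rewrite subrr normr0.
have [g gP] := choice E.
pose C := 2 * expR (2 * L * (b - a)).
have C0 : 0 < C by rewrite mulr_gt0 // expR_gt0.
(* [C] is the Gronwall factor. The choice of [eta] keeps a solution within [r / 4] of [c], itself
   within [r / 4] of [x], so it never leaves the box of radius [r / 2] on which [clamp] is the
   identity. *)
exists g, (r / 4 / C), C; split => //; first by rewrite !divr_gt0.
move=> y ye; have [ga gD] := gP y; split=> // t tI.
have key s : a <= s <= b -> `|g y s - c s| <= C * `|y - c a|.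
  move=> sI.
  have := @gronwall R _ a b (fun s => g y s - c s)
    (fun s => F (clamp x (r / 2) (g y s)) - F (c s)) L 0 L0 (lexx _).
  move=> /(_ _ _ s sI); rewrite ga mul0r addr0 => H.
  apply: (le_trans (H _ _)).
  - by move=> u uI; apply: hderivB; [exact: gD | exact: (Hc u uI).1].
  - move=> u uI; rewrite addr0; have cu := (Hc u uI).2.
    rewrite -{1}(@clamp_id x (r / 2) (c u) r2); last by apply: ltW; lra.
    apply: (le_trans (lip _ _ (clr _) (clr _))).
    by apply: ler_wpM2l; [exact: ltW | exact: clamp_lip].
  rewrite /C mulrAC; apply: ler_wpM2r => //; apply: ler_wpM2l => //.
  rewrite ler_expR; apply: ler_wpM2l; first by rewrite mulr_ge0 // ltW.
  by rewrite lerD2r; case/andP: sI.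
have near_x s : a <= s <= b -> `|g y s - x| < r / 2.
  move=> sI; rewrite -(subrKA (c s)); apply: (le_lt_trans (ler_normD _ _)).
  have := key s sI; have := (Hc s sI).2.
  have : C * `|y - c a| < r / 4 by rewrite mulrC -ltr_pdivlMr.
  by move=> *; lra.
split; [|exact: near_x|exact: key].
have := gD t tI; rewrite clamp_id //; apply: ltW; exact: near_x.
Qed.

(** Near [c t0] the estimate between two moving points covers all neighbouring base points at once;
    the induction along the interval then retains the smaller of the radii. *)
Lemma uniform_diff (A : set 'rV[R]_n) F (a b : R) (c : R -> 'rV[R]_n) :
  a <= b -> open A -> smooth_on A F ->
  (forall t, a <= t <= b -> A (c t) /\ hcont a b c t) ->
  forall e : R, 0 < e -> exists2 d : R, 0 < d & forall t y, a <= t <= b ->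
    `|y - c t| < d -> `|F y - F (c t) - 'd F (c t) (y - c t)| <= e * `|y - c t|.
Proof.
move=> ab oA HF Hc e e0.
apply: (@real_induction R a b (fun s => exists2 d : R, 0 < d & forall t y, a <= t <= s ->
    `|y - c t| < d -> `|F y - F (c t) - 'd F (c t) (y - c t)| <= e * `|y - c t|) ab).
  have aI : a <= a <= b by rewrite lexx.
  have [d d0 dP] := diff_eps (smooth_on_diff HF (Hc a aI).1) e0.
  by exists d => // t y /le_anti <-; exact: dP.
move=> t0 t0I; have e2 : 0 < e / 2 by rewrite divr_gt0.
have [r r0 [H1 H2]] := smooth_strict_diff oA HF (Hc t0 t0I).1 e2.
have [d d0 dP] := (Hc t0 t0I).2 _ (divr_gt0 r0 (ltr0n _ 2)).
exists d => // s1 s2 /andP[as1 s1t] /andP[ts2 s2b] ds1 ds2 [d' d'0 d'P].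
exists (Num.min d' (r / 2)); first by rewrite lt_min d'0 divr_gt0.
move=> t y /andP[at_ ts]; rewrite lt_min => /andP[yd yr].
have [ts1|ts1] := leP t s1; first by apply: d'P => //; rewrite at_.
have tI : a <= t <= b by lra.
have td : `|t - t0| < d by rewrite ltr_norml; lra.
have ct := dP t tI td.
have yt : `|y - c t0| < r.
  rewrite -(subrKA (c t)); apply: (le_lt_trans (ler_normD _ _)); lra.
have ct' : `|c t - c t0| < r by lra.
have A1 := H2 _ _ yt ct'; have A2 := H1 _ (y - c t) ct'.
have tri (p q s : 'rV[R]_n) : `|p - q| <= e / 2 * `|y - c t| ->
    `|s - q| <= e / 2 * `|y - c t| -> `|p - s| <= e * `|y - c t|.
  move=> H3 H4; rewrite -(subrKA q); apply: (le_trans (ler_normD _ _)).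
  rewrite (distrC q); move: H3 H4; move: `|p - q| `|s - q| `|y - c t| => *; lra.
exact: tri A1 A2.
Qed.

Lemma linear_hom_zero (F' : R -> 'rV[R]_n -> 'rV[R]_n) (L a b : R) (J : R -> 'rV[R]_n) :
  0 < L -> (forall t w, a <= t <= b -> `|F' t w| <= L * `|w|) ->
  (forall t, a <= t <= b -> hderiv a b J t (F' t (J t))) -> J a = 0 ->
  forall t, a <= t <= b -> J t = 0.
Proof.
move=> L0 bd HJ Ja t tI; apply/eqP; rewrite -normr_le0.
have := @gronwall R _ a b J (fun s => F' s (J s)) L 0 L0 (lexx _) HJ.
move=> /(_ _ t tI); rewrite Ja normr0 mul0r addr0 mulr0 mul0r; apply=> s sI.
by rewrite addr0; exact: bd.
Qed.

End LocalFlow.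

(** * Differentiability of the flow in the initial point *)

Section FlowDiff.
Variables (R : realType) (n : nat).
Implicit Types (F : 'rV[R]_n -> 'rV[R]_n) (x y z : 'rV[R]_n).

(** The candidate for the differential of the flow: the [w j] will be the final values of the
    solutions of the variational equation that start at the basis vectors. A matrix product supplies
    the linear structure. *)
Lemma rV_comb_linear k (w : 'I_n -> 'rV[R]_k) :
  exists2 l : {linear 'rV[R]_n -> 'rV[R]_k},
    (forall h, differentiable l h) &
    forall h, l h = \sum_j h 0 j *: w j.
Proof.
pose W : 'M[R]_(n, k) := \matrix_j w j.
have E (h : 'rV[R]_n) : h *m W = \sum_j h 0 j *: w j.
  apply/rowP => j; rewrite !mxE summxE; apply: eq_bigr => l _.
  by rewrite !mxE.
pose l : {linear 'rV[R]_n -> 'rV[R]_k} := mulmxr W.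
have lE h : l h = \sum_j h 0 j *: w j by rewrite -E.
exists l => // h.
have H : smooth_on setT (fun h : 'rV[R]_n => \sum_j h 0 j *: w j).
  apply: smooth_on_sum => [|j]; first exact: openT.
  apply: smooth_on_scale; [exact: openT | | exact: smooth_on_cst].
  apply: smooth_on_coord; first exact: openT.
  move=> vs y _; elim/last_ind: vs => [//|vs v _].
  rewrite /iter_derive foldr_rcons (_ : 'D_v _ = fun=> v); last first.
    by apply/funext => u; exact: derive_id.
  exact: (@smooth_on_cst R _ _ setT v vs y I).
have Hl : smooth_on setT (l : 'rV[R]_n -> 'rV[R]_k).
  by apply: (smooth_on_eq openT _ H) => y _; rewrite lE.
exact: smooth_on_diff Hl I.
Qed.

(** The error [rho] of the first order approximation starts at 0 and solves the variational equation
    up to the Taylor remainder of [F] along [c], which is small relative to [|y - c a|] uniformly in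
    time; Gronwall bounds its final value. By uniqueness, any solution [J] of the variational
    equation is the combination of the [w j] with the coordinates of [J a]. *)
Lemma flow_diff (A : set 'rV[R]_n) F (L a b : R) (c : R -> 'rV[R]_n)
    (g : 'rV[R]_n -> R -> 'rV[R]_n) (eta C : R) :
  a <= b -> open A -> smooth_on A F -> 0 < L -> 0 < eta -> 0 < C ->
  (forall t, a <= t <= b -> [/\ A (c t), hderiv a b c t (F (c t)) &
     forall w, `|'d F (c t) w| <= L * `|w|]) ->
  (forall y, `|y - c a| < eta -> g y a = y /\ forall t, a <= t <= b ->
      hderiv a b (g y) t (F (g y t)) /\ `|g y t - c t| <= C * `|y - c a|) ->
  differentiable (g ^~ b) (c a) /\
  forall J : R -> 'rV[R]_n,
    (forall t, a <= t <= b -> hderiv a b J t ('d F (c t) (J t))) ->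
    'd (g ^~ b) (c a) (J a) = J b.
Proof.
move=> ab oA HF L0 eta0 C0 Hc Hg.
have aI : a <= a <= b by rewrite lexx.
have bI : a <= b <= b by rewrite lexx andbT.
have E j : exists w : R -> 'rV[R]_n, w a = delta_mx 0 j /\
    forall t, a <= t <= b -> hderiv a b w t ('d F (c t) (w t)).
  apply: (@picard R n a b (fun t z => 'd F (c t) z) L) => //.
    move=> t tI y1 y2; rewrite -linearB; have [_ _] := Hc t tI; exact.
  move=> t tI v.
  have [Act cD _] := Hc t tI.
  have dv : differentiable ('D_v F) (c t).
    exact: smooth_on_diff (smooth_on_derive v HF) Act.
  apply: (@hcont_eq _ _ a b ('D_v F \o c)).
  - exact: deriveE (smooth_on_diff HF Act).
  - exists 1 => // s sI _; have [Acs _ _] := Hc s sI.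
    exact: deriveE (smooth_on_diff HF Acs).
  - exact: hderiv_cont (hderiv_comp cD dv).
have [w wP] := choice E.
have wD (h : 'rV[R]_n) t : a <= t <= b ->
    hderiv a b (fun s => \sum_j h 0 j *: w j s) t ('d F (c t) (\sum_j h 0 j *: w j t)).
  move=> tI; rewrite linear_sum; apply: hderiv_sum => j.
  have -> : 'd F (c t) (h 0 j *: w j t) = h 0 j *: 'd F (c t) (w j t).
    by rewrite linearZ.
  by apply: hderivZ; exact: (wP j).2.
have wa (h : 'rV[R]_n) : \sum_j h 0 j *: w j a = h.
  by rewrite [RHS]row_sum_delta; apply: eq_bigr => j _; rewrite (wP j).1.
have [l lc lE] := rV_comb_linear (fun j => w j b).
have [H1 H2] : differentiable (g ^~ b) (c a) /\ 'd (g ^~ b) (c a) = l :> (_ -> _).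
  apply: diff_of_eps => [h|e e0]; first exact: differentiable_continuous (lc h).
  (* The Gronwall factor times the constant [C] by which the flow expands distances: Taylor accuracy
     [e / K] along the curve becomes [e * |h|] at the end. The 1 keeps [K] positive when [a = b]. *)
  pose K := 2 * C * (b - a + 1) * expR (2 * L * (b - a)).
  have ba0 : 0 <= b - a by rewrite subr_ge0.
  have K0 : 0 < K.
    rewrite !mulr_gt0 ?expR_gt0 //; lra.
  have cc t : a <= t <= b -> A (c t) /\ hcont a b c t.
    by move=> /Hc[? /hderiv_cont ? _].
  have [d d0 dP] := uniform_diff ab oA HF cc (divr_gt0 e0 K0).
  exists (Num.min eta (d / C)); first by rewrite lt_min eta0 divr_gt0.
  move=> y; rewrite lt_min => /andP[yeta yd].
  have [ga gD] := Hg y yeta.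
  have ca : `|c a - c a| < eta by rewrite subrr normr0.
  have gcb : g (c a) b = c b.
    have [_ /(_ b bI)[_]] := Hg _ ca; rewrite subrr normr0 mulr0 normr_le0.
    by rewrite subr_eq0 => /eqP.
  pose h := y - c a.
  pose rho s := g y s - c s - \sum_j h 0 j *: w j s.
  have rho0 : rho a = 0 by rewrite /rho wa ga subrr.
  have e1 : 0 <= e / K * (C * `|h|).
    apply: mulr_ge0; first by apply: divr_ge0; exact: ltW.
    by apply: mulr_ge0 => //; exact: ltW.
  have := @gronwall R _ a b rho
    (fun s => F (g y s) - F (c s) - 'd F (c s) (\sum_j h 0 j *: w j s)) L _ L0 e1.
  move=> /(_ _ _ b bI); rewrite rho0 normr0 add0r => G.
  rewrite lE -/h gcb; apply: (le_trans (G _ _)).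
  - move=> t tI; apply: hderivB; last exact: wD.
    by apply: hderivB; [exact: (gD t tI).1 | have [] := Hc t tI].
  - move=> t tI; have [Act _ bd] := Hc t tI.
    have -> : F (g y t) - F (c t) - 'd F (c t) (\sum_j h 0 j *: w j t) =
      'd F (c t) (rho t) + (F (g y t) - F (c t) - 'd F (c t) (g y t - c t)).
      rewrite /rho [X in _ = X + _]linearB /=.
      by rewrite [RHS]addrC subrKA.
    apply: (le_trans (ler_normD _ _)); apply: lerD; first exact: bd.
    have gc := (gD t tI).2.
    have gcd : `|g y t - c t| < d.
      by apply: (le_lt_trans gc); rewrite mulrC -ltr_pdivlMr.
    apply: (le_trans (dP t _ tI gcd)).
    by apply: ler_wpM2l => //; apply: divr_ge0; exact: ltW.
  have -> : 2 * (e / K * (C * `|h|) * (b - a)) * expR (2 * L * (b - a)) =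
    e * `|h| * ((2 * C * (b - a) * expR (2 * L * (b - a))) / K).
    by field; rewrite gt_eqF.
  apply: ler_piMr; first by rewrite mulr_ge0 // ltW.
  rewrite ler_pdivrMr // mul1r /K; apply: ler_wpM2r; first exact: expR_ge0.
  by apply: ler_wpM2l; [rewrite mulr_ge0 // ltW | rewrite lerDl].
split=> // J HJ; rewrite H2 lE.
have := @linear_hom_zero R n (fun t z => 'd F (c t) z) L a b
  (fun s => J s - \sum_j J a 0 j *: w j s) L0.
move=> /(_ _ _ _ b bI) H.
apply/esym/subr0_eq; apply: H.
- by move=> t z tI; have [] := Hc t tI.
- move=> t tI; rewrite linearB; apply: hderivB; [exact: HJ | exact: wD].
- by rewrite wa subrr.
Qed.

(** The radius [r] is fixed before the interval and the curve, so the same estimate serves every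
    piece of a curve that stays close to [x]; the induction along [c] relies on this order. *)
Theorem local_flow (A : set 'rV[R]_n) F x : open A -> smooth_on A F -> A x ->
  exists r L : R, [/\ 0 < r, 0 < L, (forall y, `|y - x| < r -> A y),
    (forall y z, `|y - x| < r -> `|z - x| < r -> `|F y - F z| <= L * `|y - z|) &
  forall (a b : R) (c : R -> 'rV[R]_n), a <= b ->
    (forall t, a <= t <= b -> hderiv a b c t (F (c t)) /\ `|c t - x| < r / 4) ->
    exists (g : 'rV[R]_n -> R -> 'rV[R]_n) (eta : R), [/\ 0 < eta,
      (forall y, `|y - c a| < eta -> g y a = y /\ forall t, a <= t <= b ->
         hderiv a b (g y) t (F (g y t)) /\ `|g y t - x| < r),
      (forall t, a <= t <= b -> g (c a) t = c t),
      differentiable (g ^~ b) (c a) &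
      forall J : R -> 'rV[R]_n,
        (forall t, a <= t <= b -> hderiv a b J t ('d F (c t) (J t))) ->
        'd (g ^~ b) (c a) (J a) = J b]].
Proof.
move=> oA HF Ax; have [r [L [r0 L0 rA dL lip]]] := local_lipschitz oA HF Ax.
exists r, L; split=> // a b c ab Hc.
have [g [eta [C [eta0 C0 gP]]]] := box_flow r0 L0 ab lip Hc.
have cr t : a <= t <= b -> `|c t - x| < r.
  by move=> /Hc[_ H]; apply: (lt_trans H); lra.
have [||d1 d2] := @flow_diff A F L a b c g eta C ab oA HF L0 eta0 C0.
- move=> t tI; split; [exact/rA/cr | exact: (Hc t tI).1 | ].
  by move=> w; apply: dL; exact: cr.
- by move=> y /gP[ga gD]; split=> // t /gD[].
exists g, eta; split=> //.
- move=> y /gP[ga gD]; split=> // t /gD[? H _]; split=> //.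
  by apply: (lt_trans H); lra.
- move=> t tI; have ca : `|c a - c a| < eta by rewrite subrr normr0.
  have [_ /(_ t tI)[_ _]] := gP _ ca; rewrite subrr normr0 mulr0 normr_le0.
  by rewrite subr_eq0 => /eqP.
Qed.

End FlowDiff.

(** * Lie brackets in charts *)

Section LocalBracket.
Variables (R : realType) (n : nat).
Implicit Types (O : set 'rV[R]_n) (X Y S : 'rV[R]_n -> 'rV[R]_n) (x : 'rV[R]_n).

Definition lbr X Y x : 'rV[R]_n := 'D_(X x) Y x - 'D_(Y x) X x.

Lemma smooth_lbr O X Y : open O -> smooth_on O X -> smooth_on O Y ->
  smooth_on O (lbr X Y).
Proof.
by move=> oO HX HY; apply: smooth_onB => //; exact: smooth_on_derive_dir.
Qed.

Lemma lbr_near X Y Z x : (\forall y \near x, Y y = Z y) -> lbr X Y x = lbr X Z x.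
Proof.
move=> YZ; rewrite /lbr (near_eq_derive _ YZ).
by rewrite (nbhs_singleton YZ).
Qed.

Lemma derive_comb k (V W : normedModType R) (g : 'I_k -> V -> R^o)
    (w : 'I_k -> V -> W) (x v : V) :
  (forall i, differentiable (g i) x) -> (forall i, differentiable (w i) x) ->
  'D_v (fun y => \sum_i (g i y : R) *: w i y) x =
  \sum_i ('D_v (g i) x : R) *: w i x + \sum_i (g i x : R) *: 'D_v (w i) x.
Proof.
move=> dg dw.
have -> : (fun y => \sum_i (g i y : R) *: w i y) =
    \sum_i (fun y => (g i y : R) *: w i y) by apply/funext => y; rewrite fct_sumE.
rewrite derive_sum; last first.
  by move=> i; apply: diff_derivable; have [] := diff_scale (dg i) (dw i).
by rewrite -big_split; apply: eq_bigr => i _; rewrite derive_scale.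
Qed.

Lemma lbr_comb k (g : 'I_k -> 'rV[R]_n -> R^o) (w : 'I_k -> 'rV[R]_n -> 'rV[R]_n) X x :
  differentiable X x ->
  (forall i, differentiable (g i) x) -> (forall i, differentiable (w i) x) ->
  lbr X (fun y => \sum_i (g i y : R) *: w i y) x =
  \sum_i ('D_(X x) (g i) x : R) *: w i x + \sum_i (g i x : R) *: lbr X (w i) x.
Proof.
move=> dX dg dw; rewrite /lbr derive_comb // -addrA; congr (_ + _).
rewrite [X in _ - X](deriveE _ dX) linear_sum -sumrB; apply: eq_bigr => i _.
rewrite scalerBr; congr (_ - _).
by rewrite (deriveE (w i x) dX) linearZ.
Qed.

Lemma diff_compE (U V W : normedModType R) (f : U -> V) (h : V -> W) (x v : U) :
  differentiable f x -> differentiable h (f x) ->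
  'd (h \o f) x v = 'd h (f x) ('d f x v).
Proof. by move=> df dh; rewrite (diff_comp df dh). Qed.

(** Expanding ['d phi y (Y y)] in the basis, the product rule produces mixed second derivatives of
    [phi]. Exchanging them by [schwarz] reassembles them into the derivative of ['D_v phi] along
    [Y x]. *)
Lemma derive_dmap (O : set 'rV[R]_n) (phi : 'rV[R]_n -> 'rV[R]_n) Y x v :
  open O -> smooth_on O phi -> O x -> differentiable Y x ->
  'D_v (fun y => 'd phi y (Y y)) x = 'd phi x ('D_v Y x) + 'D_(Y x) ('D_v phi) x.
Proof.
move=> oO Hphi Ox dY.
have dphi y : O y -> differentiable phi y by exact: smooth_on_diff.
have dD u y : O y -> differentiable ('D_u phi) y.
  by apply: smooth_on_diff; exact: smooth_on_derive.
have dc i : differentiable (fun y => Y y 0 i : R^o) x.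
  have dco := @differentiable_coord R 1 n (Y x) 0 i.
  exact: (differentiable_comp dY dco).
have E : \forall y \near x, 'd phi y (Y y) =
    \sum_j (Y y 0 j : R) *: 'D_(delta_mx 0 j) phi y.
  apply: filterS (open_nbhs_nbhs (conj oO Ox)) => y Oy.
  by rewrite -[LHS](deriveE (Y y) (dphi y Oy)) derive_basis //; exact: dphi.
rewrite (near_eq_derive _ E).
rewrite (@derive_comb n _ _ (fun j y => Y y 0 j : R^o)) //; last first.
  by move=> j; exact: dD.
congr (_ + _).
  rewrite -[RHS](deriveE _ (dphi x Ox)) derive_basis; last exact: dphi.
  apply: eq_bigr => j _; congr (_ *: _).
  by rewrite derive_mx; [rewrite mxE | exact: diff_derivable].
have Sw j : 'D_v ('D_(delta_mx 0 j) phi) x = 'D_(delta_mx 0 j) ('D_v phi) x.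
  by apply: schwarz; [exact: smooth_on_near oO Ox Hphi | exact: dD | exact: dD].
rewrite [RHS](derive_basis (Y x) (dD v x Ox)).
by apply: eq_bigr => j _; rewrite Sw.
Qed.

(** Each half of the bracket picks up the second derivative of [phi] in the directions of the two
    fields; by symmetry these cancel in the difference. *)
Lemma lbr_natural (O : set 'rV[R]_n) (phi : 'rV[R]_n -> 'rV[R]_n)
    (X1 Y1 X2 Y2 : 'rV[R]_n -> 'rV[R]_n) x :
  open O -> smooth_on O phi -> O x ->
  differentiable X1 x -> differentiable Y1 x ->
  differentiable X2 (phi x) -> differentiable Y2 (phi x) ->
  (\forall y \near x, X2 (phi y) = 'd phi y (X1 y)) ->
  (\forall y \near x, Y2 (phi y) = 'd phi y (Y1 y)) ->
  lbr X2 Y2 (phi x) = 'd phi x (lbr X1 Y1 x).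
Proof.
move=> oO Hphi Ox dX1 dY1 dX2 dY2 XE YE.
have dphi : differentiable phi x by exact: smooth_on_diff Hphi Ox.
have key (A1 B1 A2 B2 : 'rV[R]_n -> 'rV[R]_n) : differentiable B1 x ->
    differentiable B2 (phi x) -> A2 (phi x) = 'd phi x (A1 x) ->
    (\forall y \near x, B2 (phi y) = 'd phi y (B1 y)) ->
    'D_(A2 (phi x)) B2 (phi x) =
      'd phi x ('D_(A1 x) B1 x) + 'D_(B1 x) ('D_(A1 x) phi) x.
  move=> dB1 dB2 AE BE; rewrite -(derive_dmap (A1 x) oO Hphi Ox dB1).
  rewrite -(near_eq_derive _ BE) AE deriveE //.
  rewrite (@deriveE _ _ _ (B2 \o phi)); last exact: differentiable_comp.
  exact: esym (diff_compE _ dphi dB2).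
rewrite {1}/lbr (key X1 Y1) //; last exact: nbhs_singleton XE.
rewrite (key Y1 X1) //; last exact: nbhs_singleton YE.
have -> : 'D_(Y1 x) ('D_(X1 x) phi) x = 'D_(X1 x) ('D_(Y1 x) phi) x.
  by apply: schwarz; [exact: smooth_on_near oO Ox Hphi | |];
     apply: (smooth_on_diff _ Ox); exact: smooth_on_derive.
by rewrite opprD addrACA subrr addr0 -linearB.
Qed.

(** [w], [z], [u] stand for a frame and its first and second brackets with [X]; [p], [q], [g] for
    the second derivatives, first derivatives and values of the coefficients of a section. Two
    applications of the Leibniz rule give the middle term twice, hence [q i *+ 2]. *)
Lemma comb_regroup m (w z u : 'I_m -> 'rV[R]_n) (p q g : 'I_m -> R)
    (h k : 'M[R]_m) :
  (forall j, u j = \sum_i h i j *: w i + \sum_i k i j *: z i) ->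
  \sum_i p i *: w i + \sum_i q i *: z i + (\sum_i q i *: z i + \sum_i g i *: u i) =
  \sum_i (p i + \sum_j h i j * g j) *: w i + \sum_i (q i *+ 2 + \sum_j k i j * g j) *: z i.
Proof.
move=> uE.
have -> : \sum_i g i *: u i =
    \sum_i (\sum_j h i j * g j) *: w i + \sum_i (\sum_j k i j * g j) *: z i.
  under eq_bigr do rewrite uE scalerDr !scaler_sumr.
  rewrite big_split /= exchange_big [in X in _ + X]exchange_big /=.
  by congr (_ + _); apply: eq_bigr => i _; rewrite scaler_suml;
     apply: eq_bigr => j _; rewrite scalerA mulrC.
under [in RHS]eq_bigr do rewrite scalerDl.
under [X in _ = _ + X]eq_bigr do rewrite scalerDl mulr2n scalerDl.
rewrite !big_split /=.
by rewrite [LHS](AC (2*(1*2)) ((1*4)*((2*3)*5))).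
Qed.

Section NormalSection.
Variables (m : nat) (O : set 'rV[R]_n) (X S : 'rV[R]_n -> 'rV[R]_n).
Variables (W : 'I_m -> 'rV[R]_n -> 'rV[R]_n) (H0 H1 : 'rV[R]_n -> 'M[R]_m).
Variable (g : 'I_m -> 'rV[R]_n -> R^o).
Hypothesis oO : open O.
Hypothesis HX : smooth_on O X.
Hypothesis HS : smooth_on O S.
Hypothesis HW : forall i, smooth_on O (W i).
Hypothesis W1free : forall x, O x -> forall a : 'I_m -> R,
  \sum_i a i *: W i x = 0 -> forall i, a i = 0.
Hypothesis Wfree : forall x, O x -> forall a b : 'I_m -> R,
  \sum_i a i *: W i x + \sum_i b i *: lbr X (W i) x = 0 ->
  (forall i, a i = 0) /\ (forall i, b i = 0).
Hypothesis WE : forall x, O x -> forall j, lbr X (lbr X (W j)) x =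
  \sum_i H0 x i j *: W i x + \sum_i H1 x i j *: lbr X (W i) x.
Hypothesis SE : forall x, O x -> S x = \sum_i (g i x : R) *: W i x.

Lemma smooth_section_coef i : smooth_on O (g i).
Proof. exact: (smooth_on_coef oO HW HS SE W1free). Qed.

(** The structure functions are given only through [WE]. As the frame and its brackets form a free
    family of [m + m] vectors, they are coefficients to which [smooth_on_coef] applies. Smoothness
    matters because the curvature differentiates [H1]. *)
Lemma smooth_structure_coef i j : smooth_on O (fun x => H1 x i j : R^o).
Proof.
pose fam (l : 'I_(m + m)) : 'rV[R]_n -> 'rV[R]_n :=
  match fintype.split l with inl a => W a | inr b => lbr X (W b) end.
pose co (l : 'I_(m + m)) x : R^o :=
  match fintype.split l with inl a => H0 x a j | inr b => H1 x b j end.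
have fl a : fam (lshift m a) = W a by rewrite /fam (unsplitK (inl a)).
have fr a : fam (rshift m a) = lbr X (W a) by rewrite /fam (unsplitK (inr a)).
have cl a x : co (lshift m a) x = H0 x a j by rewrite /co (unsplitK (inl a)).
have cr a x : co (rshift m a) x = H1 x a j by rewrite /co (unsplitK (inr a)).
have -> : (fun x => H1 x i j : R^o) = co (rshift m i).
  by apply/funext => x; rewrite cr.
have Hl (a : 'I_m) : smooth_on O (lbr X (W a)) by exact: smooth_lbr.
apply: (@smooth_on_coef R n (m + m) O fam co (lbr X (lbr X (W j)))) => //.
- by move=> l; rewrite /fam; case: (fintype.split l).
- exact: smooth_lbr.
- move=> x Ox; rewrite WE // big_split_ord; congr (_ + _); apply: eq_bigr => a _.
    by rewrite fl cl.
  by rewrite fr cr.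
- move=> x Ox c; rewrite big_split_ord /= => E l.
  have [|A B] := @Wfree x Ox (fun a => c (lshift m a)) (fun a => c (rshift m a)).
    by rewrite -[RHS]E; congr (_ + _); apply: eq_bigr => a _; rewrite ?fl ?fr.
  by rewrite -(splitK l); case: (fintype.split l) => a /=.
Qed.

Lemma lbr_section x : O x -> lbr X S x =
  \sum_i ('D_(X x) (g i) x : R) *: W i x + \sum_i (g i x : R) *: lbr X (W i) x.
Proof.
move=> Ox; rewrite -lbr_comb; first last.
- by move=> i; exact: smooth_on_diff (HW i) Ox.
- by move=> i; exact: smooth_on_diff (smooth_section_coef i) Ox.
- exact: smooth_on_diff HX Ox.
by apply: lbr_near; apply: filterS (open_nbhs_nbhs (conj oO Ox)).
Qed.

Lemma lbr2_section x : O x -> lbr X (lbr X S) x =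
  \sum_i ('D_(X x) (fun y => 'D_(X y) (g i) y) x + \sum_j H0 x i j * g j x) *: W i x
  + \sum_i ('D_(X x) (g i) x *+ 2 + \sum_j H1 x i j * g j x) *: lbr X (W i) x.
Proof.
move=> Ox.
have dg i : smooth_on O (fun y => 'D_(X y) (g i) y).
  by apply: smooth_on_derive_dir => //; exact: smooth_section_coef.
have HL i : smooth_on O (lbr X (W i)) by exact: smooth_lbr.
pose P y := \sum_i ('D_(X y) (g i) y : R) *: W i y.
pose Q y := \sum_i (g i y : R) *: lbr X (W i) y.
have sP : smooth_on O P.
  by apply: smooth_on_sum => // i; exact: smooth_on_scale.
have sQ : smooth_on O Q.
  by apply: smooth_on_sum => // i; apply: smooth_on_scale => //; exact: smooth_section_coef.
have dX := smooth_on_diff HX Ox.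
have -> : lbr X (lbr X S) x = lbr X P x + lbr X Q x.
  rewrite (@lbr_near X _ (fun y => P y + Q y)); last first.
    by apply: filterS (open_nbhs_nbhs (conj oO Ox)) => y Oy; exact: lbr_section.
  have dP := smooth_on_diff sP Ox; have dQ := smooth_on_diff sQ Ox.
  rewrite /lbr (@deriveD _ _ _ P Q); try exact: diff_derivable.
  rewrite (deriveE (P x + Q x) dX) linearD opprD addrACA.
  by rewrite (deriveE (P x) dX) (deriveE (Q x) dX).
have HP : lbr X P x = \sum_i ('D_(X x) (fun y => 'D_(X y) (g i) y) x : R) *: W i x
    + \sum_i ('D_(X x) (g i) x : R) *: lbr X (W i) x.
  apply: (@lbr_comb m (fun i y => 'D_(X y) (g i) y)) => // i.
    exact: smooth_on_diff (dg i) Ox.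
  exact: smooth_on_diff (HW i) Ox.
have HQ : lbr X Q x = \sum_i ('D_(X x) (g i) x : R) *: lbr X (W i) x
    + \sum_i (g i x : R) *: lbr X (lbr X (W i)) x.
  apply: (@lbr_comb m g) => // i.
    exact: smooth_on_diff (smooth_section_coef i) Ox.
  exact: smooth_on_diff (HL i) Ox.
rewrite HP HQ; apply: comb_regroup => i; exact: WE.
Qed.

(** Origin of the curvature formula. Normality kills the coefficients of the brackets [[X, W i]],
    which reads [2 X(g) + H1 g = 0]. Substituting [X(g) = - H1 g / 2] twice into the remaining part
    [X(X(g)) + H0 g] leaves [(H0 - X(H1) / 2 + H1^2 / 4) g], that is [- K g]. *)
Lemma normal_section_coef x : O x ->
  (forall y, O y -> exists c : 'I_m -> R, lbr X (lbr X S) y = \sum_i c i *: W i y) ->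
  (forall i, 'D_(X x) (g i) x = - 2^-1 * \sum_j H1 x i j * g j x) /\
  lbr X (lbr X S) x =
    - \sum_i (\sum_j ((- H0 x + 2^-1 *: (\matrix_(i, j) 'D_(X x) (fun y => H1 y i j : R^o) x)
       - 4^-1 *: (H1 x *m H1 x)) i j) * g j x) *: W i x.
Proof.
move=> Ox normal.
(* Needed on all of [O] and not only at [x], because the identity is differentiated once more
   below. *)
have E1 y : O y -> forall i, 'D_(X y) (g i) y = - 2^-1 * \sum_j H1 y i j * g j y.
  move=> Oy i; have [c cE] := normal y Oy.
  have [|_ /(_ i)] := @Wfree y Oy
    (fun i => 'D_(X y) (fun z => 'D_(X z) (g i) z) y + \sum_j H0 y i j * g j y - c i)
    (fun i => 'D_(X y) (g i) y *+ 2 + \sum_j H1 y i j * g j y).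
    under eq_bigr do rewrite scalerBl.
    by rewrite sumrB addrAC -lbr2_section // cE subrr.
  rewrite mulr2n => H; set s := \sum_j _ in H *; move: H; set d := 'D_(X y) (g i) y.
  by move=> H; have H' : (d : R) + d + s = 0 by []; move: H'; move: (d : R) => d' *; lra.
split; first exact: E1.
rewrite lbr2_section // [X in _ + X]big1 ?addr0; last first.
  move=> i _; rewrite E1 // [X in X *: _](_ : _ = 0) ?scale0r //.
  by move: (\sum_j _) => s; rewrite mulr2n; lra.
rewrite -sumrN; apply: eq_bigr => i _; rewrite -scaleNr; congr (_ *: _).
have dg j : differentiable (g j) x by exact: smooth_on_diff (smooth_section_coef j) Ox.
have dH j : differentiable (fun y => H1 y i j : R^o) x.
  exact: smooth_on_diff (smooth_structure_coef i j) Ox.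
have -> : 'D_(X x) (fun y => 'D_(X y) (g i) y) x = - 2^-1 *
    (\sum_j 'D_(X x) (fun y => H1 y i j : R^o) x * g j x +
     \sum_j H1 x i j * 'D_(X x) (g j) x).
  pose f (y : 'rV[R]_n) : R^o := \sum_j (H1 y i j : R) *: (g j y : R^o).
  rewrite (@near_eq_derive _ _ _ _ ((- 2^-1 : R) \*: f)); last first.
    by apply: filterS (open_nbhs_nbhs (conj oO Ox)) => y Oy; exact: E1.
  have sf : smooth_on O f.
    apply: smooth_on_sum => // j; apply: (smooth_on_scale oO).
      exact: smooth_structure_coef.
    exact: smooth_section_coef.
  rewrite deriveZ; last exact: diff_derivable (smooth_on_diff sf Ox).
  by rewrite (@derive_comb m _ R^o (fun j y => H1 y i j) g).
under [X in _ * (_ + X)]eq_bigr do rewrite E1 // mulrCA.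
rewrite -mulr_sumr.
under [X in _ = - X]eq_bigr do rewrite !mxE !mulrDl mulNr.
rewrite !big_split /=.
have -> : \sum_j H1 x i j * (\sum_l H1 x j l * g l x) =
    \sum_j (\sum_l H1 x i l * H1 x l j) * g j x.
  under eq_bigr do rewrite mulr_sumr.
  under [RHS]eq_bigr do rewrite mulr_suml.
  rewrite exchange_big; apply: eq_bigr => j _; apply: eq_bigr => l _.
  by rewrite mulrA.
under [X in _ = - (_ + X + _)]eq_bigr do rewrite -mulrA.
under [X in _ = - (_ + X)]eq_bigr do rewrite mulNr -mulrA.
rewrite !sumrN -!mulr_sumr.
set a := \sum_j _; set b := \sum_j _; set d := \sum_j _.
have gen (a' b' d' : R) : - 2^-1 * (a' + - 2^-1 * b') + d' = - (- d' + 2^-1 * a' - 4^-1 * b').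
  by field.
exact: gen.
Qed.

End NormalSection.

(** Along [c] the derivative of [S] is [[X, S] + DX(S)], and likewise for [[X, S]]. In the
    derivative of the combination the terms [al [X, S]] and [- al [X, S]] cancel, as do [lam be S]
    and [be [X, [X, S]]]; what remains is [DX] applied to the combination. *)
Lemma jacobi_local O X S (a b t lam : R) (c : R -> 'rV[R]_n) (al be : R -> R^o) :
  open O -> smooth_on O X -> smooth_on O S -> O (c t) ->
  hderiv a b c t (X (c t)) -> hderiv a b al t (lam * be t : R^o) ->
  hderiv a b be t (- al t) -> lbr X (lbr X S) (c t) = - (lam *: S (c t)) ->
  hderiv a b (fun s => (al s : R) *: S (c s) + (be s : R) *: lbr X S (c s)) t
    ('d X (c t) ((al t : R) *: S (c t) + (be t : R) *: lbr X S (c t))).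
Proof.
move=> oO HX HS Oc Hc Ha Hb E.
have dX := smooth_on_diff HX Oc; have dS := smooth_on_diff HS Oc.
have dZ := smooth_on_diff (smooth_lbr oO HX HS) Oc.
have H := hderivD (hderiv_scale Ha (hderiv_comp Hc dS))
                  (hderiv_scale Hb (hderiv_comp Hc dZ)).
have ES : 'd S (c t) (X (c t)) = lbr X S (c t) + 'd X (c t) (S (c t)).
  by rewrite /lbr (deriveE _ dS) (deriveE _ dX) subrK.
have EZ : 'd (lbr X S) (c t) (X (c t)) = - (lam *: S (c t)) + 'd X (c t) (lbr X S (c t)).
  by rewrite -E {2}/lbr (deriveE _ dZ) (deriveE _ dX) subrK.
have EJ : 'd X (c t) ((al t : R) *: S (c t) + (be t : R) *: lbr X S (c t)) =
    (al t : R) *: 'd X (c t) (S (c t)) + (be t : R) *: 'd X (c t) (lbr X S (c t)).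
  by rewrite linearD; congr (_ + _); exact: linearZ.
have gen (u v p q w s z : 'rV[R]_n) (k l : R) : u = z + p -> v = - (lam *: s) + q ->
    w = k *: p + l *: q ->
    (lam * l) *: s + k *: u + ((- k) *: z + l *: v) = w.
  move=> -> -> ->; rewrite !scalerDr scaleNr scalerN scalerA (mulrC l).
  rewrite [LHS](AC ((1*2)*(1*2)) (((1*5)*(2*4))*(3*6))).
  by rewrite /= !subrr !add0r.
exact: eq_ind _ (hderiv a b _ t) H _ (gen _ _ _ _ _ _ _ _ _ ES EZ EJ).
Qed.

End LocalBracket.

(** * Fields and integral curves on a manifold *)

Section Charts.
Variables (R : realType) (n : nat) (M : manifold R n).
Implicit Types (p q r : M) (U : set M) (Y Z : M -> 'rV[R]_n).

Definition img p U : set 'rV[R]_n := chart p @` (dom p `&` U).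

Lemma img_chart p U q : dom p q -> U q -> img p U (chart p q).
Proof. by move=> pq Uq; exists q. Qed.

Lemma imgV p U u : img p U u ->
  [/\ dom p (chartV p u), U (chartV p u) & chart p (chartV p u) = u].
Proof. by move=> [q [pq Uq] <-]; rewrite chartK. Qed.

Lemma img_dom p U u : img p U u -> (chart p @` dom p) u.
Proof. by move=> [q [pq _] <-]; exists q. Qed.

Lemma near_chartV p q (P : M -> Prop) : dom p q ->
  (\forall r \near q, P r) -> \forall u \near chart p q, P (chartV p u).
Proof.
move=> pq Pq.
have H : {for chart p q, continuous (chartV p)}.
  by apply: chartV_continuous; exists q.
by apply: H; rewrite /= chartK.
Qed.

Lemma near_chart p q (P : 'rV[R]_n -> Prop) : dom p q ->
  (\forall u \near chart p q, P u) -> \forall r \near q, P (chart p r).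
Proof. by move=> pq Pq; apply: (chart_continuous pq). Qed.

Lemma near_dom p q : dom p q -> \forall r \near q, dom p r.
Proof. by move=> pq; apply: open_nbhs_nbhs; split=> //; exact: dom_open. Qed.

Lemma img_open p U : open U -> open (img p U).
Proof.
move=> oU; rewrite openE => _ [q [pq Uq] <-].
have H1 : \forall u \near chart p q, (chart p @` dom p) u.
  by apply: open_nbhs_nbhs; split; [exact: chart_open | exists q].
have H2 : \forall u \near chart p q, U (chartV p u).
  by apply: near_chartV => //; exact: open_nbhs_nbhs.
apply: filterS2 H1 H2 => u [q' pq' <-]; rewrite chartK // => Uq'.
by exists q'.
Qed.

Lemma trans_smooth p q : smooth_on (img p (dom q)) (chart q \o chartV p).
Proof. exact: chart_compat. Qed.

Lemma trans_diff p q r : dom p r -> dom q r ->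
  differentiable (chart q \o chartV p) (chart p r).
Proof. by move=> pr qr; exact: smooth_on_diff (@trans_smooth p q) (img_chart pr qr). Qed.

(** Chain rule: the composite of two transition maps agrees with the direct one near the point,
    which is all that the differential sees. *)
Lemma trans_cocycle p q s r v : dom p r -> dom q r -> dom s r ->
  'd (chart s \o chartV p) (chart p r) v =
  'd (chart s \o chartV q) (chart q r) ('d (chart q \o chartV p) (chart p r) v).
Proof.
move=> pr qr sr.
have d1 := trans_diff pr qr.
have d2 : differentiable (chart s \o chartV q) ((chart q \o chartV p) (chart p r)).
  by rewrite /= chartK //; exact: trans_diff.
have d3 := differentiable_comp d1 d2.
have E : {near chart p r, (chart s \o chartV q) \o (chart q \o chartV p) =1
    chart s \o chartV p}.
  have : \forall u \near chart p r, dom q (chartV p u).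
    by apply: near_chartV => //; exact: near_dom.
  by apply: filterS => u qu; rewrite /= chartK.
have [_ E2] := differentiable_near E d3.
apply: (etrans (congr1 (@^~ v) E2)); apply: (etrans (diff_compE v d1 d2)).
have e : (chart q \o chartV p) (chart p r) = chart q r by rewrite /= chartK.
by rewrite e.
Qed.

Lemma trans_id p r v : dom p r -> 'd (chart p \o chartV p) (chart p r) v = v.
Proof.
move=> pr.
have E : {near chart p r, id =1 chart p \o chartV p}.
  have H1 : \forall u \near chart p r, (chart p @` dom p) u.
    by apply: open_nbhs_nbhs; split; [exact: chart_open | exists r].
  by apply: filterS H1 => _ [q pq <-] /=; rewrite chartK.
have did : differentiable (id : 'rV[R]_n -> 'rV[R]_n) (chart p r) by [].
have [_ E2] := differentiable_near E did.
apply: (etrans (congr1 (@^~ v) E2)).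
by rewrite diff_val.
Qed.

Lemma in_chart_trans p q r v : dom p r -> dom q r ->
  in_chart p r v = 'd (chart p \o chartV q) (chart q r) (in_chart q r v).
Proof. by move=> pr qr; apply: trans_cocycle => //; exact: dom_center. Qed.

Lemma in_chart_id p v : in_chart p p v = v.
Proof. by apply: trans_id; exact: dom_center. Qed.

Lemma in_chartK p r v : dom p r ->
  'd (chart r \o chartV p) (chart p r) (in_chart p r v) = v.
Proof. by move=> pr; rewrite -in_chart_trans ?in_chart_id //; exact: dom_center. Qed.

Lemma in_chart0 p r : in_chart p r 0 = 0.
Proof. exact: linear0. Qed.

Lemma in_chartD p r v w : in_chart p r (v + w) = in_chart p r v + in_chart p r w.
Proof. exact: linearD. Qed.

Lemma in_chartZ p r k v : in_chart p r (k *: v) = k *: in_chart p r v.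
Proof. exact: linearZ. Qed.

Lemma in_chartN p r v : in_chart p r (- v) = - in_chart p r v.
Proof. by rewrite -scaleN1r in_chartZ scaleN1r. Qed.

Lemma in_chart_sum p r (I : Type) (s : seq I) (f : I -> 'rV[R]_n) :
  in_chart p r (\sum_(i <- s) f i) = \sum_(i <- s) in_chart p r (f i).
Proof. by elim/big_rec2: _ => [|i x y _ <-]; [exact: in_chart0 | rewrite in_chartD]. Qed.

Lemma in_chart_inj p r v w : dom p r -> in_chart p r v = in_chart p r w -> v = w.
Proof. by move=> pr E; rewrite -(in_chartK v pr) E in_chartK. Qed.

Lemma local_repE Y p r : dom p r -> local_rep Y p (chart p r) = in_chart p r (Y r).
Proof. by move=> pr; rewrite /local_rep chartK. Qed.

Lemma local_rep_center Y p : local_rep Y p (chart p p) = Y p.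
Proof. by rewrite local_repE ?in_chart_id //; exact: dom_center. Qed.

Lemma local_rep_trans Y p q r : dom p r -> dom q r ->
  local_rep Y p (chart p r) =
  'd (chart p \o chartV q) (chart q r) (local_rep Y q (chart q r)).
Proof. by move=> pr qr; rewrite !local_repE //; exact: in_chart_trans. Qed.

Lemma bracketE Y Z p :
  bracket Y Z p = lbr (local_rep Y p) (local_rep Z p) (chart p p).
Proof. by rewrite /lbr !local_rep_center. Qed.

Lemma smooth_field_diff U Y p q : smooth_field U Y -> dom p q -> U q ->
  differentiable (local_rep Y p) (chart p q).
Proof. by move=> HY pq Uq; exact: smooth_on_diff (HY p) (img_chart pq Uq). Qed.

(** [bracket] uses at each point the chart centred there, so the chart changes with the point.
    Naturality under transition maps replaces these by one fixed chart, in which a bracket can be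
    differentiated again. *)
Lemma bracket_chart U Y Z p q : smooth_field U Y -> smooth_field U Z ->
  dom p q -> U q ->
  in_chart p q (bracket Y Z q) = lbr (local_rep Y p) (local_rep Z p) (chart p q).
Proof.
move=> HY HZ pq Uq; have qq := dom_center q.
have E : (chart p \o chartV q) (chart q q) = chart p q by rewrite /= chartK.
have NE A : \forall u \near chart q q, local_rep A p ((chart p \o chartV q) u) =
    'd (chart p \o chartV q) u (local_rep A q u).
  have H : open_nbhs (chart q q) (img q (dom p)).
    by split; [apply: img_open; exact: dom_open | exact: img_chart].
  apply: filterS (open_nbhs_nbhs H) => _ [r [qr pr] <-].
  by rewrite /= chartK //; exact: local_rep_trans.
have := @lbr_natural R n (img q (dom p)) (chart p \o chartV q) (local_rep Y q)
  (local_rep Z q) (local_rep Y p) (local_rep Z p) (chart q q).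
rewrite E => ->; rewrite -?bracketE //.
- by apply: img_open; exact: dom_open.
- exact: trans_smooth.
- exact: img_chart.
- exact: smooth_field_diff HY qq Uq.
- exact: smooth_field_diff HZ qq Uq.
- exact: smooth_field_diff HY pq Uq.
- exact: smooth_field_diff HZ pq Uq.
Qed.

Lemma bracket_local U Y Z p u : smooth_field U Y -> smooth_field U Z ->
  img p U u -> local_rep (bracket Y Z) p u = lbr (local_rep Y p) (local_rep Z p) u.
Proof.
move=> HY HZ [q [pq Uq] <-].
by rewrite local_repE //; exact: bracket_chart HY HZ pq Uq.
Qed.

Lemma smooth_field_bracket U Y Z : open U -> smooth_field U Y -> smooth_field U Z ->
  smooth_field U (bracket Y Z).
Proof.
move=> oU HY HZ p; have oI := @img_open p _ oU.
apply: (smooth_on_eq oI _ (smooth_lbr oI (HY p) (HZ p))) => u iu.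
exact/esym/(bracket_local HY HZ).
Qed.

Lemma smooth_field_subset U U' Y : U `<=` U' -> smooth_field U' Y -> smooth_field U Y.
Proof.
move=> UU HY p; apply: smooth_on_subset (HY p) => _ [q [pq Uq] <-].
by exists q => //; split=> //; exact: UU.
Qed.

Lemma bracket2_local U Y Z p u : open U -> smooth_field U Y -> smooth_field U Z ->
  img p U u -> local_rep (bracket Y (bracket Y Z)) p u =
    lbr (local_rep Y p) (lbr (local_rep Y p) (local_rep Z p)) u.
Proof.
move=> oU HY HZ iu.
rewrite (bracket_local HY (smooth_field_bracket oU HY HZ) iu).
apply: lbr_near; apply: filterS (open_nbhs_nbhs (conj (@img_open p _ oU) iu)) => w.
exact: bracket_local.
Qed.

End Charts.

(** * Integral curves: change of chart, concatenation, uniqueness *)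

Section Curves.
Variables (R : realType) (n : nat) (M : manifold R n).
Variable X : M -> 'rV[R]_n.
Hypothesis HX : smooth_field setT X.
Implicit Types (p q : M) (c : R -> M).

(* [integral_curve] on an arbitrary interval. *)
Definition icurve (a b : R) c : Prop := forall t, a <= t <= b ->
  (forall P : M -> Prop, (\forall q \near c t, P q) ->
     exists2 d : R, 0 < d & forall s, a <= s <= b -> `|s - t| < d -> P (c s)) /\
  hderiv a b (chart (c t) \o c) t (X (c t)).

Lemma icurveP T c : integral_curve X T c <-> icurve 0 T c.
Proof.
split=> [[cc cD] t tI|H].
  split; last by apply/has_derivP => //; exact: cD.
  move=> P Pc; move/subspace_continuousP : cc => /(_ t).
  rewrite /= in_itv /= => /(_ tI P Pc).
  move=> /nbhs_ballP[d /= d0 dP].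
  exists d => // s sI sd; apply: (dP s); first by rewrite /ball /= distrC.
  by rewrite /= in_itv.
split; last by move=> t tI; apply/has_derivP => //; exact: (H t tI).2.
apply/subspace_continuousP => t; rewrite /= in_itv /= => tI P Pc.
have [d d0 dP] := (H t tI).1 P Pc.
apply/nbhs_ballP; exists d => //= s.
rewrite /ball /= distrC in_itv /= => sd sI; exact: dP.
Qed.

Lemma icurve_near a b c t (P : M -> Prop) : icurve a b c -> a <= t <= b ->
  (\forall q \near c t, P q) ->
  exists2 d : R, 0 < d & forall s, a <= s <= b -> `|s - t| < d -> P (c s).
Proof. by move=> H tI; exact: (H t tI).1. Qed.

Lemma icurve_hderiv a b c t p : icurve a b c -> a <= t <= b -> dom p (c t) ->
  hderiv a b (chart p \o c) t (local_rep X p (chart p (c t))).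
Proof.
move=> H tI pc; have [Hn Hd] := H t tI.
have cc := dom_center (c t).
have dT := trans_diff cc pc.
have := hderiv_comp Hd dT; rewrite local_repE //.
apply: hderiv_eq; first by rewrite /= chartK.
have [d d0 dP] := Hn _ (near_dom cc).
by exists d => // s sI sd /=; rewrite chartK //; exact: dP.
Qed.

Lemma icurve_sub a b a' b' c : a <= a' -> b' <= b -> icurve a b c -> icurve a' b' c.
Proof.
move=> aa bb H t /andP[t1 t2].
have sub s : a' <= s <= b' -> a <= s <= b.
  by move=> /andP[s1 s2]; rewrite (le_trans aa) // (le_trans s2).
have [|Hn Hd] := H t; first by rewrite sub // t1.
split; last exact: hderiv_sub Hd.
move=> P /Hn[d d0 dP]; exists d => // s sI; apply: dP; exact: sub.
Qed.

Lemma chartV_icurve p (y : R -> 'rV[R]_n) a b :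
  (forall t, a <= t <= b -> hderiv a b y t (local_rep X p (y t)) /\
     (chart p @` dom p) (y t)) -> icurve a b (chartV p \o y).
Proof.
move=> H t tI; have [Hd [q pq qy]] := H t tI.
have Vq : chartV p (y t) = q by rewrite -qy chartK.
split.
  move=> P /= Pc; rewrite Vq in Pc.
  have := near_chartV pq Pc; rewrite qy => /near_normP[e e0 eP].
  have [d d0 dP] := hderiv_cont Hd e0.
  by exists d => // s sI sd; exact/eP/dP.
have dT : differentiable (chart q \o chartV p) (y t).
  by rewrite -qy; apply: trans_diff => //; exact: dom_center.
rewrite /= Vq; have := hderiv_comp Hd dT.
have -> : 'd (chart q \o chartV p) (y t) (local_rep X p (y t)) = X q.
  by rewrite -qy local_repE // in_chartK.
exact.
Qed.

Lemma icurve_cat a b d c1 c2 : a <= b -> b <= d -> icurve a b c1 -> icurve b d c2 ->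
  c1 b = c2 b -> icurve a d (fun s => if s <= b then c1 s else c2 s).
Proof.
move=> ab bd H1 H2 E; pose c s := if s <= b then c1 s else c2 s.
rewrite -[X in icurve _ _ X]/c => t /andP[at_ td].
have cL s : s <= b -> c s = c1 s by rewrite /c => ->.
have cR s : b <= s -> c s = c2 s.
  rewrite /c; case: (leP s b) => // sb bs.
  by have -> : s = b by apply/eqP; rewrite eq_le sb.
have [tb|bt] := ltP t b.
  have [|Hn Hd] := H1 t; first by rewrite at_ ltW.
  have bt0 : 0 < b - t by rewrite subr_gt0.
  have lt_b s : `|s - t| < b - t -> s <= b.
    by rewrite ltr_norml => /andP[_ ?]; apply: ltW; lra.
  have ct : c t = c1 t by apply: cL; exact: ltW.
  rewrite ct; split.
    move=> P /Hn[e e0 eP]; exists (Num.min e (b - t)); first by rewrite lt_min e0.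
    move=> s /andP[as_ sd]; rewrite lt_min => /andP[se /lt_b sb].
    by rewrite cL //; apply: eP => //; rewrite as_.
  move=> e e0; have [r r0 rP] := Hd e e0.
  exists (Num.min r (b - t)); first by rewrite lt_min r0.
  move=> s /andP[as_ sd]; rewrite lt_min => /andP[sr /lt_b sb] /=.
  by rewrite cL // ct; apply: rP => //; rewrite as_.
have ct : c t = c2 t by exact: cR.
rewrite ct; have [|Hn2 Hd2] := H2 t; first by rewrite bt.
have [bt'|tb] := ltP b t.
  have bt0 : 0 < t - b by rewrite subr_gt0.
  have gt_b s : `|s - t| < t - b -> b <= s.
    by rewrite ltr_norml => /andP[? _]; apply: ltW; lra.
  split.
    move=> P /Hn2[e e0 eP]; exists (Num.min e (t - b)); first by rewrite lt_min e0.
    move=> s /andP[as_ sd]; rewrite lt_min => /andP[se /gt_b sb].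
    by rewrite cR //; apply: eP => //; rewrite sb.
  move=> e e0; have [r r0 rP] := Hd2 e e0.
  exists (Num.min r (t - b)); first by rewrite lt_min r0.
  move=> s /andP[as_ sd]; rewrite lt_min => /andP[sr /gt_b sb] /=.
  by rewrite cR // ct; apply: rP => //; rewrite sb.
have tE : t = b by apply/eqP; rewrite eq_le tb.
subst t; have [|Hn1 Hd1] := H1 b; first by rewrite ab lexx.
rewrite E in Hn1 Hd1; split.
  move=> P HP; have [e1 e10 P1] := Hn1 _ HP; have [e2 e20 P2] := Hn2 _ HP.
  exists (Num.min e1 e2); first by rewrite lt_min e10.
  move=> s /andP[as_ sd]; rewrite lt_min => /andP[se1 se2].
  have [sb|/ltW bs] := leP s b; first by rewrite cL //; apply: P1; rewrite ?as_.
  by rewrite cR //; apply: P2; rewrite ?bs.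
move=> e e0; have [r1 r10 P1] := Hd1 e e0; have [r2 r20 P2] := Hd2 e e0.
exists (Num.min r1 r2); first by rewrite lt_min r10.
move=> s /andP[as_ sd]; rewrite lt_min => /andP[sr1 sr2] /=; rewrite ct.
have [sb|/ltW bs] := leP s b.
  by rewrite cL // -E; have := P1 s; rewrite /= -E; apply; rewrite ?as_.
by rewrite cR //; apply: P2; rewrite ?bs.
Qed.

(** If the curves differ at [t0], Hausdorff separation makes them differ at every nearby [s1],
    against the induction hypothesis. If they agree at [t0], both stay in a chart ball where the
    field is Lipschitz, and Gronwall forces equality a little beyond. *)
Lemma icurve_unique a b c1 c2 : a <= b -> icurve a b c1 -> icurve a b c2 ->
  c1 a = c2 a -> forall t, a <= t <= b -> c1 t = c2 t.
Proof.
move=> ab H1 H2 E.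
apply: (@real_induction R a b (fun s => forall t, a <= t <= s -> c1 t = c2 t) ab).
  by move=> t /le_anti <-.
move=> t0 t0I; have [E0|NE0] := pselect (c1 t0 = c2 t0); last first.
  have [[A B] /= [Ac Bc] [oA oB AB]] :
      exists2 AB : set M * set M, (c1 t0 \in AB.1) /\ (c2 t0 \in AB.2) &
        [/\ open AB.1, open AB.2 & AB.1 `&` AB.2 = set0].
    have H := @manifold_hausdorff R n M; rewrite open_hausdorff in H.
    have [|AB [? ?] [? ? /eqP ?]] := H (c1 t0) (c2 t0); first exact/eqP.
    by exists AB.
  have [d1 d10 P1] := icurve_near H1 t0I
    (open_nbhs_nbhs (conj oA (set_mem Ac : A (c1 t0)))).
  have [d2 d20 P2] := icurve_near H2 t0I
    (open_nbhs_nbhs (conj oB (set_mem Bc : B (c2 t0)))).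
  exists (Num.min d1 d2); first by rewrite lt_min d10.
  move=> s1 s2 /andP[as1 s1t] /andP[ts2 s2b]; rewrite lt_min => /andP[sd1 sd2] _ Ps1.
  have n1 : `|s1 - t0| = t0 - s1 by rewrite distrC ger0_norm ?subr_ge0.
  have s1I : a <= s1 <= b by rewrite as1 (le_trans s1t) // (le_trans ts2).
  have A1 := P1 s1 s1I; rewrite n1 in A1; have {}A1 := A1 sd1.
  have A2 := P2 s1 s1I; rewrite n1 in A2; have {}A2 := A2 sd2.
  exfalso; have : (A `&` B) (c1 s1).
    by split=> //; rewrite Ps1 // as1 lexx.
  by rewrite AB.
pose p := c1 t0; have pp := dom_center p.
have oT : open (img p setT) by apply: img_open; exact: openT.
have [r [L [r0 L0 rA _ lip]]] := local_lipschitz oT (@HX p) (img_chart pp I).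
have nP q : q = p -> \forall q' \near q, dom p q' /\ `|chart p q' - chart p p| < r.
  move=> ->; apply: filterI; first exact: near_dom.
  apply: (near_chart (P := fun u => `|u - chart p p| < r) pp).
  by apply/near_normP; exists r.
have [d1 d10 P1] := icurve_near H1 t0I (nP _ erefl).
have [d2 d20 P2] := icurve_near H2 t0I (nP _ (esym E0)).
exists (Num.min d1 d2); first by rewrite lt_min d10.
move=> s1 s2 /andP[as1 s1t] /andP[ts2 s2b]; rewrite !lt_min.
move=> /andP[sd1 sd2] /andP[sd3 sd4] Ps1 t /andP[at_ ts].
have [ts1|s1t'] := leP t s1; first by apply: Ps1; rewrite at_.
have nt s : s1 <= s <= s2 -> a <= s <= b /\ `|s - t0| < d1 /\ `|s - t0| < d2.
  by move=> /andP[? ?]; rewrite !ltr_norml; do !split; lra.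
have K s : s1 <= s <= s2 -> [/\ dom p (c1 s), dom p (c2 s),
    `|chart p (c1 s) - chart p p| < r & `|chart p (c2 s) - chart p p| < r].
  by move=> /nt[sI [sa sb]]; have [? ?] := P1 s sI sa; have [? ?] := P2 s sI sb.
have s12 : s1 <= s2 by lra.
have tI : s1 <= t <= s2 by lra.
have [k1 k2 _ _] := K t tI.
suff : chart p (c1 t) = chart p (c2 t).
  by move=> /(congr1 (chartV p)); rewrite !chartK.
apply/eqP; rewrite -subr_eq0 -normr_le0.
have := @gronwall R _ s1 s2 (fun s => (chart p \o c1) s - (chart p \o c2) s)
  (fun s => local_rep X p (chart p (c1 s)) - local_rep X p (chart p (c2 s)))
  L 0 L0 (lexx _).
move=> /(_ _ _ t tI).
rewrite /= (Ps1 s1) ?as1 ?lexx // subrr normr0 mul0r addr0 mulr0 mul0r; apply.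
  move=> s sI; have [sab _] := nt s sI; have [? ? _ _] := K s sI.
  have a1 : a <= s1 by []. 
  by apply: hderivB; apply: (hderiv_sub as1 s2b); exact: icurve_hderiv.
move=> s sI; rewrite addr0; have [_ _ ? ?] := K s sI; exact: lip.
Qed.

(** One integral curve rules out the default value of [flow], and uniqueness makes the chosen
    endpoint independent of the choice. *)
Lemma flowE t p g : 0 <= t -> icurve 0 t g -> g 0 = p -> flow X t p = g t.
Proof.
move=> t0 Hg gp; rewrite /flow; apply: xget_unique.
  by exists g; split=> //; exact/icurveP.
move=> q [g' [/icurveP Hg' g'p <-]].
by apply: (icurve_unique t0) => //; rewrite ?g'p ?gp // t0 lexx.
Qed.

End Curves.

(** * The differential of the flow along the curve *)

Section Transport.
Variables (R : realType) (n : nat) (M : manifold R n).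
Variable X : M -> 'rV[R]_n.
Hypothesis HX : smooth_field setT X.
Implicit Types (p q : M) (c : R -> M).

(* [J] is invariant under the flow of X: in charts, [J' = DX(c) J]. *)
Definition jacobi_along (T : R) c (J : R -> 'rV[R]_n) : Prop :=
  forall t0, 0 <= t0 <= T -> exists2 d : R, 0 < d & forall t, 0 <= t <= T ->
    `|t - t0| < d -> hderiv 0 T (fun s => in_chart (c t0) (c s) (J s)) t
      ('d (local_rep X (c t0)) (chart (c t0) (c t)) (in_chart (c t0) (c t) (J t))).

(** Around [c t0] one chart contains the piece of [c] between [s1] and [s2], and [psi] is the local
    flow read there. The integral curves from all points near [c s1] are part of the conclusion
    because they continue the global flow from time [s1] to time [s2]. *)
Lemma local_transport T c J t0 : icurve X 0 T c -> jacobi_along T c J ->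
  0 <= t0 <= T -> exists2 d : R, 0 < d & forall s1 s2,
    0 <= s1 <= t0 -> t0 <= s2 <= T -> t0 - s1 < d -> s2 - t0 < d ->
    exists (psi : 'rV[R]_n -> 'rV[R]_n), [/\ dom (c t0) (c s1), dom (c t0) (c s2),
      (\forall q \near c s1, dom (c t0) q /\ exists g, [/\ icurve X s1 s2 g,
          g s1 = q & g s2 = chartV (c t0) (psi (chart (c t0) q))]),
      differentiable psi (chart (c t0) (c s1)) /\
        psi (chart (c t0) (c s1)) = chart (c t0) (c s2) &
      'd psi (chart (c t0) (c s1)) (in_chart (c t0) (c s1) (J s1)) =
        in_chart (c t0) (c s2) (J s2)].
Proof.
move=> Hc HJ t0I; set p := c t0; have pp : dom p p by exact: dom_center.
have oT : open (img p setT) by apply: img_open; exact: openT.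
have [r [L [r0 L0 rA _ Hflow]]] := local_flow oT (@HX p) (img_chart pp I).
have r4 : 0 < r / 4 by rewrite divr_gt0.
have nP : \forall q \near c t0, dom p q /\ `|chart p q - chart p p| < r / 4.
  apply: filterI; first exact: near_dom.
  apply: (near_chart (P := fun u => `|u - chart p p| < r / 4) pp).
  by apply/near_normP; exists (r / 4).
have [d1 d10 P1] := icurve_near Hc t0I nP.
have [d2 d20 P2] := HJ t0 t0I.
exists (Num.min d1 d2); first by rewrite lt_min d10.
move=> s1 s2 /andP[s10 s1t] /andP[ts2 s2T]; rewrite !lt_min.
move=> /andP[sd1 sd2] /andP[sd3 sd4].
have nt s : s1 <= s <= s2 -> 0 <= s <= T /\ `|s - t0| < d1 /\ `|s - t0| < d2.
  by move=> /andP[? ?]; rewrite !ltr_norml; do !split; lra.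
have s12 : s1 <= s2 by lra.
have I1 : s1 <= s1 <= s2 by rewrite lexx.
have I2 : s1 <= s2 <= s2 by rewrite lexx andbT.
have K s : s1 <= s <= s2 -> dom p (c s) /\ `|chart p (c s) - chart p p| < r / 4.
  by move=> /nt[sI [sa sb]]; exact: P1.
have Hch t : s1 <= t <= s2 -> hderiv s1 s2 (chart p \o c) t
    (local_rep X p ((chart p \o c) t)) /\ `|(chart p \o c) t - chart p p| < r / 4.
  move=> tI; have [sI _] := nt t tI; have [? ?] := K t tI; split=> //.
  by apply: (hderiv_sub s10 s2T); exact: icurve_hderiv.
have [g [eta [eta0 gP gc gd gJ]]] := Hflow s1 s2 _ s12 Hch.
exists (g ^~ s2); have [ds1 _] := K s1 I1; have [ds2 _] := K s2 I2.
split=> //.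
- have nQ : \forall q \near c s1, `|chart p q - chart p (c s1)| < eta.
    apply: (near_chart (P := fun u => `|u - chart p (c s1)| < eta) ds1).
    by apply/near_normP; exists eta.
  apply: filterS2 (near_dom ds1) nQ => q pq qe; split=> //.
  have [ga gD] := gP _ qe.
  exists (chartV p \o g (chart p q)); split => //=; last by rewrite ga chartK.
  apply: chartV_icurve => t tI; have [D1 D2] := gD t tI; split=> //.
  exact: img_dom (rA _ D2).
- by split=> //; exact: gc.
- apply: (gJ (fun s => in_chart p (c s) (J s))) => t tI.
  have [sI [_ sb]] := nt t tI.
  exact: hderiv_sub s10 s2T (P2 t sI sb).
Qed.

(** In charts [F2] is a composite of four maps: [F1], a transition into the chart at [p], [psi], and
    a transition out of it. The first transition turns [J s1] into its coordinates at [p], on which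
    [psi] is known to act, and the second turns the result back into [J s2]. *)
Lemma flow_diff_step c (J : R -> 'rV[R]_n) s1 s2 p (psi : 'rV[R]_n -> 'rV[R]_n)
    (F1 F2 : M -> M) :
  let pc := c 0 in
  dom p (c s1) -> dom p (c s2) -> F1 pc = c s1 -> {for pc, continuous F1} ->
  differentiable (chart (c s1) \o F1 \o chartV pc) (chart pc pc) ->
  'd (chart (c s1) \o F1 \o chartV pc) (chart pc pc) (J 0) = J s1 ->
  (\forall q \near pc, F2 q = chartV p (psi (chart p (F1 q)))) ->
  differentiable psi (chart p (c s1)) ->
  psi (chart p (c s1)) = chart p (c s2) ->
  'd psi (chart p (c s1)) (in_chart p (c s1) (J s1)) = in_chart p (c s2) (J s2) ->
  [/\ {for pc, continuous F2},
      differentiable (chart (c s2) \o F2 \o chartV pc) (chart pc pc) &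
      'd (chart (c s2) \o F2 \o chartV pc) (chart pc pc) (J 0) = J s2].
Proof.
move=> pc ds1 ds2 F1c cF1 dF1 JF1 F2E dpsi psiE Jpsi.
have cc := dom_center pc; have c1 := dom_center (c s1); have c2 := dom_center (c s2).
have F2c : F2 pc = c s2.
  by rewrite (nbhs_singleton F2E) F1c psiE chartK.
have contF2 : {for pc, continuous F2}.
  move=> P /= Pc; rewrite F2c in Pc.
  have H1 := near_chartV ds2 Pc; rewrite -psiE in H1.
  have H2 := differentiable_continuous dpsi H1.
  have H3 := near_chart ds1 H2; rewrite -F1c in H3.
  have H4 := cF1 _ H3.
  by apply: filterS2 F2E H4 => q FE; rewrite /preimage /= FE.
have d1 := trans_diff c1 ds1.
have d2 := trans_diff ds2 c2.
pose f1 := chart (c s1) \o F1 \o chartV pc.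
have f1c : f1 (chart pc pc) = chart (c s1) (c s1) by rewrite /f1 /= chartK // F1c.
have d1' := d1; rewrite -f1c in d1'.
have e1 : (chart p \o chartV (c s1)) (f1 (chart pc pc)) = chart p (c s1).
  by rewrite f1c /= chartK.
have d12 := differentiable_comp dF1 d1'.
have dpsi' := dpsi; rewrite -e1 in dpsi'.
have d123 := differentiable_comp d12 dpsi'.
have e2 : psi ((chart p \o chartV (c s1)) (f1 (chart pc pc))) = chart p (c s2).
  by rewrite e1.
have d2' := d2; rewrite -e2 in d2'.
have d1234 := differentiable_comp d123 d2'.
have E : {near chart pc pc, (chart (c s2) \o chartV p) \o (psi \o
    ((chart p \o chartV (c s1)) \o f1)) =1 chart (c s2) \o F2 \o chartV pc}.
  have H1 : \forall r \near F1 pc, dom (c s1) r by rewrite F1c; exact: near_dom c1.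
  have H2 := cF1 _ H1.
  have G1 := near_chartV (P := fun q => F2 q = chartV p (psi (chart p (F1 q)))) cc F2E.
  have G2 := near_chartV (P := fun q => dom (c s1) (F1 q)) cc H2.
  apply: filterS2 G1 G2 => u FE du.
  by rewrite /= FE /f1 /= chartK.
have [D1 D2] := differentiable_near E d1234.
split; [exact: contF2 | exact: D1 | ].
have dpt (f : 'rV[R]_n -> 'rV[R]_n) x y v w : x = y -> v = w -> 'd f x v = 'd f y w.
  by move=> -> ->.
apply: (etrans (congr1 (@^~ (J 0)) D2)).
apply: (etrans (diff_compE (J 0) d123 d2')).
have S1 : 'd ((chart p \o chartV (c s1)) \o f1) (chart pc pc) (J 0) =
    in_chart p (c s1) (J s1).
  apply: (etrans (diff_compE (J 0) dF1 d1')).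
  exact: dpt f1c JF1.
have S2 : 'd (psi \o ((chart p \o chartV (c s1)) \o f1)) (chart pc pc) (J 0) =
    in_chart p (c s2) (J s2).
  apply: (etrans (diff_compE (J 0) d12 dpsi')).
  apply: (etrans _ Jpsi); exact: dpt e1 S1.
apply: (etrans (dpt _ _ _ _ _ e2 S2)).
exact: in_chartK.
Qed.

Theorem transport T c J s : icurve X 0 T c -> jacobi_along T c J ->
  0 <= s <= T -> flow X s (c 0) = c s /\
    tangent_map (flow X s) (c 0) (J 0) = J s.
Proof.
move=> Hc HJ /andP[s0 sT].
have flowc u : 0 <= u <= T -> flow X u (c 0) = c u.
  move=> /andP[u0 uT]; apply: (flowE HX u0) => //.
  by apply: icurve_sub Hc.
have sI : 0 <= s <= T by rewrite s0.
split; first exact: flowc.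
rewrite /tangent_map flowc //.
(* The first clause says that orbits starting near [c 0] last until [u]; without it [flow X u] might
   take its default value there. Continuity is what places the images of points near [c 0] close
   enough to [c u] for the next local step. *)
pose Q u := [/\ (\forall q \near c 0, exists g, icurve X 0 u g /\ g 0 = q),
   {for c 0, continuous (flow X u)},
   differentiable (chart (c u) \o flow X u \o chartV (c 0)) (chart (c 0) (c 0)) &
   'd (chart (c u) \o flow X u \o chartV (c 0)) (chart (c 0) (c 0)) (J 0) = J u].
suff : Q s by case.
have icst q : icurve X 0 0 (fun=> q).
  move=> t /le_anti <-; split=> [P Pq|e e0]; exists 1 => //.
    by move=> *; exact: nbhs_singleton Pq.
  by move=> u /le_anti <- _; rewrite !(subrr, scale0r, subr0, normr0, mulr0).
have flow0 : flow X 0 = id by apply/funext => q; exact: (flowE HX (lexx 0) (icst q)).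
apply: (@real_induction R 0 s Q s0).
  have E0 : chart (c 0) \o flow X 0 \o chartV (c 0) = chart (c 0) \o chartV (c 0).
    by rewrite flow0.
  have cc := dom_center (c 0); split.
  - by apply: filterE => q; exists (fun=> q).
  - by rewrite flow0.
  - by rewrite E0; exact: trans_diff.
  - by rewrite E0; exact: trans_id.
move=> t0 /andP[t00 t0s].
have t0I : 0 <= t0 <= T by rewrite t00 (le_trans t0s).
have [d d0 dP] := local_transport Hc HJ t0I; exists d => // s1 s2.
move=> /andP[s10 s1t] /andP[ts2 s2s] sd1 sd2 [Q1 Q2 Q3 Q4].
have [||psi [ds1 ds2 near_psi [dpsi psiE] Jpsi]] := dP s1 s2 _ _ sd1 sd2.
- by rewrite s10.
- by rewrite ts2 (le_trans s2s).
have s20 : 0 <= s2 by rewrite (le_trans s10) // (le_trans s1t).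
have s12 : s1 <= s2 by rewrite (le_trans s1t).
have s1I : 0 <= s1 <= T by rewrite s10 (le_trans s12) // (le_trans s2s).
rewrite -(flowc s1 s1I) in near_psi; have near2 := Q2 _ near_psi.
have [A1 A2] : (\forall q \near c 0, exists g, icurve X 0 s2 g /\ g 0 = q) /\
    (\forall q \near c 0, flow X s2 q =
       chartV (c t0) (psi (chart (c t0) (flow X s1 q)))).
  have : \forall q \near c 0, (exists g, icurve X 0 s2 g /\ g 0 = q) /\ flow X s2 q =
       chartV (c t0) (psi (chart (c t0) (flow X s1 q))).
    (* An orbit that has lasted until [s1] is continued by the local integral curve starting at its
       endpoint. *)
    apply: filterS2 Q1 near2 => q [g1 [Hg1 g10]] /= [_ [g2 [Hg2 g21 g22]]].
    have E1 : g1 s1 = g2 s1 by rewrite g21 (flowE HX s10 Hg1 g10).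
    have Hg := icurve_cat s10 s12 Hg1 Hg2 E1.
    have g0 : (if 0 <= s1 then g1 0 else g2 0) = q by rewrite s10.
    split; first by exists (fun u => if u <= s1 then g1 u else g2 u).
    rewrite (flowE HX s20 Hg g0); case: ifP => // s21.
    have -> : s2 = s1 by apply/eqP; rewrite eq_le s21.
    have {}s21 : s2 = s1 by apply/eqP; rewrite eq_le s21.
    by rewrite E1 -g22 s21.
  by move=> H; split; apply: filterS H => q [].
have [B1 B2 B3] := flow_diff_step ds1 ds2 (flowc s1 s1I) Q2 Q3 Q4 A2 dpsi psiE Jpsi.
by [].
Qed.

End Transport.

(** * Normal sections and Jacobi fields *)

Section Frames.
Variables (R : realType) (n : nat) (M : manifold R n).
Variables (X : M -> 'rV[R]_n) (V : M -> {vspace 'rV[R]_n}) (m : nat).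
Hypothesis HX : smooth_field setT X.
Implicit Types (p q : M) (c : R -> M) (U : set M).

Lemma smooth_field_setT U : smooth_field U X.
Proof. exact: smooth_field_subset HX. Qed.

Lemma local_rep_comb (W : 'I_m -> M -> 'rV[R]_n) (k : 'I_m -> M -> R) p u :
  local_rep (fun q => \sum_i k i q *: W i q) p u =
  \sum_i k i (chartV p u) *: local_rep (W i) p u.
Proof.
by rewrite /local_rep in_chart_sum; apply: eq_bigr => i _; rewrite in_chartZ.
Qed.

Lemma local_rep_near U (Y Z : M -> 'rV[R]_n) p u : (forall q, U q -> Y q = Z q) ->
  img p U u -> local_rep Y p u = local_rep Z p u.
Proof. by move=> YZ /imgV[_ Uu _]; rewrite /local_rep YZ. Qed.

Lemma bracket_near U (Y Z : M -> 'rV[R]_n) q : open U -> U q ->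
  (forall q, U q -> Y q = Z q) -> bracket X Y q = bracket X Z q.
Proof.
move=> oU Uq YZ; rewrite !bracketE; apply: lbr_near.
have H : img q U (chart q q) by apply: img_chart => //; exact: dom_center.
apply: filterS (open_nbhs_nbhs (conj (@img_open _ _ _ q _ oU) H)) => u.
exact: local_rep_near.
Qed.

Lemma smooth_field_comb U (W : 'I_m -> M -> 'rV[R]_n) (k : 'I_m -> R) : open U ->
  (forall i, smooth_field U (W i)) -> smooth_field U (fun q => \sum_i k i *: W i q).
Proof.
move=> oU HW p; have oI := @img_open _ _ _ p _ oU.
apply: (@smooth_on_eq _ _ _ _ (fun u => \sum_i k i *: local_rep (W i) p u)) => //.
  by move=> u _; rewrite (local_rep_comb W (fun i _ => k i)).
apply: smooth_on_sum => // i; apply: smooth_on_scale => //; last exact: HW.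
exact: smooth_on_cst.
Qed.

Lemma bracket_comb U (W : 'I_m -> M -> 'rV[R]_n) (k : 'I_m -> R) q : open U -> U q ->
  (forall i, smooth_field U (W i)) ->
  bracket X (fun q => \sum_i k i *: W i q) q = \sum_i k i *: bracket X (W i) q.
Proof.
move=> oU Uq HW; rewrite bracketE.
have qq := dom_center q.
have -> : local_rep (fun q => \sum_i k i *: W i q) q =
    (fun u => \sum_i (k i : R^o) *: local_rep (W i) q u).
  by apply/funext => u; rewrite (local_rep_comb W (fun i _ => k i)).
rewrite (@lbr_comb _ _ _ (fun i _ => k i)).
- rewrite big1 ?add0r; first by apply: eq_bigr => i _; rewrite bracketE.
  by move=> i _; rewrite derive_cst scale0r.
- exact: smooth_field_diff (@smooth_field_setT U) qq Uq.
- by move=> i; exact: differentiable_cst.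
- by move=> i; exact: smooth_field_diff (HW i) qq Uq.
Qed.

Lemma bracket2_comb U (W : 'I_m -> M -> 'rV[R]_n) (k : 'I_m -> R) q : open U -> U q ->
  (forall i, smooth_field U (W i)) ->
  bracket X (bracket X (fun q => \sum_i k i *: W i q)) q =
  \sum_i k i *: bracket X (bracket X (W i)) q.
Proof.
move=> oU Uq HW.
have HB i : smooth_field U (bracket X (W i)).
  by apply: smooth_field_bracket => //; exact: smooth_field_setT.
rewrite -(bracket_comb k oU Uq HB); apply: (bracket_near oU Uq) => r Ur.
exact: (bracket_comb k oU Ur HW).
Qed.

Definition frame_coord (W : 'I_m -> M -> 'rV[R]_n) (i : 'I_m) q (v : 'rV[R]_n) : R :=
  coord [tuple W i q | i < m] i v.

Lemma frame_coordE U (W : 'I_m -> M -> 'rV[R]_n) q v : frame V U W -> U q -> v \in V q ->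
  v = \sum_i frame_coord W i q v *: W i q.
Proof.
move=> [_ [_ HW]] Uq vV; rewrite {1}(coord_basis (HW q Uq) vV).
by apply: eq_bigr => i _; rewrite -tnth_nth tnth_mktuple.
Qed.

Lemma frame_free U (W : 'I_m -> M -> 'rV[R]_n) q (a : 'I_m -> R) : frame V U W -> U q ->
  \sum_i a i *: W i q = 0 -> forall i, a i = 0.
Proof.
move=> [_ [_ HW]] Uq E; have /freeP := basis_free (HW q Uq).
apply; rewrite -[RHS]E.
by apply: eq_bigr => i _; rewrite -tnth_nth tnth_mktuple.
Qed.

Lemma frame_eq U (W : 'I_m -> M -> 'rV[R]_n) q (a b : 'I_m -> R) : frame V U W -> U q ->
  \sum_i a i *: W i q = \sum_i b i *: W i q -> forall i, a i = b i.
Proof.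
move=> FW Uq E i; apply/eqP; rewrite -subr_eq0; apply/eqP.
apply: (frame_free FW Uq (a := fun i => a i - b i)).
by under eq_bigr do rewrite scalerBl; rewrite sumrB E subrr.
Qed.

Lemma frame_mem U (W : 'I_m -> M -> 'rV[R]_n) q (a : 'I_m -> R) : frame V U W -> U q ->
  \sum_i a i *: W i q \in V q.
Proof.
move=> [HW _] Uq; apply: memv_suml => i _; apply: memvZ.
by have [_ _] := HW i; apply.
Qed.

Lemma frame_smooth U (W : 'I_m -> M -> 'rV[R]_n) i : frame V U W -> smooth_field U (W i).
Proof. by move=> [HW _]; have [] := HW i. Qed.

Lemma frame_open U (W : 'I_m -> M -> 'rV[R]_n) : frame V U W -> open U.
Proof. by move=> [_ []]. Qed.

Lemma img_free U (W : 'I_m -> M -> 'rV[R]_n) p u (a : 'I_m -> R) : frame V U W ->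
  img p U u -> \sum_i a i *: local_rep (W i) p u = 0 -> forall i, a i = 0.
Proof.
move=> FW iu E; have [pu Uu _] := imgV iu.
apply: (frame_free FW Uu); apply: (in_chart_inj pu).
rewrite in_chart0 in_chart_sum -[RHS]E.
by apply: eq_bigr => i _; rewrite in_chartZ.
Qed.

End Frames.

(** * Normal sections, normal frames and curvature *)

Section Normal.
Variables (R : realType) (n : nat) (M : manifold R n).
Variables (X : M -> 'rV[R]_n) (V : M -> {vspace 'rV[R]_n}) (m : nat).
Hypothesis hreg : regular_pair X V m.
Implicit Types (p q : M) (c : R -> M) (U : set M) (W : 'I_m -> M -> 'rV[R]_n).

Lemma regular_smooth : smooth_field setT X.
Proof. by case: hreg => -[]. Qed.
Let HX := regular_smooth.

Lemma section_local U U' W (Y : M -> 'rV[R]_n) p u : frame V U W -> section_of V U' Y ->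
  img p (U `&` U') u -> local_rep Y p u =
    \sum_i (frame_coord W i (chartV p u) (Y (chartV p u)) : R) *: local_rep (W i) p u.
Proof.
move=> FW [_ _ YV] iu; have [_ [Uu Uu'] _] := imgV iu.
rewrite -(local_rep_comb W (fun i q => frame_coord W i q (Y q))).
rewrite /local_rep; congr in_chart.
exact: frame_coordE FW Uu (YV _ Uu').
Qed.

Lemma section_bracket U U' W (Y : M -> 'rV[R]_n) p : frame V U W ->
  section_of V U' Y -> U p -> U' p ->
  let g i u : R^o := frame_coord W i (chartV p u) (Y (chartV p u)) in
  bracket X Y p = \sum_i 'D_(X p) (g i) (chart p p) *: W i p +
    \sum_i frame_coord W i p (Y p) *: bracket X (W i) p.
Proof.
move=> FW HY Up U'p g; have [oU' sY _] := HY; have oU := frame_open FW.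
have pp := dom_center p.
have oI : open (img p (U `&` U')) by apply: img_open; exact: openI.
have xI : img p (U `&` U') (chart p p) by apply: img_chart.
have sub : img p (U `&` U') `<=` img p U.
  by move=> _ [q [pq [Uq _]] <-]; exact: img_chart.
have sub' : img p (U `&` U') `<=` img p U'.
  by move=> _ [q [pq [_ Uq]] <-]; exact: img_chart.
have HXO : smooth_on (img p (U `&` U')) (local_rep X p).
  exact: (@smooth_field_setT _ _ _ _ HX (U `&` U') p).
have HYO : smooth_on (img p (U `&` U')) (local_rep Y p).
  exact: smooth_on_subset sub' (@sY p).
have HWO i : smooth_on (img p (U `&` U')) (local_rep (W i) p).
  exact: smooth_on_subset sub (@frame_smooth _ _ _ _ _ _ _ i FW p).
have free u : img p (U `&` U') u -> forall a : 'I_m -> R,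
    \sum_i a i *: local_rep (W i) p u = 0 -> forall i, a i = 0.
  by move=> /sub iu a; exact: img_free FW iu.
have SE u (iu : img p (U `&` U') u) : local_rep Y p u =
    \sum_i (g i u : R) *: local_rep (W i) p u := section_local FW HY iu.
have E := lbr_section oI HXO HYO HWO free SE xI.
apply: (etrans (etrans (bracketE X Y p) E)).
apply: (congr2 +%R); apply: eq_bigr => i _; apply: (congr2 *:%R).
- exact: (congr1 (fun w => 'D_w (g i) (chart p p)) (local_rep_center X p)).
- exact: local_rep_center.
- by rewrite /g chartK.
- exact: esym (bracketE _ _ _).
Qed.

(** Dimension count: by the Leibniz rule the [m + m] vectors span all generators of the derived
    distribution, whose dimension is [2 * m], so they are free. *)
Lemma frame_free2 U W q (a b : 'I_m -> R) : frame V U W -> U q ->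
  \sum_i a i *: W i q + \sum_i b i *: bracket X (W i) q = 0 ->
  (forall i, a i = 0) /\ (forall i, b i = 0).
Proof.
move=> FW Uq E; case: hreg => _ _ [D [Dspan Ddim _]].
pose fam := [tuple match fintype.split l with
  | inl i => W i q | inr i => bracket X (W i) q end | l < m + m].
have faml i : fam`_(lshift m i) = W i q.
  by rewrite -tnth_nth tnth_mktuple (unsplitK (inl i)).
have famr i : fam`_(rshift m i) = bracket X (W i) q.
  by rewrite -tnth_nth tnth_mktuple (unsplitK (inr i)).
have memf (l : 'I_(m + m)) : fam`_l \in <<fam>>%VS.
  by apply: memv_span; rewrite -tnth_nth; exact: mem_tnth.
have DF : (D q <= <<fam>>)%VS.
  have [_] := Dspan q; apply=> _ [U' [Y [U'q HY [->|->]]]].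
    have [_ _ YV] := HY; rewrite (frame_coordE FW Uq (YV q U'q)).
    by apply: memv_suml => i _; apply: memvZ; rewrite -faml; exact: memf.
  rewrite (section_bracket FW HY Uq U'q).
  apply: memvD; apply: memv_suml => i _; apply: memvZ.
    by rewrite -faml; exact: memf.
  by rewrite -famr; exact: memf.
have free_fam : free fam.
  rewrite /free; apply/eqP/anti_leq; rewrite dim_span /= size_tuple.
  by apply: leq_trans (dimvS DF); rewrite Ddim mul2n addnn card_ord.
have /freeP H := free_fam.
have {}H := H (fun l => match fintype.split l with inl i => a i | inr i => b i end).
have {}H : forall l : 'I_(m + m),
    match fintype.split l with inl i => a i | inr i => b i end = 0.
  apply: H; rewrite big_split_ord -[RHS]E; congr (_ + _); apply: eq_bigr => i _.
    by rewrite faml (unsplitK (inl i)).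
  by rewrite famr (unsplitK (inr i)).
split=> i; first by have := H (lshift m i); rewrite (unsplitK (inl i)).
by have := H (rshift m i); rewrite (unsplitK (inr i)).
Qed.

Definition normal_section U (S : M -> 'rV[R]_n) : Prop :=
  section_of V U S /\ forall q, U q -> bracket X (bracket X S) q \in V q.

(** In the chart at [p] the structure equation, the freeness of frame and brackets, and normality
    become the hypotheses of [normal_section_coef]. *)
Lemma normal_section_local U U' W (H0 H1 : M -> 'M[R]_m) (S : M -> 'rV[R]_n) p :
  frame V U W -> structure_eq X U W H0 H1 -> normal_section U' S -> U p -> U' p ->
  let g i u : R^o := frame_coord W i (chartV p u) (S (chartV p u)) in
  (forall i, differentiable (g i) (chart p p) /\
    'D_(X p) (g i) (chart p p) = - 2^-1 * \sum_j H1 p i j * frame_coord W j p (S p)) /\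
  bracket X (bracket X S) p =
    - \sum_i (\sum_j curvature_matrix X H0 H1 p i j * frame_coord W j p (S p)) *: W i p.
Proof.
move=> FW HS [HY HN] Up U'p g; have [oU' sY YV] := HY; have oU := frame_open FW.
have pp := dom_center p.
have oI : open (img p (U `&` U')) by apply: img_open; exact: openI.
have xI : img p (U `&` U') (chart p p) by apply: img_chart.
have sub : img p (U `&` U') `<=` img p U.
  by move=> _ [q [pq [Uq _]] <-]; exact: img_chart.
have sub' : img p (U `&` U') `<=` img p U'.
  by move=> _ [q [pq [_ Uq]] <-]; exact: img_chart.
have HXU' := smooth_field_setT HX.
have HXO : smooth_on (img p (U `&` U')) (local_rep X p).
  exact: (@HXU' (U `&` U') p).
have HYO : smooth_on (img p (U `&` U')) (local_rep S p).
  exact: smooth_on_subset sub' (@sY p).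
have HWO i : smooth_on (img p (U `&` U')) (local_rep (W i) p).
  exact: smooth_on_subset sub (@frame_smooth _ _ _ _ _ _ _ i FW p).
have free u : img p (U `&` U') u -> forall a : 'I_m -> R,
    \sum_i a i *: local_rep (W i) p u = 0 -> forall i, a i = 0.
  by move=> /sub iu a; exact: img_free FW iu.
have brW i u : img p U u -> lbr (local_rep X p) (local_rep (W i) p) u =
    local_rep (bracket X (W i)) p u.
  by move=> iu; rewrite (bracket_local (@HXU' U) (frame_smooth i FW) iu).
have free2 u : img p (U `&` U') u -> forall a b : 'I_m -> R,
    \sum_i a i *: local_rep (W i) p u +
    \sum_i b i *: lbr (local_rep X p) (local_rep (W i) p) u = 0 ->
    (forall i, a i = 0) /\ (forall i, b i = 0).
  move=> /sub iu a b; have [pu Uu _] := imgV iu => E.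
  apply: (frame_free2 FW Uu); apply: (in_chart_inj pu).
  rewrite in_chart0 in_chartD !in_chart_sum -[RHS]E; congr (_ + _).
    by apply: eq_bigr => i _; rewrite in_chartZ.
  by apply: eq_bigr => i _; rewrite in_chartZ brW.
have WE u : img p (U `&` U') u -> forall j,
    lbr (local_rep X p) (lbr (local_rep X p) (local_rep (W j) p)) u =
    \sum_i H0 (chartV p u) i j *: local_rep (W i) p u +
    \sum_i H1 (chartV p u) i j *: lbr (local_rep X p) (local_rep (W i) p) u.
  move=> /sub iu j; have [pu Uu _] := imgV iu.
  rewrite -(bracket2_local oU (@HXU' U) (frame_smooth j FW) iu).
  rewrite {1}/local_rep (HS _ Uu j) in_chartD !in_chart_sum; congr (_ + _).
    by apply: eq_bigr => i _; rewrite in_chartZ.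
  by apply: eq_bigr => i _; rewrite in_chartZ brW.
have SE u (iu : img p (U `&` U') u) := section_local FW HY iu.
have normal u : img p (U `&` U') u -> exists a : 'I_m -> R,
    lbr (local_rep X p) (lbr (local_rep X p) (local_rep S p)) u =
    \sum_i a i *: local_rep (W i) p u.
  move=> iu; have [pu [Uu U'u] _] := imgV iu.
  rewrite -(bracket2_local oU' (@HXU' U') sY (sub' _ iu)).
  exists (fun i => frame_coord W i (chartV p u) (bracket X (bracket X S) (chartV p u))).
  rewrite {1}/local_rep {1}(frame_coordE FW Uu (HN _ U'u)) in_chart_sum.
  by apply: eq_bigr => i _; rewrite in_chartZ.
have [A B] := normal_section_coef oI HXO HYO HWO free free2 WE SE xI normal.
have Vp : chartV p (chart p p) = p by rewrite chartK.
split=> [i|].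
  split; first exact: smooth_on_diff (smooth_section_coef oI HYO HWO free SE i) xI.
  by rewrite -[X p](local_rep_center X p) A Vp.
move: B; rewrite -(bracket2_local oU' (@HXU' U') sY (sub' _ xI)) local_rep_center => ->.
congr (- _); apply: eq_bigr => i _; rewrite local_rep_center; congr (_ *: _).
rewrite Vp; apply: eq_bigr => j _; congr (_ * _).
by rewrite /curvature_matrix /field_apply local_rep_center.
Qed.

(** [curvature] leaves the frame and its structure functions existentially quantified. On a normal
    section its value is expressed by brackets alone, so the choice is immaterial and an eigenvalue
    becomes a statement about [[X, [X, S]]]. *)
Lemma curvature_section U S p (w : 'rV[R]_n) : normal_section U S -> U p ->
  curvature X V m p (S p) w -> w = - bracket X (bracket X S) p.
Proof.
move=> HS Up [U' [W [H0 [H1 [a [U'p FW SW Sa ->]]]]]].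
have [_ ->] := normal_section_local FW SW HS U'p Up.
rewrite opprK; apply: eq_bigr => i _; congr (_ *: _).
rewrite mxE; apply: eq_bigr => j _; congr (_ * _).
have [[_ _ SV] _] := HS.
have E : \sum_i frame_coord W i p (S p) *: W i p = \sum_i a i 0 *: W i p.
  by rewrite -(frame_coordE FW U'p (SV p Up)).
by have -> := frame_eq FW U'p E j.
Qed.

Lemma normal_frame_section U (E : 'I_m -> M -> 'rV[R]_n) (k : 'I_m -> R) :
  normal_frame X V U E -> normal_section U (fun q => \sum_i k i *: E i q).
Proof.
move=> [FE HN]; have oU := frame_open FE.
have sE i : smooth_field U (E i) by exact: frame_smooth FE.
split; first by split=> [||q Uq]; [ | exact: smooth_field_comb | exact: frame_mem FE Uq].
move=> q Uq; rewrite (bracket2_comb HX k oU Uq sE).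
by apply: memv_suml => i _; apply: memvZ; exact: HN.
Qed.

Lemma normal_frame_structure U (E : 'I_m -> M -> 'rV[R]_n) : normal_frame X V U E ->
  structure_eq X U E (fun q => \matrix_(i, j) frame_coord E i q (bracket X (bracket X (E j)) q))
    (fun=> 0).
Proof.
move=> [FE HN] q Uq j.
rewrite [X in _ = _ + X]big1 ?addr0; last by move=> i _; rewrite mxE scale0r.
rewrite {1}(frame_coordE FE Uq (HN j q Uq)).
by apply: eq_bigr => i _; rewrite mxE.
Qed.

(** In a normal frame [H1 = 0], so the equation [X(g) = - H1 g / 2] for the coordinates of a normal
    section says that they are constant along [X]. *)
Lemma normal_coord U U' (E : 'I_m -> M -> 'rV[R]_n) S p i :
  normal_frame X V U E -> normal_section U' S -> U p -> U' p ->
  let g u : R^o := frame_coord E i (chartV p u) (S (chartV p u)) in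
  differentiable g (chart p p) /\ 'd g (chart p p) (X p) = 0.
Proof.
move=> NE HS Up U'p g.
have [A _] := normal_section_local NE.1 (normal_frame_structure NE) HS Up U'p.
have [d D] := A i; split=> //; rewrite -deriveE // D big1 ?mulr0 // => j _.
by rewrite mxE mul0r.
Qed.

Lemma bracket_normal_section U U' (E : 'I_m -> M -> 'rV[R]_n) S p :
  normal_frame X V U E -> normal_section U' S -> U p -> U' p ->
  bracket X S p = \sum_i frame_coord E i p (S p) *: bracket X (E i) p.
Proof.
move=> NE HS Up U'p; rewrite (section_bracket NE.1 HS.1 Up U'p) big1 ?add0r // => i _.
have [d D] := normal_coord i NE HS Up U'p.
by rewrite deriveE // D scale0r.
Qed.

End Normal.

(** * Parallel sections and invariant fields along the curve *)

Section AlongCurve.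
Variables (R : realType) (n : nat) (M : manifold R n).
Variables (X : M -> 'rV[R]_n) (V : M -> {vspace 'rV[R]_n}) (m : nat).
Hypothesis hreg : regular_pair X V m.
Variables (T : R) (c : R -> M).
Hypothesis Hc : icurve X 0 T c.
Implicit Types (p q : M) (U : set M) (v : R -> 'rV[R]_n).

Let HX := regular_smooth hreg.

Lemma near_itvP (t : R) (P : R -> Prop) :
  (\forall s \near t, 0 <= s <= T -> P s) <->
  exists2 d : R, 0 < d & forall s, 0 <= s <= T -> `|s - t| < d -> P s.
Proof.
split=> [/nbhs_ballP[d /= d0 dP]|[d d0 dP]].
  by exists d => // s sI sd; apply: dP => //; rewrite /ball /= distrC.
by apply/nbhs_ballP; exists d => // s; rewrite /ball /= distrC => sd sI; exact: dP.
Qed.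

Lemma hderiv0_const (W : normedModType R) (a b : R) (f : R -> W) : a <= b ->
  (forall t, a <= t <= b -> hderiv a b f t 0) -> f a = f b.
Proof.
move=> ab H; apply/esym/eqP; rewrite -subr_eq0 -normr_le0.
have := @mean_value_le R W a b f (fun=> 0) (fun=> 0) (fun=> 0) ab H.
rewrite subrr; apply => t _; first exact: hderiv_cst.
by rewrite normr0.
Qed.

Lemma frame_coord_comb k (E : 'I_m -> M -> 'rV[R]_n) i q (a : 'I_k -> R)
    (w : 'I_k -> 'rV[R]_n) :
  frame_coord E i q (\sum_j a j *: w j) = \sum_j a j * frame_coord E i q (w j).
Proof.
by rewrite /frame_coord linear_sum; apply: eq_bigr => j _; rewrite linearZ.
Qed.

(** The normal frame hidden in [covariant_deriv] may differ from [E]. Coordinates of one normal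
    frame in another have zero derivative along [c], so the change of frame contributes nothing. *)
Lemma covariant_deriv_coord U (E : 'I_m -> M -> 'rV[R]_n) v t i :
  normal_frame X V U E -> 0 <= t <= T -> U (c t) ->
  covariant_deriv X V m T c v t 0 ->
  hderiv 0 T (fun s => frame_coord E i (c s) (v s) : R^o) t 0.
Proof.
move=> NE tI Uc [U1 [E1 [f [df [[U1c NE1] near_v Hf df0]]]]].
have df_eq0 j : df j = 0.
  by apply: (frame_free NE1.1 U1c (a := df)); rewrite -df0.
have HG j : hderiv 0 T (fun s => frame_coord E i (c s) (E1 j (c s)) : R^o) t 0.
  have NS : normal_section X V U1 (E1 j).
    by split; [exact: NE1.1.1 | exact: NE1.2].
  have [dg Dg] := normal_coord hreg i NE NS Uc U1c.
  have := hderiv_comp (Hc tI).2 dg; rewrite /= Dg.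
  have [d d0 dP] := icurve_near Hc tI (near_dom (dom_center (c t))).
  apply: hderiv_eq; first by rewrite /= chartK //; exact: dom_center.
  by exists d => // s sI sd /=; rewrite chartK //; exact: dP.
have [d d0 dP] := (near_itvP _ _).1 near_v.
have Hsum := @hderiv_sum R R^o _ (index_enum 'I_m) 0 T
  (fun j s => (f j s : R) *: (frame_coord E i (c s) (E1 j (c s)) : R^o)) t
  (fun=> 0).
rewrite big1 // in Hsum; apply: hderiv_eq (Hsum _).
- by rewrite dP ?subrr ?normr0 // frame_coord_comb.
- by exists d => // s sI sd; rewrite (dP s sI sd) frame_coord_comb.
move=> j; have Hfj : hderiv 0 T (f j : R -> R^o) t (df j).
  by apply/has_derivP => //; exact: Hf.
have := hderiv_scale Hfj (HG j).
by rewrite df_eq0 scale0r scaler0 addr0.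
Qed.

Lemma parallel_comb U (E : 'I_m -> M -> 'rV[R]_n) v t0 :
  normal_frame X V U E -> 0 <= t0 <= T -> U (c t0) ->
  (exists2 d : R, 0 < d & forall t, 0 <= t <= T -> `|t - t0| < d ->
     v t \in V (c t) /\ covariant_deriv X V m T c v t 0) ->
  exists2 d : R, 0 < d & forall s, 0 <= s <= T -> `|s - t0| < d ->
    v s = \sum_i frame_coord E i (c t0) (v t0) *: E i (c s).
Proof.
move=> NE t0I Uc [d1 d10 P1]; have oU := frame_open NE.1.
have [d2 d20 P2] := icurve_near Hc t0I (open_nbhs_nbhs (conj oU Uc)).
exists (Num.min d1 d2); first by rewrite lt_min d10.
move=> s sI; rewrite lt_min => /andP[sd1 sd2].
have Us := P2 s sI sd2; have [vV _] := P1 s sI sd1.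
rewrite {1}(frame_coordE NE.1 Us vV); apply: eq_bigr => i _; congr (_ *: _).
pose f u : R^o := frame_coord E i (c u) (v u).
have D u : 0 <= u <= T -> `|u - t0| < d1 -> `|u - t0| < d2 -> hderiv 0 T f u 0.
  move=> uI ud1 ud2; apply: (covariant_deriv_coord i NE) => //; first exact: P2.
  by have [] := P1 u uI ud1.
have /andP[s0 sT] := sI; have /andP[t00 t0T] := t0I.
move: sd1 sd2; rewrite !ltr_norml => /andP[? ?] /andP[? ?].
have [st|ts] := leP s t0.
  apply: (@hderiv0_const R^o s t0 f st) => u /andP[su ut].
  apply: (hderiv_sub s0 t0T); apply: D; rewrite ?ltr_norml; lra.
apply/esym/(@hderiv0_const R^o t0 s f (ltW ts)) => u /andP[su ut].
by apply: (hderiv_sub t00 sT); apply: D; rewrite ?ltr_norml; lra.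
Qed.

(** The coordinates of [v] in a normal frame are constant near [t0], and the combination of the
    frame with these constants is a field on an open set that extends [v], to which brackets apply.
    The normal frame itself is extracted from the [covariant_deriv] hypothesis at [t0]. *)
Lemma parallel_section v t0 : 0 <= t0 <= T ->
  (forall t : R, 0 <= t <= T -> v t \in V (c t) /\ covariant_deriv X V m T c v t 0) ->
  exists U S, [/\ U (c t0), normal_section X V U S &
    exists2 d : R, 0 < d & forall s, 0 <= s <= T -> `|s - t0| < d ->
      U (c s) /\ v s = S (c s)].
Proof.
move=> t0I Hv; have [_ [U [E [_ [_ [[Uc NE] _ _ _]]]]]] := Hv t0 t0I.
have [|d1 d10 P1] := parallel_comb NE t0I Uc (v := v).
  by exists 1 => // t tI _; exact: Hv.
have [d2 d20 P2] := icurve_near Hc t0I (open_nbhs_nbhs (conj (frame_open NE.1) Uc)).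
exists U, (fun q => \sum_i frame_coord E i (c t0) (v t0) *: E i q); split=> //.
  exact: normal_frame_section.
exists (Num.min d1 d2); first by rewrite lt_min d10.
by move=> s sI; rewrite lt_min => /andP[? ?]; split; [exact: P2 | exact: P1].
Qed.

Variables (v : R -> 'rV[R]_n) (lam : R -> R).
Hypothesis Hv : forall t : R, 0 <= t <= T ->
  [/\ v t \in V (c t), v t != 0 & covariant_deriv X V m T c v t 0].
Hypothesis Hlam : forall t : R, 0 <= t <= T -> curvature X V m (c t) (v t) (lam t *: v t).

Let section_at t0 (t0I : 0 <= t0 <= T) := parallel_section t0I
  (fun t tI => let: And3 a _ b := Hv tI in conj a b).

Lemma eigenvalue_bracket U S t : 0 <= t <= T -> normal_section X V U S -> U (c t) ->
  v t = S (c t) -> bracket X (bracket X S) (c t) = - (lam t *: S (c t)).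
Proof.
move=> tI NS Uc vS; have := Hlam tI; rewrite vS => H.
by rewrite (curvature_section hreg NS Uc H) opprK.
Qed.

(** Near [t0] the eigenvalue is a quotient of continuous functions: minus a coordinate of [[X,
    [X, S]]] over the same coordinate of the extension [S] of [v], chosen nonzero at [t0].
    Continuity is needed for existence and uniqueness in the scalar equation. *)
Lemma eigenvalue_cont t0 : 0 <= t0 <= T -> hcont 0 T (lam : R -> R^o) t0.
Proof.
move=> t0I; have [U [S [Uc NS [d d0 dP]]]] := section_at t0I.
have [[oU sS _] _] := NS; pose p := c t0; have pp := dom_center p.
have oI := @img_open _ _ _ p _ oU.
have sX := @smooth_field_setT _ _ _ _ HX U.
pose A := local_rep S p; pose B := lbr (local_rep X p) (lbr (local_rep X p) A).
have sA : smooth_on (img p U) A by exact: sS.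
have sB : smooth_on (img p U) B.
  by apply: (smooth_lbr oI (@sX p)); exact: smooth_lbr oI (@sX p) sA.
have [_ vn0 _] := Hv t0I.
have An0 : A (chart p p) != 0.
  by rewrite /A local_rep_center -(dP t0 t0I _).2 ?subrr ?normr0.
have [i Ai] : exists i, A (chart p p) 0 i != 0.
  apply/existsP; rewrite -negb_forall; apply/negP => /forallP H.
  by case/negP: An0; apply/eqP/rowP => i; rewrite (eqP (H i)) mxE.
have xI : img p U (chart p p) by exact: img_chart.
have dA : differentiable (fun u => A u 0 i : R^o) (chart p p).
  exact: smooth_on_diff (smooth_on_coord i oI sA) xI.
have dB : differentiable (fun u => B u 0 i : R^o) (chart p p).
  exact: smooth_on_diff (smooth_on_coord i oI sB) xI.
have dV : differentiable (fun u => (A u 0 i)^-1 : R^o) (chart p p).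
  exact: differentiableV.
have HD := (Hc t0I).2.
have H1 := hderiv_comp HD dV; have H2 := hderiv_comp HD dB.
have H3 := hderiv_cont (hderivN (hderiv_scale H1 H2)).
have nA : \forall q \near c t0, dom p q /\ A (chart p q) 0 i != 0.
  have cA := differentiable_continuous dA.
  have nz : \forall y \near (A (chart p p) 0 i : R^o), y != 0.
    by apply: open_nbhs_nbhs; split => //; exact: open_neq.
  have H4 := cA _ nz.
  apply: filterS2 (near_dom pp) (near_chart (P := fun u => A u 0 i != 0) pp H4).
  by move=> q pq Aq; split.
have [d1 d10 P1] := icurve_near Hc t0I nA.
have E s : 0 <= s <= T -> `|s - t0| < d -> `|s - t0| < d1 ->
    - ((A (chart p (c s)) 0 i)^-1 * B (chart p (c s)) 0 i) = lam s.
  move=> sI sd sd1; have [Us vs] := dP s sI sd; have [ps As] := P1 s sI sd1.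
  have iu : img p U (chart p (c s)) by exact: img_chart.
  have := congr1 (in_chart p (c s)) (eigenvalue_bracket sI NS Us vs).
  rewrite -local_repE // (bracket2_local oU (@sX) sS iu) -/A -/B.
  rewrite in_chartN in_chartZ -local_repE // => ->.
  by rewrite !mxE mulrN opprK mulrCA mulVf ?mulr1.
apply: hcont_eq H3; first by apply: E; rewrite ?subrr ?normr0.
exists (Num.min d d1); first by rewrite lt_min d0.
by move=> s sI; rewrite lt_min => /andP[? ?]; exact: E.
Qed.

(* Well defined: for a normal section [S], the value of [[X, S]] at a point depends only on
   the value of [S] there. *)
Definition hlift (t : R) : 'rV[R]_n :=
  xget 0 [set z | exists U S, [/\ U (c t), normal_section X V U S, S (c t) = v t &
                                 z = bracket X S (c t)]].

Lemma hliftE U S t : 0 <= t <= T -> U (c t) -> normal_section X V U S ->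
  S (c t) = v t -> hlift t = bracket X S (c t).
Proof.
move=> tI Uc NS Sv; apply: xget_unique; first by exists U, S.
move=> z [U' [S' [U'c NS' S'v ->]]].
have [_ _ [U0 [E [_ [_ [[U0c NE] _ _ _]]]]]] := Hv tI.
rewrite (bracket_normal_section hreg NE NS U0c Uc).
by rewrite (bracket_normal_section hreg NE NS' U0c U'c) Sv S'v.
Qed.

Lemma jacobi_field (al be : R -> R^o) :
  (forall t, 0 <= t <= T -> hderiv 0 T al t (lam t * be t : R^o)) ->
  (forall t, 0 <= t <= T -> hderiv 0 T be t (- al t)) ->
  jacobi_along X T c (fun t => (al t : R) *: v t + (be t : R) *: hlift t).
Proof.
move=> Ha Hb t0 t0I; have [U [S [Uc NS [d d0 dP]]]] := section_at t0I.
have [[oU sS _] _] := NS; pose p := c t0; have pp := dom_center p.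
have oI := @img_open _ _ _ p _ oU.
have sX := @smooth_field_setT _ _ _ _ HX U.
have [d1 d10 P1] := icurve_near Hc t0I (near_dom pp).
exists (Num.min d d1); first by rewrite lt_min d0.
have E s : 0 <= s <= T -> `|s - t0| < d -> `|s - t0| < d1 ->
    in_chart p (c s) ((al s : R) *: v s + (be s : R) *: hlift s) =
    (al s : R) *: local_rep S p (chart p (c s)) +
    (be s : R) *: lbr (local_rep X p) (local_rep S p) (chart p (c s)).
  move=> sI sd sd1; have [Us vs] := dP s sI sd; have ps := P1 s sI sd1.
  rewrite in_chartD !in_chartZ (hliftE sI Us NS (esym vs)) vs -local_repE //.
  by rewrite (bracket_chart (@sX) sS ps Us).
move=> t tI; rewrite lt_min => /andP[td td1].
have [Ut vt] := dP t tI td; have pt := P1 t tI td1.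
have iu : img p U (chart p (c t)) by exact: img_chart.
have EB : lbr (local_rep X p) (lbr (local_rep X p) (local_rep S p)) (chart p (c t)) =
    - (lam t *: local_rep S p (chart p (c t))).
  rewrite -(bracket2_local oU (@sX) sS iu) !local_repE //.
  by rewrite (eigenvalue_bracket tI NS Ut vt) in_chartN in_chartZ.
have := jacobi_local (c := chart p \o c) oI (@sX p) (@sS p) iu
  (icurve_hderiv Hc tI pt) (Ha t tI) (Hb t tI) EB.
rewrite -/p (E t tI td td1).
apply: hderiv_eq; first by rewrite E.
(* Points this close to [t] are still within the radius around [t0] where the chart formula [E]
   holds. *)
pose e := Num.min d d1 - `|t - t0|.
have e0 : 0 < e by rewrite subr_gt0 lt_min td.
exists e => // s sI se; have sm : `|s - t0| < Num.min d d1.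
  rewrite -(subrKA t); apply: (le_lt_trans (ler_normD _ _)).
  by move: se; rewrite /e; lra.
by move: sm; rewrite lt_min => /andP[? ?]; rewrite E.
Qed.

End AlongCurve.

(** * Conjugate times *)

Section ScalarJacobi.
Variables (R : realType).
Implicit Types (y dy lam : R -> R^o).

Definition jacobi_solution (T : R) lam y dy : Prop :=
  forall s, 0 <= s <= T -> hderiv 0 T y s (dy s) /\
    hderiv 0 T dy s (- (lam s : R) * y s : R^o).

Lemma ord2_cases (P : 'I_2 -> Prop) : P 0 -> P 1 -> forall i, P i.
Proof.
move=> P0 P1 i; have : i = 0 \/ i = 1.
  by case: i => -[|[|//]] ilt; [left | right]; exact: val_inj.
by case=> ->.
Qed.

(** A first order system for the pair of [y] and its derivative; in the maximum norm [1 + B] is a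
    Lipschitz constant when [B] bounds [lam]. *)
Lemma jacobi_exists (T : R) lam : 0 <= T ->
  (forall t, 0 <= t <= T -> hcont 0 T lam t) ->
  exists y dy, [/\ jacobi_solution T lam y dy, y 0 = 0 & dy 0 = 1].
Proof.
move=> T0 Hlam; have [B B0 BP] := hcont_bounded T0 Hlam.
pose f (t : R) (x : 'rV[R]_2) : 'rV[R]_2 :=
  \row_i (if i == 0 then x 0 1 else - (lam t : R) * x 0 0).
have [|t tI x z|t tI x e e0|g [g0 gD]] := @picard R 2 0 T f (1 + B)
   (\row_i (if i == 0 then 0 else 1)) T0.
- by rewrite addr_gt0.
- rewrite rV_norm_le; last by rewrite mulr_ge0 // addr_ge0 // ltW.
  have n0 := normr_ge0 (x - z).
  apply/forallP; apply: ord2_cases; rewrite !mxE /=.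
    have := rV_coord_le (x - z) 1; rewrite !mxE => H.
    by apply: (le_trans H); rewrite mulrDl mul1r lerDl mulr_ge0 // ltW.
  have := rV_coord_le (x - z) 0; rewrite !mxE => H.
  rewrite -mulrBr normrM normrN; apply: ler_pM => //.
  by apply: (le_trans (BP t tI)); rewrite lerDr.
- have c0 : 0 < `|x 0 0| + 1 by rewrite ltr_wpDl.
  have e1 : 0 < e / (`|x 0 0| + 1) by rewrite divr_gt0.
  have [d d0 dP] := Hlam t tI _ e1; exists d => // s sI sd.
  have H := dP s sI sd.
  apply: (@le_lt_trans _ _ (`|lam s - lam t| * `|x 0 0|)).
    rewrite rV_norm_le; last by rewrite mulr_ge0.
    apply/forallP; apply: ord2_cases; rewrite !mxE /=.
      by rewrite subrr normr0 mulr_ge0.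
    by rewrite -mulrBl normrM opprK addrC distrC.
  rewrite (ltr_pdivlMr _ _ c0) in H.
  by apply: le_lt_trans H; apply: ler_wpM2l => //; rewrite lerDl.
exists (fun t => g t 0 0), (fun t => g t 0 1); split.
- move=> t tI; have H := gD t tI.
  by split; [have := hderiv_coord 0 H | have := hderiv_coord 1 H]; rewrite mxE.
- by rewrite g0 mxE.
- by rewrite g0 mxE.
Qed.

(** [gronwall] propagates from the left endpoint, so the system is rewritten in the reversed
    variable [t - s], where zero data at [t] become initial data. In use: a nontrivial solution has
    nonzero slope at each of its zeros. *)
Lemma jacobi_unique (T t : R) lam y dy : 0 <= t <= T ->
  (forall t, 0 <= t <= T -> hcont 0 T lam t) ->
  jacobi_solution T lam y dy -> y t = 0 -> dy t = 0 -> dy 0 = 0.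
Proof.
move=> /andP[t0 tT] Hlam H yt dyt; have T0 := le_trans t0 tT.
have [B B0 BP] := hcont_bounded T0 Hlam.
pose g (s : R) : 'rV[R]_2 := \row_i (if i == 0 then y (t - s) else dy (t - s)).
pose dg (s : R) : 'rV[R]_2 :=
  \row_i (if i == 0 then - dy (t - s) else lam (t - s) * y (t - s)).
have rev (f : R -> R^o) (s l : R) : 0 <= s <= t -> hderiv 0 T f (t - s) l ->
    hderiv 0 t (fun u => f (t - u)) s (- l).
  move=> sI Hf e e0; have [d d0 dP] := Hf e e0; exists d => // u uI ud.
  have E : t - u - (t - s) = - (u - s) by rewrite opprB addrC subrKA opprB addrC.
  have := dP (t - u); rewrite E normrN scaleNr scalerN => /(_ _ ud); apply.
  by move: uI; lra.
have gD s : 0 <= s <= t -> hderiv 0 t g s (dg s).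
  move=> sI; have tsI : 0 <= t - s <= T by move: sI; lra.
  have [D1 D2] := H _ tsI; apply: hderiv_rV; apply: ord2_cases; rewrite mxE /=.
    apply: hderiv_eq (rev _ _ _ sI D1); first by rewrite mxE.
    by exists 1 => // u _ _; rewrite mxE.
  have := rev _ _ _ sI D2; rewrite mulNr opprK.
  apply: hderiv_eq; first by rewrite mxE.
  by exists 1 => // u _ _; rewrite mxE.
have := @gronwall R _ 0 t g dg (1 + B) 0 (addr_gt0 ltr01 B0) (lexx _) gD.
have g0 : g 0 = 0.
  by apply/rowP; apply: ord2_cases; rewrite !mxE /= subr0.
have tI : 0 <= t <= t by rewrite t0 lexx.
move=> /(_ _ t tI); rewrite g0 normr0 mul0r addr0 mulr0 mul0r => G.
have : g t = 0.
  apply/eqP; rewrite -normr_le0; apply: G => s sI; rewrite addr0.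
  have tsI : 0 <= t - s <= T by move: sI; lra.
  have gn := normr_ge0 (g s).
  rewrite rV_norm_le; last by rewrite mulr_ge0 // addr_ge0 // ltW.
  apply/forallP; apply: ord2_cases; rewrite !mxE /=.
    have := rV_coord_le (g s) 1; rewrite mxE /= normrN => H1.
    by apply: (le_trans H1); rewrite mulrDl mul1r lerDl mulr_ge0 // ltW.
  have := rV_coord_le (g s) 0; rewrite mxE /= => H1.
  rewrite normrM; apply: ler_pM => //.
  by apply: (le_trans (BP _ tsI)); rewrite lerDr.
by move=> /(congr1 (fun h : 'rV[R]_2 => h 0 1)); rewrite !mxE /= subrr.
Qed.

Lemma hderiv_sin_lin (a b w t : R) :
  hderiv a b (fun s => sin (w * s) : R^o) t (w * cos (w * t) : R^o).
Proof.
have D : differentiable (sin : R^o -> R^o) (w * t) by exact/derivable1_diffP.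
have H0 : hderiv a b (fun s : R => s : R^o) t (1 : R^o).
  by apply: hderiv_eq (hderiv_shift a b 0 t); rewrite ?subr0 //; exists 1 => // s _ _; rewrite subr0.
have := hderiv_comp (hderivZ w H0) D.
rewrite -[_ *: (1 : R^o)]/(w * 1) mulr1 -[X in 'd _ _ X]mulr1.
rewrite -[X in 'd _ _ X]/(w *: (1 : R^o)) linearZ -deriveE //.
by rewrite derive_val.
Qed.

Lemma hderiv_cos_lin (a b w t : R) :
  hderiv a b (fun s => cos (w * s) : R^o) t (- (w * sin (w * t)) : R^o).
Proof.
have D : differentiable (cos : R^o -> R^o) (w * t) by exact/derivable1_diffP.
have H0 : hderiv a b (fun s : R => s : R^o) t (1 : R^o).
  by apply: hderiv_eq (hderiv_shift a b 0 t); rewrite ?subr0 //; exists 1 => // s _ _; rewrite subr0.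
have := hderiv_comp (hderivZ w H0) D.
rewrite -[_ *: (1 : R^o)]/(w * 1) mulr1 -[X in 'd _ _ X]mulr1.
rewrite -[X in 'd _ _ X]/(w *: (1 : R^o)) linearZ -deriveE //.
by rewrite derive_val -mulrN.
Qed.

(** Intermediate values by induction on the interval: values closer than [|y t|] to [y t] all have
    its sign. *)
Lemma positive_of_nonzero (a b : R) y : a <= b ->
  (forall t, a <= t <= b -> hcont a b y t /\ (y t : R) != 0) ->
  0 < (y a : R) -> 0 < (y b : R).
Proof.
move=> ab Hy ya; apply: (@real_induction R a b (fun s => 0 < (y s : R)) ab ya) => t tI.
have [cy yt] := Hy t tI; have e0 : 0 < `|y t| by rewrite normr_gt0.
have [d d0 dP] := cy _ e0; exists d => // s1 s2 /andP[as1 s1t] /andP[ts2 s2b] ds1 ds2 y1.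
have I1 : a <= s1 <= b by lra.
have I2 : a <= s2 <= b by lra.
have N1 : `|s1 - t| < d by rewrite ltr_norml; lra.
have N2 : `|s2 - t| < d by rewrite ltr_norml; lra.
have := dP s1 I1 N1; have := dP s2 I2 N2; rewrite !ltr_norml.
have gen (p q r : R) : 0 < p -> r != 0 -> - `|r| < q - r < `|r| -> - `|r| < p - r < `|r| -> 0 < q.
  by move=> p0 r0; case: (ger0P r) => ?; lra.
exact: gen.
Qed.

(* Sturm comparison with [sin (sqrt kappa t)], through the Wronskian. *)
Lemma sturm_zero (T kappa : R) lam y dy : 0 < kappa -> pi / Num.sqrt kappa <= T ->
  (forall t, 0 < t <= T -> kappa <= lam t) ->
  jacobi_solution T lam y dy -> y 0 = 0 -> dy 0 = 1 ->
  exists2 t : R, 0 < t <= pi / Num.sqrt kappa & y t = 0.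
Proof.
move=> k0 bT Hlam H y0 dy0; pose w := Num.sqrt kappa.
have w0 : 0 < w by rewrite sqrtr_gt0.
have ww : w * w = kappa by rewrite -expr2 sqr_sqrtr // ltW.
pose b := pi / w; have b0 : 0 < b by rewrite divr_gt0 // pi_gt0.
have wb : w * b = pi by rewrite /b mulrC divfK // gt_eqF.
apply: contrapT => nz.
have yn0 t : 0 < t <= b -> (y t : R) != 0.
  by move=> tI; apply/eqP => yt; apply: nz; exists t.
have HD t : 0 <= t <= b -> hderiv 0 b y t (dy t) /\
    hderiv 0 b dy t (- (lam t : R) * y t : R^o).
  move=> /andP[t0 tb]; have [|D1 D2] := H t; first by rewrite t0 (le_trans tb).
  by split; [exact: hderiv_sub D1 | exact: hderiv_sub D2].
have zI : (0 : R) <= 0 <= b by apply/andP; split=> //; exact: ltW.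
have ypos t : 0 < t <= b -> 0 < (y t : R).
  move=> /andP[t0 tb].
  (* With slope 1 at 0, accuracy [1 / 2] gives [y s >= s / 2] just after 0; in the absence of zeros
     the sign then persists up to [t]. *)
  have [d d0 dP] := (HD 0 zI).1 (2^-1) ltac:(by rewrite invr_gt0).
  pose s := Num.min (d / 2) t.
  have s0 : 0 < s by rewrite lt_min t0 divr_gt0.
  have st : s <= t by rewrite ge_min lexx orbT.
  have sd : s < d.
    by apply: (@le_lt_trans _ _ (d / 2)); [rewrite ge_min lexx | lra].
  have sI : 0 <= s <= b by rewrite ltW // (le_trans st).
  have ys : 0 < (y s : R).
    have := dP s sI; rewrite subr0 (ger0_norm (ltW s0)) => /(_ sd).
    rewrite y0 dy0 subr0 -[s *: (1 : R^o)]/(s * 1) mulr1 ler_norml => /andP[+ _].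
    by move: (y s : R) => z *; lra.
  apply: (positive_of_nonzero st) ys => u /andP[su ut]; split.
    apply: (hcont_sub (ltW s0) tb); apply: hderiv_cont (HD u _).1.
    by rewrite (le_trans (ltW s0)) // (le_trans ut).
  by apply: yn0; rewrite (lt_le_trans s0) // (le_trans ut).
(* [Wr] vanishes at 0 and its derivative [(lam - kappa) y sin (w s)] is nonnegative on [0, b]; yet
   at [b], where [w * b = pi], it equals [- w y(b)], which is negative. *)
pose Wr s : R^o := y s * (w * cos (w * s)) - dy s * sin (w * s).
pose dWr s : R^o := (lam s - kappa) * (y s * sin (w * s)).
have WD t : 0 <= t <= b -> hderiv 0 b Wr t (dWr t).
  move=> tI; have [D1 D2] := HD t tI.
  have C := @hderivZ R R^o 0 b w _ t _ (hderiv_cos_lin 0 b w t).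
  have S := hderiv_sin_lin 0 b w t.
  have := hderivB (hderiv_scale D1 C) (hderiv_scale D2 S).
  rewrite (_ : _ - _ = dWr t) //.
  rewrite /dWr -ww -[w *: _]/(w * _) -![_ *: (_ : R^o)]/(_ * _).
  move: (y t : R) (dy t : R) (lam t : R) (cos _) (sin _) => p q r ct st.
  rewrite -[LHS]/((q : R) * (w * ct) + p * (w * - (w * st)) - (- r * p * st + q * (w * ct))).
  by ring.
have dW0 t : 0 <= t <= b -> `|0 : R^o| <= dWr t.
  move=> /andP[t0 tb]; rewrite normr0 /dWr.
  (* The lower bound on [lam] is given at positive times only; at 0 the factor [y 0] vanishes. *)
  have [->|tn0] := eqVneq t 0; first by rewrite y0 mul0r mulr0.
  have tp : 0 < t by rewrite lt_neqAle eq_sym tn0.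
  apply: mulr_ge0; first by rewrite subr_ge0 Hlam // tp (le_trans tb).
  apply: mulr_ge0; first by apply/ltW/ypos; rewrite tp.
  apply: sin_ge0_pi; apply/andP; split; first by rewrite mulr_ge0 // ltW.
  by rewrite -wb ler_pM2l.
have := @mean_value_le R R^o 0 b (fun=> 0) (fun=> 0) Wr dWr (ltW b0)
  (fun t _ => hderiv_cst 0 b (0 : R^o) t) WD dW0.
rewrite subrr normr0 /Wr wb cospi sinpi mulr0 !mulr0 sin0 mulr0 y0 mul0r !subr0.
have := ypos b; rewrite lexx b0 => /(_ isT).
by move: (y b : R) => z z0; rewrite mulrN1 mulrN oppr_ge0 leNgt mulr_gt0.
Qed.

End ScalarJacobi.

(** * From zeros of the scalar equation to conjugate times *)

Section Conjugate.
Variables (R : realType) (n : nat) (M : manifold R n).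
Variables (X : M -> 'rV[R]_n) (V : M -> {vspace 'rV[R]_n}) (m : nat).
Hypothesis hreg : regular_pair X V m.
Variables (T : R) (c : R -> M).
Hypothesis T0 : 0 < T.
Hypothesis Hc : icurve X 0 T c.
Implicit Types (lam : R -> R) (L : R -> {vspace 'rV[R]_n}).

Lemma tangent_mapE (F : M -> M) p (v : 'rV[R]_n) :
  linfun (tangent_map F p) v = tangent_map F p v.
Proof. exact: lfunE. Qed.

Lemma parallel_eigenlineP L lam : parallel_eigenline X V m T c L lam ->
  exists v : R -> 'rV[R]_n,
    [/\ forall t : R, 0 <= t <= T ->
          [/\ v t \in V (c t), v t != 0 & covariant_deriv X V m T c v t 0],
        forall t : R, 0 <= t <= T -> curvature X V m (c t) (v t) (lam t *: v t) &
        forall t : R, 0 <= t <= T -> L t = <[v t]>%VS].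
Proof.
move=> [[v Hv] HL]; exists v; split=> t tI; have [? ? LE ?] := Hv t tI => //.
by apply: HL => //; rewrite LE memv_line.
Qed.

Lemma eigenline_cont L lam t : parallel_eigenline X V m T c L lam ->
  0 <= t <= T -> hcont 0 T (lam : R -> R^o) t.
Proof.
move=> /parallel_eigenlineP[v [Hv Hlam _]] tI.
exact: (eigenvalue_cont hreg Hc Hv Hlam tI).
Qed.

(** As [y] vanishes at both ends, the invariant field reduces there to multiples of [v]. The
    multiple at [t] is nonzero by [jacobi_unique], which puts the line [L t] itself into the
    conjugate space; knowing the line is what allows multiplicities to be counted. *)
Lemma eigenline_conjugate L lam (y dy : R -> R^o) t :
  parallel_eigenline X V m T c L lam -> jacobi_solution T lam y dy ->
  y 0 = 0 -> dy 0 != 0 -> 0 < t <= T -> y t = 0 ->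
  (L t <= conjugate_space X V c t)%VS.
Proof.
move=> PL H y0 dy0 /andP[t0 tT] yt; have tI : 0 <= t <= T by rewrite ltW.
have lc := eigenline_cont PL.
have dyt : dy t != 0.
  by apply/eqP => dyt; case/eqP: dy0; exact: jacobi_unique tI lc H yt dyt.
have [v [Hv Hlam LE]] := parallel_eigenlineP PL.
have zI : (0 : R) <= 0 <= T by rewrite lexx ltW.
have Ha s : 0 <= s <= T -> hderiv 0 T (fun s => - dy s) s (lam s * y s : R^o).
  by move=> sI; have := hderivN (H s sI).2; rewrite mulNr opprK.
have Hb s : 0 <= s <= T -> hderiv 0 T y s (- - dy s).
  by move=> sI; rewrite opprK; exact: (H s sI).1.
have J := jacobi_field hreg Hc Hv Hlam Ha Hb.
have [_ E0] := transport (regular_smooth hreg) Hc J tI.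
have drop s : y s = 0 -> (- dy s : R) *: v s = (- dy s : R) *: v s +
    (y s : R) *: hlift X V c v s.
  by move=> ->; rewrite scale0r addr0.
have E : tangent_map (flow X t) (c 0) (- (dy 0 : R) *: v 0) = - (dy t : R) *: v t.
  exact: etrans (congr1 _ (drop 0 y0)) (etrans E0 (esym (drop t yt))).
rewrite LE // -memvE /conjugate_space memv_cap; have [vV _ _] := Hv t tI.
rewrite vV andbT.
have -> : v t = linfun (tangent_map (flow X t) (c 0))
    ((- dy t)^-1 *: (- (dy 0 : R) *: v 0)).
  by rewrite linearZ /= tangent_mapE E scalerA mulVf ?scale1r // oppr_eq0.
apply: memv_img; apply: memvZ; apply: memvZ.
by have [] := Hv 0 zI.
Qed.

Lemma eigenline_neq0 L lam t : parallel_eigenline X V m T c L lam ->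
  0 <= t <= T -> \dim (L t) = 1%N.
Proof.
move=> /parallel_eigenlineP[v [Hv _ LE]] tI; have [_ v0 _] := Hv t tI.
by rewrite LE // dim_vline v0.
Qed.

Lemma jacobi_zeroP lam t : jacobi_zero T lam t ->
  exists y dy, [/\ jacobi_solution T lam y dy, y 0 = 0, dy 0 != 0 & y t = 0].
Proof.
move=> [y [dy [Hy Hdy y0 dy0 yt]]]; exists y, dy; split=> // s sI.
by split; [apply/has_derivP => //; exact: Hy | apply/has_derivP => //; exact: Hdy].
Qed.

Lemma jacobi_zero_conjugate L lam t : parallel_eigenline X V m T c L lam ->
  0 < t <= T -> jacobi_zero T lam t -> (L t <= conjugate_space X V c t)%VS.
Proof.
move=> PL tI /jacobi_zeroP[y [dy [H y0 dy0 yt]]].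
exact: eigenline_conjugate PL H y0 dy0 tI yt.
Qed.

Lemma conjugate_time_line L lam t : parallel_eigenline X V m T c L lam ->
  0 < t <= T -> (L t <= conjugate_space X V c t)%VS -> conjugate_time X V T c t.
Proof.
move=> PL tI sub; split=> //; apply/eqP => E0.
have tI' : 0 <= t <= T by move/andP: tI => [/ltW -> ->].
by have := dimvS sub; rewrite E0 (eigenline_neq0 PL tI') dimv0.
Qed.

Lemma sturm_conjugate L lam kappa : parallel_eigenline X V m T c L lam ->
  0 < kappa -> (forall t, 0 < t <= T -> kappa <= lam t) ->
  pi / Num.sqrt kappa <= T ->
  exists2 t : R, 0 < t <= pi / Num.sqrt kappa & conjugate_time X V T c t.
Proof.
move=> PL k0 Hk bT.
have [y [dy [H y0 dy0]]] := jacobi_exists (ltW T0) (fun t => eigenline_cont PL (t := t)).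
have [t tI yt] := sturm_zero k0 bT Hk H y0 dy0.
have tT : 0 < t <= T by have /andP[-> /le_trans] := tI; apply.
exists t => //; apply: (conjugate_time_line PL tT).
by apply: (eigenline_conjugate PL H y0 _ tT yt); rewrite dy0 oner_neq0.
Qed.

(** Each line contributes dimension one to a direct sum inside the conjugate space. *)
Lemma conjugate_multiplicity (r : nat) (L : 'I_r -> R -> {vspace 'rV[R]_n})
    (lam : 'I_r -> R -> R) (I : {set 'I_r}) t :
  (forall i, parallel_eigenline X V m T c (L i) (lam i)) -> 0 < t <= T ->
  directv (\sum_(i in I) L i t)%VS -> (forall i, i \in I -> jacobi_zero T (lam i) t) ->
  (#|I| <= multiplicity X V c t)%N.
Proof.
move=> PL tI dir HI; have tI' : 0 <= t <= T by move/andP: tI => [/ltW -> ->].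
have sub : (\sum_(i in I) L i t <= conjugate_space X V c t)%VS.
  by apply/subv_sumP => i iI; exact: jacobi_zero_conjugate (PL i) tI (HI i iI).
apply: leq_trans (dimvS sub).
rewrite (directvP dir) /= -sum1_card.
by apply: leq_sum => i _; rewrite (eigenline_neq0 (PL i) tI').
Qed.

End Conjugate.

(** * Parallel eigenlines and diagonal blocks of the normal curvature matrix *)

Section NormalMatrix.
Variables (R : realType) (n : nat) (M : manifold R n).
Variables (X : M -> 'rV[R]_n) (V : M -> {vspace 'rV[R]_n}) (m : nat).
Hypothesis hreg : regular_pair X V m.
Variables (T : R) (c : R -> M).
Hypothesis T0 : 0 < T.
Hypothesis Hc : icurve X 0 T c.

Let HX := regular_smooth hreg.

(** Brackets are linear over constants, so normality survives; the condition on [A] is independence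
    of its columns, which keeps the new family a basis. *)
Lemma normal_frame_change U (E : 'I_m -> M -> 'rV[R]_n) (A : 'M[R]_m) :
  normal_frame X V U E ->
  (forall a : 'I_m -> R, (forall l, \sum_i a i * A l i = 0) -> forall i, a i = 0) ->
  normal_frame X V U (fun i q => \sum_l A l i *: E l q).
Proof.
move=> NE inj; have [FE _] := NE.
have NS i := normal_frame_section hreg (fun l => A l i) NE.
split; last by move=> i; exact: (NS i).2.
split; first by move=> i; exact: (NS i).1.
split; first exact: frame_open FE.
move=> q Uq; have [_ [_ bE]] := FE; rewrite basisEfree; apply/and3P; split.
- apply/freeP => a.
  under eq_bigr do rewrite -tnth_nth tnth_mktuple scaler_sumr.
  rewrite exchange_big /= => H; apply: inj => l.
  apply: (frame_free FE Uq (a := fun l => \sum_i a i * A l i)).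
  rewrite -[RHS]H; apply: eq_bigr => k _; rewrite scaler_suml.
  by apply: eq_bigr => i _; rewrite scalerA.
- by apply/span_subvP => _ /mapP[i _ ->]; exact: frame_mem FE Uq.
- by rewrite size_tuple -(size_basis (bE q Uq)) .
Qed.

Lemma normal_frame_section_of U (E : 'I_m -> M -> 'rV[R]_n) i :
  normal_frame X V U E -> normal_section X V U (E i).
Proof. by move=> [[HE _] HN]; split; [exact: HE | exact: HN]. Qed.

Lemma covariant_deriv_frame (T' : R) U (W : 'I_m -> M -> 'rV[R]_n) i t
    (v : R -> 'rV[R]_n) :
  0 <= t <= T' -> normal_frame X V U W -> U (c t) ->
  (\forall s \near t, 0 <= s <= T' -> v s = W i (c s)) ->
  covariant_deriv X V m T' c v t 0.
Proof.
move=> tI NW Uc Hv; exists U, W, (fun l _ => (l == i)%:R), (fun=> 0); split=> //.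
- apply: filterS Hv => s H sI; rewrite (H sI) (bigD1 i) //= eqxx scale1r.
  by rewrite big1 ?addr0 // => l /negbTE ->; rewrite scale0r.
- by move=> l; apply/has_derivP => //; exact: hderiv_cst.
- by rewrite big1 // => l _; rewrite scale0r.
Qed.

(** Column [j] makes [E j] an eigenvector at each time, and a member of a normal frame along [c] is
    parallel since its coordinates in that frame are constant. *)
Lemma normal_matrix_eigenline (N : R -> 'M[R]_m) (j : 'I_m) (lam : R -> R) :
  normal_curvature_matrix X V T c N ->
  (forall t : R, 0 <= t <= T -> forall i, N t i j = if i == j then lam t else 0) ->
  exists L, parallel_eigenline X V m T c L lam.
Proof.
move=> [E [HE HN]] Nj; exists (fun t => <[E j t]>%VS).
have nearE t : 0 <= t <= T -> exists U W, [/\ U (c t), normal_frame X V U W,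
    \forall s \near t, 0 <= s <= T -> E j s = W j (c s) & E j t = W j (c t)].
  move=> tI; have [U [W [Uc NW near_E]]] := HE t tI; exists U, W; split=> //.
    by apply: filterS near_E => s H sI; exact: H.
  exact: nbhs_singleton near_E tI j.
split.
  exists (E j) => t tI; have [U [W [Uc NW near_E Et]]] := nearE t tI; split=> //.
  - by rewrite Et; have [_ _ H] := NW.1.1 j; exact: H.
  - rewrite Et; apply/eqP => W0.
    have := frame_free NW.1 Uc (a := fun l => (l == j)%:R).
    rewrite (bigD1 j) //= eqxx W0 scaler0 add0r big1; last first.
      by move=> l /negbTE ->; rewrite scale0r.
    by move=> /(_ erefl j); rewrite eqxx => /eqP; rewrite oner_eq0.
  - exact: covariant_deriv_frame tI NW Uc near_E.
move=> t tI v /vlineP[k ->].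
have [U [W [H0 [H1 [a [Uc FW SW Ea Ka]]]]]] := HN t tI j.
exists U, W, H0, H1, (k *: a); split=> //.
  by rewrite Ea scaler_sumr; apply: eq_bigr => i _; rewrite scalerA mxE.
have -> : lam t *: (k *: E j t) = k *: (\sum_i N t i j *: E i t).
  rewrite (bigD1 j) //= Nj // eqxx big1 ?addr0 ?scalerA 1?mulrC //.
  by move=> i /negbTE ij; rewrite Nj // ij scale0r.
rewrite Ka scaler_sumr; apply: eq_bigr => i _.
by rewrite -scalemxAr scalerA [in RHS]mxE.
Qed.

Section Extend.
Variables (L : R -> {vspace 'rV[R]_n}) (lam : R -> R) (v : R -> 'rV[R]_n).
Hypothesis Hv : forall t : R, 0 <= t <= T ->
  [/\ v t \in V (c t), v t != 0 & covariant_deriv X V m T c v t 0].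

Lemma normal_frame_at t : 0 <= t <= T ->
  exists U (E : 'I_m -> M -> 'rV[R]_n), U (c t) /\ normal_frame X V U E.
Proof.
by move=> tI; have [_ _ [U [E [_ [_ [[Uc NE] _ _ _]]]]]] := Hv tI; exists U, E.
Qed.

(** Exchange argument: some coordinate [k j] of [v 0] is nonzero, and [A] is the identity matrix
    with column [j] replaced by the coordinates of [v 0]. The index [j] found here remains the
    column of the block at all times. *)
Lemma initial_normal_frame : exists (j : 'I_m) (E : 'I_m -> R -> 'rV[R]_n),
  normal_frame_along X V 0 c E /\ E j 0 = v 0.
Proof.
have zI : (0 : R) <= 0 <= T by rewrite lexx ltW.
have [U [E [Uc NE]]] := normal_frame_at zI; have [vV vn0 _] := Hv zI.
pose k i := frame_coord E i (c 0) (v 0).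
have [j kj] : exists j, k j != 0.
  apply/existsP; rewrite -negb_forall; apply/negP => /forallP H.
  case/negP: vn0; rewrite (frame_coordE NE.1 Uc vV) big1 // => i _.
  by rewrite -/(k i) (eqP (H i)) scale0r.
pose A : 'M[R]_m := \matrix_(l, i) if i == j then k l else (l == i)%:R.
have AE (a : 'I_m -> R) l : \sum_i a i * A l i =
    a j * k l + (if l == j then 0 else a l).
  rewrite (bigD1 j) //= mxE eqxx; congr (_ + _).
  case: (eqVneq l j) => [->|lj].
    by rewrite big1 // => i /negbTE ij; rewrite mxE ij eq_sym ij mulr0.
  rewrite (bigD1 l) //= mxE (negbTE lj) eqxx mulr1 big1 ?addr0 // => i.
  move=> /andP[/negbTE ij /negbTE il].
  by rewrite mxE ij eq_sym il mulr0.
have inj (a : 'I_m -> R) : (forall l, \sum_i a i * A l i = 0) -> forall i, a i = 0.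
  move=> H; have aj : a j = 0.
    have := H j; rewrite AE eqxx addr0 => /eqP; rewrite mulf_eq0 (negbTE kj) orbF.
    by move/eqP.
  by move=> i; have := H i; rewrite AE aj mul0r add0r; case: eqP => [->|].
have NW := normal_frame_change NE inj.
exists j, (fun i t => \sum_l A l i *: E l (c t)); split.
  move=> t /le_anti <-; exists U, (fun i q => \sum_l A l i *: E l q).
  by split=> //; apply/(near_itvP 0); exists 1.
rewrite [RHS](frame_coordE NE.1 Uc vV); apply: eq_bigr => l _.
by rewrite mxE eqxx.
Qed.

(** Normal frames are available only locally. The induction recombines the local frame [W] around
    [c t0] by the constant matrix [A] that matches the frame built so far at time [s1]. *)
Lemma normal_frame_along_v : exists (j : 'I_m) (E : 'I_m -> R -> 'rV[R]_n),
  normal_frame_along X V T c E /\ forall t, 0 <= t <= T -> E j t = v t.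
Proof.
have [j [E0 [HE0 E0j]]] := initial_normal_frame; exists j.
apply: (@real_induction R 0 T (fun s => exists E : 'I_m -> R -> 'rV[R]_n,
  normal_frame_along X V s c E /\ forall t, 0 <= t <= s -> E j t = v t) (ltW T0)).
  by exists E0; split=> // t /le_anti <-.
move=> t0 t0I; have [U [W [Uc0 NW]]] := normal_frame_at t0I.
have oU := frame_open NW.1.
have [d1 d10 P1] := icurve_near Hc t0I (open_nbhs_nbhs (conj oU Uc0)).
have [|d2 d20 P2] := parallel_comb hreg Hc (v := v) NW t0I Uc0.
  by exists 1 => // t tI _; have [] := Hv tI.
exists (Num.min d1 d2); first by rewrite lt_min d10.
move=> s1 s2 /andP[s10 s1t] /andP[ts2 s2T]; rewrite !lt_min.
move=> /andP[sd1 sd2] /andP[sd3 sd4] [E [HE Ej]].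
have s12 : s1 <= s2 := le_trans s1t ts2.
have nt s : s1 <= s <= s2 -> [/\ 0 <= s <= T, `|s - t0| < d1 & `|s - t0| < d2].
  by move=> /andP[? ?]; rewrite !ltr_norml; split; lra.
have I11 : s1 <= s1 <= s2 by rewrite lexx.
have I01 : 0 <= s1 <= s1 by rewrite s10 lexx.
have Us s : s1 <= s <= s2 -> U (c s) by move=> /nt[sI sd _]; exact: P1.
pose A : 'M[R]_m := \matrix_(l, i) frame_coord W l (c s1) (E i s1).
have [U1 [W1 [U1c NW1 near1]]] := HE s1 I01.
have E1 i : E i s1 = W1 i (c s1) by exact: nbhs_singleton near1 I01 i.
have EV i : E i s1 \in V (c s1).
  by rewrite E1; have [_ _ H] := NW1.1.1 i; exact: H.
have AE i : \sum_l A l i *: W l (c s1) = E i s1.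
  rewrite [RHS](frame_coordE NW.1 (Us s1 I11) (EV i)).
  by apply: eq_bigr => l _; rewrite mxE.
have inj (a : 'I_m -> R) : (forall l, \sum_i a i * A l i = 0) -> forall i, a i = 0.
  move=> H; apply: (frame_free NW1.1 U1c (a := a)).
  under eq_bigr do rewrite -E1 -AE scaler_sumr.
  rewrite exchange_big big1 //= => l _.
  under eq_bigr do rewrite scalerA.
  by rewrite -scaler_suml H scale0r.
have NA := normal_frame_change NW inj.
pose E' i s := if s <= s1 then E i s else \sum_l A l i *: W l (c s).
have E'L i s : s <= s1 -> E' i s = E i s by rewrite /E' => ->.
have E'R i s : s1 <= s -> E' i s = \sum_l A l i *: W l (c s).
  rewrite /E'; case: (leP s s1) => // ss1 s1s.
  by have -> : s = s1 by apply/eqP; rewrite eq_le ss1.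
(* At [s1] the glued frame must come from one normal frame on both sides. Immediately to the left,
   the old frame and the recombined [W] coincide, because members of the old frame have constant
   coordinates in [W]. *)
have near_s1 i : exists2 d : R, 0 < d & forall s, 0 <= s <= s1 -> `|s - s1| < d ->
    E i s = \sum_l A l i *: W l (c s).
  have Hc1 : icurve X 0 s1 c by apply: icurve_sub Hc => //; exact: le_trans s12 s2T.
  have [e1 e10 Q1] := (near_itvP s1 _ _).1 near1.
  have [e2 e20 Q2] := icurve_near Hc1 I01
    (open_nbhs_nbhs (conj (frame_open NW1.1) U1c)).
  have [|e3 e30 Q3] := parallel_comb hreg Hc1 (v := fun s => W1 i (c s)) NW I01 (Us s1 I11).
    exists e2 => // s sI se; have U1s := Q2 s sI se; split.
      by have [_ _ H] := NW1.1.1 i; exact: H.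
    by apply: (covariant_deriv_frame sI NW1 U1s (i := i)); apply/(near_itvP s1); exists 1.
  exists (Num.min e1 e3); first by rewrite lt_min e10.
  move=> s sI; rewrite lt_min => /andP[se1 se3].
  rewrite (Q1 s sI se1 i) (Q3 s sI se3).
  by apply: eq_bigr => l _; rewrite mxE E1.
exists E'; split.
  move=> t /andP[t00 ts]; have [ts1|s1t'] := ltP t s1.
    have tI1 : 0 <= t <= s1 by rewrite t00 ltW.
    have [U2 [W2 [U2c NW2 near2]]] := HE t tI1; exists U2, W2; split=> //.
    have [e e0 eP] := (near_itvP s1 _ _).1 near2.
    apply/(near_itvP s2); exists (Num.min e (s1 - t)).
      by rewrite lt_min e0 subr_gt0.
    move=> s /andP[s0 _]; rewrite lt_min => /andP[se sst] i.
    have ss1 : s <= s1 by move: sst; rewrite ltr_norml => /andP[_ ?]; apply: ltW; lra.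
    by rewrite E'L //; apply: eP => //; rewrite s0.
  exists U, (fun i q => \sum_l A l i *: W l q); split=> //.
    by apply: Us; rewrite s1t'.
  move: s1t'; rewrite le_eqVlt => /orP[/eqP <-|s1t'].
    have H : \forall s \near s1, forall i, 0 <= s <= s1 ->
        E i s = \sum_l A l i *: W l (c s).
      have /filter_forall : forall i, nbhs s1 [set s | 0 <= s <= s1 ->
          E i s = \sum_l A l i *: W l (c s)] by move=> i; apply/(near_itvP s1).
      exact.
    apply: filterS H => s Hs /andP[s0 _] i; have [ss1|/ltW s1s] := leP s s1.
      by rewrite E'L // Hs // s0.
    exact: E'R.
  apply/(near_itvP s2); exists (t - s1); first by rewrite subr_gt0.
  move=> s _; rewrite ltr_norml => /andP[? _] i.
  by apply: E'R; apply: ltW; lra.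
move=> t /andP[t00 ts]; have [ts1|/ltW s1t'] := leP t s1.
  by rewrite E'L //; apply: Ej; rewrite t00.
have tI : s1 <= t <= s2 by rewrite s1t'.
have [tT _ td2] := nt t tI; have [s1T _ sd2'] := nt s1 I11.
rewrite E'R // (P2 t tT td2); apply: eq_bigr => l _; congr (_ *: _).
rewrite mxE (Ej s1 I01); have [vV _ _] := Hv s1T.
(* On the new piece both [v] and the member [j] of the frame have constant coordinates in [W], so
   agreement at [s1] is enough. *)
have E2 : \sum_i frame_coord W i (c t0) (v t0) *: W i (c s1) =
    \sum_i frame_coord W i (c s1) (v s1) *: W i (c s1).
  by rewrite -(frame_coordE NW.1 (Us s1 I11) vV); apply/esym/P2.
exact: esym (frame_eq NW.1 (Us s1 I11) E2 l).
Qed.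

End Extend.

(** At each time the matrix is the curvature matrix of a local normal frame extending [E], selected
    by choice. Column [j] is identified by computing the curvature of [v] twice, from the eigenvalue
    and from the matrix: [curvature_section] equates both with the same bracket. *)
Lemma eigenline_normal_matrix (lam : R -> R) L :
  parallel_eigenline X V m T c L lam ->
  exists (N : R -> 'M[R]_m) (j : 'I_m), normal_curvature_matrix X V T c N /\
    forall t : R, 0 <= t <= T -> forall i, N t i j = if i == j then lam t else 0.
Proof.
move=> /parallel_eigenlineP[v [Hv Hlam _]].
have [j [E [HE Ej]]] := normal_frame_along_v Hv.
have pointwise (t : R) : exists A : 'M[R]_m, 0 <= t <= T ->
    (forall l, curvature X V m (c t) (E l t) (\sum_i A i l *: E i t)) /\
    forall i, A i j = if i == j then lam t else 0.
  have [tI|ntI] := boolP (0 <= t <= T); last by exists 0.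
  have [U [W [Uc NW near_E]]] := HE t tI.
  have Et i : E i t = W i (c t) by exact: nbhs_singleton near_E tI i.
  pose H0 q := \matrix_(i, k) frame_coord W i q (bracket X (bracket X (W k)) q).
  have SW : structure_eq X U W H0 (fun=> 0) := normal_frame_structure NW.
  pose K := curvature_matrix X H0 (fun=> 0) (c t).
  have curvK l : curvature X V m (c t) (W l (c t)) (\sum_i K i l *: W i (c t)).
    exists U, W, H0, (fun=> 0), (\col_i (i == l)%:R); split=> //.
    - exact: NW.1.
    - rewrite (bigD1 l) //= mxE eqxx scale1r big1 ?addr0 // => i /negbTE il.
      by rewrite mxE il scale0r.
    - apply: eq_bigr => i _; congr (_ *: _); rewrite [RHS]mxE (bigD1 l) //= [in RHS]mxE eqxx.
      by rewrite mulr1 big1 ?addr0 // => k /negbTE kl; rewrite mxE kl mulr0.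
  exists K => _; split.
    move=> l; rewrite Et; have := curvK l.
    by congr (curvature _ _ _ _ _ _); apply: eq_bigr => i _; rewrite Et.
  have NS := normal_frame_section_of j NW.
  have vW : v t = W j (c t) by rewrite -Et Ej.
  have C1 := Hlam t tI; rewrite vW in C1.
  have e1 := curvature_section hreg NS Uc C1.
  have e2 := curvature_section hreg NS Uc (curvK j).
  have e3 : \sum_i K i j *: W i (c t) =
      \sum_i (if i == j then lam t else 0) *: W i (c t).
    rewrite e2 -e1 (bigD1 j) //= eqxx big1 ?addr0 //.
    by move=> i /negbTE ->; rewrite scale0r.
  exact: frame_eq NW.1 Uc e3.
have [N NP] := choice pointwise.
exists N, j; split; last by move=> t /NP[].
by exists E; split=> // t tI l; have [H _] := NP t tI; exact: H.
Qed.

End NormalMatrix.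

Theorem theorem3p8 (R : realType) (n m : nat) (M : manifold R n)
    (X : M -> 'rV[R]_n) (V : M -> {vspace 'rV[R]_n})
    (hreg : regular_pair X V m)
    (T : R) (hT : 0 < T) (c : R -> M)
    (hc : integral_curve X T c) (hopen : ~ closed_orbit T c) :
  (* (i), the two forms of the hypothesis being equivalent *)
  [/\ forall lam : R -> R,
        (exists L, parallel_eigenline X V m T c L lam) <->
        (exists (N : R -> 'M[R]_m) (j : 'I_m),
          normal_curvature_matrix X V T c N /\
          forall t : R, 0 <= t <= T -> forall i,
            N t i j = if i == j then lam t else 0),
      forall (L : R -> {vspace 'rV[R]_n}) (lam : R -> R) (kappa : R),
        parallel_eigenline X V m T c L lam ->
        0 < kappa -> (forall t : R, 0 < t <= T -> kappa <= lam t) ->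
        pi / Num.sqrt kappa <= T ->
        exists2 t : R, 0 < t <= pi / Num.sqrt kappa & conjugate_time X V T c t
  (* (ii) *)
    & forall (r : nat) (L : 'I_r -> R -> {vspace 'rV[R]_n})
        (lam : 'I_r -> R -> R),
        (forall i, parallel_eigenline X V m T c (L i) (lam i)) ->
        (forall t : R, 0 < t <= T -> forall i, jacobi_zero T (lam i) t ->
           conjugate_time X V T c t) /\
        (forall (t : R) (I : {set 'I_r}), 0 < t <= T ->
           (forall s : R, 0 <= s <= T -> directv (\sum_(i in I) L i s)%VS) ->
           (forall i, i \in I -> jacobi_zero T (lam i) t) ->
           (#|I| <= multiplicity X V c t)%N)].
Proof.
have Hc : icurve X 0 T c by exact/icurveP.
split=> [lam|L lam kappa|r L lam PL].
- split=> [[L PL]|[N [j [HN Nj]]]].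
    exact: (eigenline_normal_matrix hreg hT Hc PL).
  exact: (normal_matrix_eigenline HN Nj).
- exact: sturm_conjugate.
- split=> [t tI i Z|t I tI dir Z].
    apply: (conjugate_time_line (PL i) tI).
    exact: (jacobi_zero_conjugate hreg hT Hc (PL i) tI Z).
  apply: (conjugate_multiplicity hreg hT Hc PL tI _ Z).
  by apply: dir; move/andP: tI => [/ltW -> ->].
Qed.
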